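(* Let $1\leqslant\kappa\leqslant q-1$, put $r=(q+1)/2$, let $\mathbb{P}^1(\mathbb{F}_q)=\coprod_{i=1}^r\{a_i,b_i\}$ be a decomposition into $r$ pairs, and let $$f_\kappa^T(z)=\sum_{\gamma\in\Gamma(T)}\prod_{i=1}^ru(z;\gamma a_i,\gamma b_i)^\kappa.$$ Then $f_\kappa^T\in M_{\kappa(q+1)}^{\kappa q}(\Gamma(T))$ and $f_\kappa^T=C_0^\kappa\,h^\kappa$.
   Context: $q$ is an odd prime power, $A=\mathbb{F}_q[T]$, $F=\mathbb{F}_q(T)$, $F_\infty=\mathbb{F}_q((1/T))$, $\mathbb{C}_\infty$ is the completion of an algebraic closure of $F_\infty$, $\Omega=\mathbb{C}_\infty\setminus F_\infty$, $|z|_i=\inf_{x\in F_\infty}|z-x|$, $G=\mathrm{GL}_2(A)$. $\Gamma(T)=\ker(\mathrm{GL}_2(A)\to\mathrm{GL}_2(A/TA))$; its cusps (orbits in $\mathbb{P}^1(F)$) are represented by the $q+1$ points of $\mathbb{P}^1(\mathbb{F}_q)$. $u(z;a,b)=\frac1{z-b}-\frac1{z-a}$ with $\frac1{z-\infty}=0$. The series $f_\kappa^T$ converges locally uniformly on $\Omega$. $$C_0=\prod_{1\leqslant i\leqslant r,\ \infty\notin\{a_i,b_i\}}(b_i-a_i)\in\mathbb{F}_q^\times.$$ For an $\mathbb{F}_q$-lattice $\Lambda\subset\mathbb{C}_\infty$, $e_\Lambda(z)=z\prod_{b\in\Lambda\setminus\{0\}}(1-z/b)$ and $t_\Lambda=1/e_\Lambda$.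 With $j_\gamma(z)=cz+d$ for $\gamma=\begin{pmatrix}a&b\\c&d\end{pmatrix}$ and $K=\begin{pmatrix}\mathbb{F}_q^\times&A\\0&1\end{pmatrix}$, $$h(z)=\sum_{[\gamma]\in K\backslash G}\frac{\det\gamma}{j_\gamma(z)^{q+1}}\,t_A(\gamma z),$$ which is a Drinfeld modular form of weight $q+1$ and type $1$ for $G$. $M_w^n(\Gamma(T))$ is the space of rigid holomorphic $f\colon\Omega\to\mathbb{C}_\infty$ with $f(\gamma z)=j_\gamma(z)^wf(z)$ for $\gamma\in\Gamma(T)$ that vanish to order $\geqslant n$ at every cusp: for every $\nu\in\mathrm{GL}_2(\mathbb{F}_q)$, the function $j_\nu(z)^{-w}f(\nu z)$ has, for $|z|_i$ large, an expansion $\sum_{m\geqslant n}c_m\,t_{TA}(z)^m$ with positive radius of convergence.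
   Formalization: The formula f = C_0^κ h^κ is proved when ∞ is one of the a_i; when ∞ is one of the b_i, the formula proved is f = (−C_0)^κ h^κ, since swapping a_i and b_i in that pair changes f by (−1)^κ but not C_0 or h, so the stated formula fails there for odd κ. *)

(* Defs.v *)
From HB Require Import structures.
From mathcomp Require Import all_boot all_order all_algebra.
From mathcomp Require Import finmap.
From mathcomp Require Import all_classical all_reals all_analysis.
From mathcomp Require Import summability.

Set Implicit Arguments.
Unset Strict Implicit.
Unset Printing Implicit Defensive.

Import Order.TTheory GRing.Theory Num.Theory.

Local Open Scope classical_set_scope.
Local Open Scope ring_scope.

Record ultranorm (R : realType) (C : fieldType) := Ultranorm {
  uabs :> C -> R ;
  uabs_ge0 : forall x, 0 <= uabs x ;
  uabs_eq0 : forall x, (uabs x == 0) = (x == 0) ;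
  uabsM : forall x y, uabs (x * y) = uabs x * uabs y ;
  uabsD : forall x y, uabs (x + y) <= Num.max (uabs x) (uabs y)
}.

(* C with the metric topology of v.  The library's normed modules do not
   apply: they require |x *+ n| = |x| *+ n, which fails for ultrametric
   absolute values. *)
Definition valued (R : realType) (C : fieldType) (v : ultranorm R C) : Type :=
  C.

Section ValuedTopology.
Variables (R : realType) (C : fieldType) (v : ultranorm R C).
Local Notation V := (valued v).

HB.instance Definition _ := GRing.Field.on V.
HB.instance Definition _ := isPointed.Build V 0.

Let dist (x y : V) : R := v (x - y).

Let distxx x : dist x x = 0.
Proof. by apply/eqP; rewrite /dist uabs_eq0 subrr. Qed.

Let dist_pos x y : dist x y = 0 -> x = y.
Proof. by move/eqP; rewrite uabs_eq0 subr_eq0 => /eqP. Qed.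

Let dist_sym x y : dist x y = dist y x.
Proof.
have n1 : v 1 = 1.
  have /mulfI : v 1 != 0 by rewrite uabs_eq0 oner_eq0.
  by apply; rewrite -uabsM !mulr1.
have nN1 : v (-1) = 1.
  apply/eqP; rewrite -(@pexpr_eq1 _ _ 2) ?uabs_ge0//.
  by rewrite expr2 -uabsM mulrNN mulr1 n1.
by rewrite /dist -opprB -mulN1r uabsM nN1 mul1r.
Qed.

Let dist_triangle y x z : dist x z <= dist x y + dist y z.
Proof.
rewrite /dist -(subrKA y); apply: (le_trans (uabsD _ _ _)).
by rewrite ge_max lerDl lerDr !uabs_ge0.
Qed.

HB.instance Definition _ :=
  isMetric.Build R V distxx dist_pos dist_sym dist_triangle.

End ValuedTopology.

(* Infinite sums and products are unordered: the limit of the finite partial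
   sums (products) along the directed set of finite subsets. *)
Definition unordered_sum (R : realType) (C : fieldType) (v : ultranorm R C)
    (I : choiceType) (D : set I) (F : I -> valued v) : valued v :=
  lim ((fun J : {fset I} => \sum_(i <- J | i \in D) F i) @ totally).

Definition unordered_prod (R : realType) (C : fieldType) (v : ultranorm R C)
    (I : choiceType) (D : set I) (F : I -> valued v) : valued v :=
  lim ((fun J : {fset I} => \prod_(i <- J | i \in D) F i) @ totally).

Section Uniformization.
Variables (R : realType) (Fq : finFieldType).
Variables (CC : fieldType) (v : ultranorm R CC).
Local Notation C := (valued v).
Variables (iota : {rmorphism {poly Fq} -> C}).

Local Notation q := #|Fq|.

Definition embc (x : Fq) : C := iota x%:P.

(* F_q((1/T)), as the set of sums of Laurent series
   \sum_(k >= 0) a_k T^(N - k) in C. *)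
Definition Finfty : set C :=
  [set x | exists (N : int) (a : nat -> Fq),
     series (fun k : nat => embc (a k) * iota 'X ^ (N - k%:Z)) @ \oo --> x].

(* C is a completion of an algebraic closure K of F_q((1/T)), for the absolute
   value with |T| = q; iota is the inclusion of A = F_q[T]. *)
Record is_Cinfty : Prop := IsCinfty {
  Cinfty_complete : forall F : set_system C,
    ProperFilter F -> cauchy F -> cvg F ;
  Cinfty_norm : forall p : {poly Fq}, p != 0 ->
    v (iota p) = q%:R ^+ (size p).-1 ;
  Cinfty_closure : exists (K : closedFieldType) (k : {rmorphism K -> C}),
    [/\ Finfty `<=` range k,
        forall x : K, exists P : {poly C},
          [/\ P != 0, forall i : nat, Finfty P`_i & root P (k x)]
      & dense (range k)]
}.

Definition Omega : set C := ~` Finfty.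

Definition imnorm (z : C) : R := inf [set v (z - x) | x in Finfty].

(* The standard affinoids exhausting Omega. *)
Definition Omega_n (n : nat) : set C :=
  [set z | Omega z /\ v z <= q%:R ^+ n /\ q%:R ^- n <= imnorm z].

(* On each affinoid, f is a uniform limit of rational functions without
   poles there. *)
Definition rigid_holomorphic (f : C -> C) : Prop :=
  forall (n : nat) (eps : R), 0 < eps ->
    exists P Q : {poly C}, forall z, Omega_n n z ->
      Q.[z] != 0 /\ v (f z - P.[z] / Q.[z]) < eps.

Definition autj (g : 'M[C]_2) (z : C) : C := g 1 0 * z + g 1 1.

Definition moebius (g : 'M[C]_2) (z : C) : C :=
  (g 0 0 * z + g 0 1) / autj g z.

(* The action on P^1(C) = option C, with None as the point at infinity. *)
Definition moebiusP1 (g : 'M[C]_2) (x : option C) : option C :=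
  if x is Some z then
    if autj g z == 0 then None else Some (moebius g z)
  else if g 1 0 == 0 then None else Some (g 0 0 / g 1 0).

Definition embA (g : 'M[{poly Fq}]_2) : 'M[C]_2 := map_mx iota g.

Definition GL2A : set 'M[{poly Fq}]_2 := [set g | g \in unitmx].

Definition GammaT : set 'M[{poly Fq}]_2 :=
  [set g | GL2A g /\ forall i j, 'X %| (g - 1%:M) i j].

Definition lattA : set C := range iota.
Definition lattTA : set C := [set iota ('X * p) | p in [set: {poly Fq}]].

Definition elatt (L : set C) (z : C) : C :=
  z * unordered_prod (L `\ 0) (fun b => 1 - z / b).

Definition tlatt (L : set C) (z : C) : C := (elatt L z)^-1.

Definition Ksub : set 'M[{poly Fq}]_2 :=
  [set k | exists (x : Fq) (p : {poly Fq}),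
     [/\ x != 0, k 0 0 = x%:P, k 0 1 = p, k 1 0 = 0 & k 1 1 = 1]].

Definition Kcoset (g : 'M[{poly Fq}]_2) : set 'M[{poly Fq}]_2 :=
  [set k *m g | k in Ksub].

Definition hterm (g : 'M[{poly Fq}]_2) (z : C) : C :=
  iota (\det g) / autj (embA g) z ^+ q.+1 * tlatt lattA (moebius (embA g) z).

(* Sum over the set of cosets; xget picks a representative of each of them
   (hterm only depends on the coset). *)
Definition hform (z : C) : C :=
  unordered_sum (Kcoset @` GL2A) (fun X => hterm (xget 1%:M X) z).

(* M_w^n(Gamma(T)); only the values of f on Omega matter. *)
Record modform (w n : nat) (f : C -> C) : Prop := Modform {
  modform_holo : rigid_holomorphic f ;
  modform_aut : forall g z, GammaT g -> Omega z ->
    f (moebius (embA g) z) = autj (embA g) z ^+ w * f z ;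
  modform_cusp : forall nu : 'M[Fq]_2, nu \in unitmx ->
    exists (c : nat -> C) (rho B : R),
      [/\ 0 < rho,
          forall m, (m < n)%N -> c m = 0,
          forall x : C, v x < rho ->
            cvg (series (fun m => c m * x ^+ m) @ \oo)
        & forall z, Omega z -> B < imnorm z ->
            series (fun m => c m * tlatt lattTA z ^+ m) @ \oo -->
              autj (map_mx embc nu) z ^- w * f (moebius (map_mx embc nu) z)]
}.

Definition polar (z : C) (x : option C) : C :=
  if x is Some b then (z - b)^-1 else 0.

Definition upair (z : C) (a b : option C) : C := polar z b - polar z a.

Definition fT (kappa r : nat) (a b : 'I_r -> option Fq) (z : C) : C :=
  unordered_sum GammaT (fun g => \prod_(i < r)
    upair z (moebiusP1 (embA g) (omap embc (a i)))
            (moebiusP1 (embA g) (omap embc (b i))) ^+ kappa).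

End Uniformization.

(* The points of P^1(F_q) are a_1, b_1, ..., a_r, b_r, without repetition. *)
Definition pair_decomposition (Fq : finFieldType) (r : nat)
    (a b : 'I_r -> option Fq) : Prop :=
  bijective (fun s : 'I_r + 'I_r =>
    match s with inl i => a i | inr i => b i end).

(* Exchanging a_i and b_i negates upair.  It also negates the factor
   b_i - a_i, but C0 has no factor for the pair of the point at infinity: the
   orientation of that pair is a sign that C0 does not see. *)
Definition C0 (Fq : finFieldType) (r : nat) (a b : 'I_r -> option Fq) : Fq :=
  \prod_(i < r | (a i != None) && (b i != None))
    (odflt 0 (b i) - odflt 0 (a i)).

(* Main.v *)
Require Import Defs.
From mathcomp Require Import all_boot all_order all_algebra all_field.
From mathcomp Require Import finmap.
From mathcomp Require Import all_classical all_reals all_analysis.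
From mathcomp Require Import summability.
From mathcomp Require Import ring lra zify.

(* Put D(x, y) = x^q y - x y^q = y \prod_c (x - c y), c in F_q.  The term of
   gamma in the series f_kappa^T is (+-C0 / D(gamma^-1 (z, 1)))^kappa, so that
   f_kappa^T = (+-C0)^kappa f_kappa, where f_k (fsum) is the sum of
   D(gamma (z, 1))^-k over Gamma(T); gathering the elements of Gamma(T) by
   cosets of translations gives h = f_1.  Hence everything reduces to
   f_k = f_1^k for 0 < k < q.

   Let S_k (Ssum) be the sum of D(M (z, 1))^-k over all the M = 1 mod T with
   entries in A.  As the sum of the (x + w)^-k over a finite F_q-space is the
   k-th power of the sum of the (x + w)^-1, S_k = S_1^k.  Computing Moore
   determinants of z, 1, T z, T, T^2 z, ... gives
   F_k = \sum_m m^(k q) \sum_n (m z + n)^-k = - (const)^k S_k.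
   Consider the operator g |-> L g = \sum_t g(t (x, y)), for t running over the
   reduced upper triangular matrices congruent to 1 mod T.  Then L F_k = zeta_k F_k
   with zeta_k = zeta_1^k, hence L S_k = zeta_k S_k, while L f_k = S_k by the
   Hermite normal form.  L is injective on functions that decay with the
   determinant, hence f_k = S_k / zeta_k = f_1^k.

   At infinity, f_1 is a multiple of F_1, and the sum of the (m z + n)^-1 over n
   is a rational function of t_(T A)(z), whose first coefficients are power
   sums of F_q-linear functions, which vanish.  So f_1 has order at least q. *)

Set Implicit Arguments.
Unset Strict Implicit.
Unset Printing Implicit Defensive.

Import Order.TTheory GRing.Theory Num.Theory.

Local Open Scope classical_set_scope.
Local Open Scope ring_scope.

(** * Finite F_q-vector spaces *)

(** The obstacle is the condition det = 1: Gamma(T) is not an affine F_q-space, so the identity that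
    yields S_k = S_1^k says nothing about f_k. Without the condition one gets S_k, and the Hermite
    form sorts the additional matrices by their triangular factor; it remains to undo L, which is
    possible once S_k is known to be an eigenvector. The series F_k shows this, because its inner
    sum runs over all n in A: summing over the residues b modulo 1 + T d either restores that sum or
    gives a multiple of q. The weight m^(k q) carries the exponent q because the numerator in
    Cramer's rule is then the Frobenius image of a determinant that column operations compute. The
    quotient of F_k by S_k contains y^(k q), which the triangular matrix multiplies by (1 + T d)^(k
    q); hence the exponent k q in zeta_k = \sum_n (1 + T n)^(-k q). Functions are taken in
    homogeneous variables (x, y) rather than in z, since L substitutes t (x, y) for (x, y); [nondeg]
    is the form of the condition on z that is stable under such substitutions. *)

Section FiniteFieldSums.
Variable Fq : finFieldType.
Local Notation q := #|Fq|.

Lemma card_gt1 : (1 < q)%N.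
Proof. exact: finNzRing_gt1. Qed.

Lemma card_gt0 : (0 < q)%N.
Proof. exact: ltnW card_gt1. Qed.

Lemma card_natr0 : q%:R = 0 :> Fq.
Proof.
have [p pr_p chp] := finPcharP Fq.
have /= -> := card_pprimeChar chp.
case E: (logn _ _) => [|n]; last first.
  by rewrite expnS mulrnA (mulrn_pchar chp) mul0rn.
have /= H := card_pprimeChar chp; rewrite E expn0 in H.
by have := card_gt1; rewrite H.
Qed.

Lemma sum_expr_finField (i : nat) : (i < q.-1)%N -> \sum_(c : Fq) c ^+ i = 0.
Proof.
case: i => [|i] hi.
  rewrite (eq_bigr (fun=> 1)) => [|c _]; last by rewrite expr0.
  by rewrite sumr_const -[RHS]card_natr0.
have [a /andP[a0 ai]|H] := pickP (fun a : Fq => (a != 0) && (a ^+ i.+1 != 1)).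
  have : (a ^+ i.+1 - 1) * \sum_(c : Fq) c ^+ i.+1 = 0.
    rewrite mulrBl mul1r mulr_sumr [X in _ - X](reindex_inj (mulfI a0)) /=.
    by rewrite -sumrB big1 // => c _; rewrite exprMn subrr.
  by move/eqP; rewrite mulf_eq0 subr_eq0 (negPf ai) => /eqP.
exfalso.
(* Otherwise ['X^(i.+1) - 1], of degree below q - 1, has all q - 1 nonzero constants as roots. *)
have p0 : 'X^(i.+1) - 1 != 0 :> {poly Fq} by rewrite -size_poly_gt0 size_XnsubC.
pose rs := [seq x <- enum Fq | x != 0].
have urs : uniq rs by rewrite filter_uniq ?enum_uniq.
have rrs : all (root ('X^(i.+1) - 1)) rs.
  apply/allP => x; rewrite mem_filter => /andP[x0 _].
  have /negbT := H x; rewrite x0 /= negbK => /eqP xi.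
  by rewrite /root !hornerE ?hornerXn xi subrr.
have := max_poly_roots p0 rrs urs; rewrite size_XnsubC //.
have -> : size rs = q.-1.
  rewrite -(cardC1 (0 : Fq)) size_filter cardE enumT /enum_mem size_filter.
  by rewrite -enumT; apply: eq_count => x; rewrite !inE.
by lia.
Qed.

Lemma sum_expr_card1 : \sum_(c : Fq) c ^+ q.-1 = -1.
Proof.
have q1 := card_gt1.
rewrite (bigD1 0) //= expr0n; have -> : (q.-1 == 0)%N = false by lia.
rewrite add0r (eq_bigr (fun=> 1)) => [|c c0]; last first.
  by apply: (mulIf c0); rewrite -exprSr mul1r prednK ?card_gt0 ?expf_card.
rewrite sumr_const (_ : #|_| = q.-1); last exact: cardC1.
apply/eqP; rewrite -subr_eq0 opprK -[X in _ + X]/(1%:R) -natrD addn1.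
by rewrite prednK ?card_gt0 // card_natr0.
Qed.

End FiniteFieldSums.

Section FqSpans.
Variables (Fq : finFieldType) (K : fieldType) (j : {rmorphism Fq -> K}).
Local Notation q := #|Fq|.
Implicit Types (x y b d w : K) (c : Fq) (bs : seq K).

Lemma card_natr0K : q%:R = 0 :> K.
Proof. by rewrite -(rmorph_nat j) card_natr0 rmorph0. Qed.

Lemma sum_jexpr i : (i < q.-1)%N -> \sum_(c : Fq) j c ^+ i = 0.
Proof.
move=> hi; rewrite (eq_bigr (fun c => j (c ^+ i))) => [|c _]; last first.
  by rewrite rmorphXn.
by rewrite -rmorph_sum sum_expr_finField ?rmorph0.
Qed.

Lemma frobj c : j c ^+ q = j c.
Proof. by rewrite -rmorphXn expf_card. Qed.

Lemma frobD x y : (x + y) ^+ q = x ^+ q + y ^+ q.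
Proof.
apply: exprDn_pchar; have [p pr_p chp] := finPcharP Fq.
have chK : p \in [pchar K] by rewrite (fmorph_pchar j).
by rewrite (eq_pnat _ (pcharf_eq chK)) (card_pprimeChar chp) pnatX pnat_id ?orbT.
Qed.

Lemma frobDX k x y : (x + y) ^+ (q ^ k) = x ^+ (q ^ k) + y ^+ (q ^ k).
Proof.
by elim: k => [|k IH]; rewrite ?expn0 ?expr1 // expnSr !exprM IH frobD.
Qed.

Lemma frobjX k c : j c ^+ (q ^ k) = j c.
Proof. by elim: k => [|k IH]; rewrite ?expn0 ?expr1 // expnSr exprM IH frobj. Qed.

Lemma frobN x : (- x) ^+ q = - x ^+ q.
Proof.
apply/eqP; rewrite -subr_eq0 opprK -frobD addNr expr0n.
by move: (card_gt1 Fq); case: q.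
Qed.

Lemma frobB x y : (x - y) ^+ q = x ^+ q - y ^+ q.
Proof. by rewrite frobD frobN. Qed.

Lemma frob_sum (I : Type) (r : seq I) (P : pred I) (F : I -> K) :
  (\sum_(i <- r | P i) F i) ^+ q = \sum_(i <- r | P i) F i ^+ q.
Proof.
elim/big_rec2: _ => [|i x y _ <-]; last by rewrite frobD.
by rewrite expr0n; move: (card_gt1 Fq); case: q.
Qed.

Lemma sum_shift_expr y i : (i < q.-1)%N -> \sum_(c : Fq) (y + j c) ^+ i = 0.
Proof.
move=> hi; under eq_bigr do rewrite exprDn.
rewrite exchange_big /= big1 // => -[k hk] _ /=.
under eq_bigr do rewrite -mulrnAl.
by rewrite -mulr_sumr sum_jexpr ?mulr0 //; lia.
Qed.

Lemma sum_shift_card1 y : \sum_(c : Fq) (y + j c) ^+ q.-1 = -1.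
Proof.
under eq_bigr do rewrite exprDn.
rewrite exchange_big /= big_ord_recr /= big1 => [|k _]; last first.
  under eq_bigr do rewrite -mulrnAl.
  by rewrite -mulr_sumr sum_jexpr ?mulr0.
rewrite add0r subnn expr0 binn.
rewrite (eq_bigr (fun c => j (c ^+ q.-1))) => [|c _].
  by rewrite -rmorph_sum sum_expr_card1 rmorphN1.
by rewrite rmorphXn mul1r mulr1n.
Qed.

(** Homogeneous form of the factorization of X^q - X; d = 0 is included because [moore2_prod] holds
    for arbitrary arguments. *)
Lemma prod_shift (y d : K) : \prod_(c : Fq) (y - j c * d) = y ^+ q - y * d ^+ q.-1.
Proof.
have [->|d0] := eqVneq d 0.
  rewrite expr0n; have -> : (q.-1 == 0)%N = false.
    by have := card_gt1 Fq; lia.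
  rewrite mulr0 subr0 (eq_bigr (fun=> y)) => [|c _]; last by rewrite mulr0 subr0.
  by rewrite prodr_const.
have /(congr1 (map_poly j)) := finField_genPoly Fq.
rewrite rmorph_prod rmorphB /= map_polyXn map_polyX.
rewrite (eq_bigr (fun c => 'X - (j c)%:P)) => [|c _]; last first.
  by rewrite rmorphB /= map_polyX map_polyC.
move/(congr1 (fun p => p.[y / d])); rewrite !hornerE ?hornerXn horner_prod => H.
transitivity (\prod_(c : Fq) (d * (y / d - j c))).
  by apply: eq_bigr => c _; rewrite mulrBr mulrCA divff // mulr1 [d * _]mulrC.
rewrite big_split /= prodr_const.
rewrite (eq_bigr (fun c => ('X - (j c)%:P).[y / d])) => [|c _].
  rewrite -H mulrBr expr_div_n mulrCA divff ?expf_neq0 // mulr1.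
  congr (_ - _); rewrite mulrCA; congr (_ * _).
  by rewrite -[in LHS](prednK (card_gt0 Fq)) exprSr mulfK.
by rewrite !hornerE.
Qed.

(* The numbers y + c are the roots of X - X^q = y - y^q; summing the
   recursion u^k = (y - y^q) u^(k+1) + (y + c)^(q-1-k) for u = 1/(y + c)
   leaves only the terms with u. *)
Lemma artin_schreier_sum1 y k : (forall c, y + j c != 0) -> (0 < k <= q)%N ->
  \sum_(c : Fq) (y + j c) ^- k = (y - y ^+ q) ^- k.
Proof.
move=> y0.
have rec c i : (i < q)%N ->
    (y + j c) ^- i = (y - y ^+ q) * (y + j c) ^- i.+1 + (y + j c) ^+ (q.-1 - i).
  move=> hi; have -> : y - y ^+ q = (y + j c) - (y + j c) ^+ q.
    by rewrite frobD frobj opprD addrACA subrr addr0.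
  have -> : (y + j c) ^+ q = (y + j c) ^+ (q.-1 - i) * (y + j c) ^+ i.+1.
    by rewrite -exprD; congr (_ ^+ _); lia.
  by rewrite mulrBl mulfK ?expf_neq0 // subrK exprS invfM mulVKf.
have P0 : y - y ^+ q != 0.
  have := prod_shift y 1; rewrite expr1n mulr1 => /esym H.
  rewrite -oppr_eq0 opprB H; apply/prodf_neq0 => c _.
  by have := y0 (- c); rewrite rmorphN mulr1.
elim: k => [//|k IH] /andP[_ hk].
have S (i : nat) : (i < q)%N -> (y - y ^+ q) * \sum_c (y + j c) ^- i.+1 =
    \sum_c (y + j c) ^- i - \sum_c (y + j c) ^+ (q.-1 - i).
  move=> hi; rewrite mulr_sumr -sumrB; apply: eq_bigr => c _.
  by rewrite (rec c i) // addrK.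
apply: (mulfI P0); rewrite S // exprS invfM mulrA divff // mul1r.
case: k IH hk => [_ hk|k IH hk].
  rewrite subn0 sum_shift_card1 opprK.
  rewrite (eq_bigr (fun=> 1)) => [|c _]; last by rewrite expr0 invr1.
  rewrite sumr_const (_ : 1 *+ _ = 0) ?add0r ?expr0 ?invr1 //.
  exact: card_natr0K.
by rewrite IH ?(ltnW hk) // sum_shift_expr ?subr0 //; lia.
Qed.

Lemma artin_schreier_sum y d k : d != 0 -> (forall c, y + j c * d != 0) ->
    (0 < k <= q)%N ->
  \sum_(c : Fq) (y + j c * d) ^- k = (y - y ^+ q / d ^+ q.-1) ^- k.
Proof.
move=> d0 yd hk.
have E c : y + j c * d = d * (y / d + j c).
  by rewrite mulrDr mulrCA divff // mulr1 [d * _]mulrC.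
under eq_bigr do rewrite E exprMn invfM.
rewrite -mulr_sumr artin_schreier_sum1 // => [|c]; last first.
  by have := yd c; rewrite E mulf_eq0 => /norP[].
rewrite -invfM -exprMn mulrBr mulrCA divff // mulr1.
suff -> : d * (y / d) ^+ q = y ^+ q / d ^+ q.-1 by [].
rewrite expr_div_n -[in X in _ / X](prednK (card_gt0 Fq)).
by rewrite [in X in _ / X]exprS invfM mulrCA mulVKf.
Qed.

(** Enumerated by coefficients, so that sums and products unfold one vector at a time. The list is
    free of repetitions for [indep] families ([uniq_span]). *)
Fixpoint span bs : seq K :=
  if bs is b :: bs' then [seq j c * b + w | c <- enum Fq, w <- span bs']
  else [:: 0].

Lemma sum_span_cons b bs (g : K -> K) :
  \sum_(w <- span (b :: bs)) g w =
  \sum_(c : Fq) \sum_(w <- span bs) g (j c * b + w).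
Proof. by rewrite big_allpairs_dep big_enum. Qed.

Lemma prod_span_cons b bs (g : K -> K) :
  \prod_(w <- span (b :: bs)) g w =
  \prod_(c : Fq) \prod_(w <- span bs) g (j c * b + w).
Proof. by rewrite big_allpairs_dep big_enum. Qed.

Lemma mem_span_cons b bs x :
  reflect (exists c w, w \in span bs /\ x = j c * b + w) (x \in span (b :: bs)).
Proof.
apply: (iffP allpairsP) => [[[c w] /= [_ hw ->]]|[c [w [hw ->]]]].
  by exists c, w.
by exists (c, w); rewrite mem_enum.
Qed.

Lemma span0 bs : 0 \in span bs.
Proof.
elim: bs => [|b bs IH]; first by rewrite inE.
by apply/mem_span_cons; exists 0, 0; rewrite rmorph0 mul0r addr0.
Qed.

Lemma spanD bs x y : x \in span bs -> y \in span bs -> x + y \in span bs.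
Proof.
elim: bs x y => [|b bs IH] x y.
  by rewrite !inE => /eqP -> /eqP ->; rewrite addr0.
move=> /mem_span_cons[c [w [hw ->]]] /mem_span_cons[c' [w' [hw' ->]]].
apply/mem_span_cons; exists (c + c'), (w + w'); split; first exact: IH.
by rewrite rmorphD mulrDl addrACA.
Qed.

Lemma spanZ bs c x : x \in span bs -> j c * x \in span bs.
Proof.
elim: bs x => [|b bs IH] x; first by rewrite !inE => /eqP ->; rewrite mulr0.
move=> /mem_span_cons[c' [w [hw ->]]].
apply/mem_span_cons; exists (c * c'), (j c * w); split; first exact: IH.
by rewrite mulrDr mulrA rmorphM.
Qed.

Lemma spanN bs x : x \in span bs -> - x \in span bs.
Proof. by move=> hx; rewrite -mulN1r -(rmorphN1 j); apply: spanZ. Qed.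

Lemma sum_span_shift bs u (g : K -> K) : u \in span bs ->
  \sum_(w <- span bs) g (w + u) = \sum_(w <- span bs) g w.
Proof.
elim: bs u g => [|b bs IH] u g.
  by rewrite inE => /eqP ->; rewrite !big_seq1 addr0.
move=> /mem_span_cons[c [w [hw ->]]]; rewrite !sum_span_cons.
rewrite [RHS](reindex_inj (addIr c)); apply: eq_bigr => c' _.
rewrite -[RHS](IH w) //; apply: eq_bigr => w' _; congr g.
by rewrite rmorphD mulrDl addrACA.
Qed.

Lemma size_span bs : size (span bs) = (q ^ size bs)%N.
Proof.
elim: bs => [//|b bs IH]; rewrite /= size_allpairs IH expnS.
by rewrite -cardE.
Qed.

Fixpoint indep bs : bool :=
  if bs is b :: bs' then (b \notin span bs') && indep bs' else true.

Lemma indep_shift b bs c w : b \notin span bs -> w \in span bs ->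
  (j c * b + w == 0) = (c == 0) && (w == 0).
Proof.
move=> hb hw; have [->|c0] := eqVneq c 0; first by rewrite rmorph0 mul0r add0r.
apply/negbTE; apply: contra hb => /eqP /(canRL (addrK _)); rewrite sub0r => E.
have -> : b = j c^-1 * - w by rewrite -E mulrA -rmorphM mulVf // rmorph1 mul1r.
by apply/spanZ/spanN.
Qed.

Lemma uniq_span bs : indep bs -> uniq (span bs).
Proof.
elim: bs => [//|b bs IH] /= /andP[hb /IH Hu].
apply: allpairs_uniq => //; first exact: enum_uniq.
move=> [c w] [c' w'] /allpairsP[[? ?] /= [_ h [-> ->]]].
move=> /allpairsP[[? ?] /= [_ h' [-> ->]]] /= /eqP; rewrite -subr_eq0.
rewrite opprD addrACA -mulrBl -rmorphB (indep_shift _ hb) ?spanD ?spanN //.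
by rewrite !subr_eq0 => /andP[/eqP -> /eqP ->].
Qed.

Record fqlin (f : K -> K) : Prop := Fqlin {
  fqlinD : forall x y, f (x + y) = f x + f y ;
  fqlinZ : forall c x, f (j c * x) = j c * f x }.

Lemma fqlin0 f : fqlin f -> f 0 = 0.
Proof. by move=> fl; have := fqlinZ fl 0 0; rewrite rmorph0 !mul0r. Qed.

Lemma fqlinN f x : fqlin f -> f (- x) = - f x.
Proof. by move=> fl; rewrite -mulN1r -(rmorphN1 j) (fqlinZ fl) rmorphN1 mulN1r. Qed.

Lemma fqlin_frob k : fqlin (fun x => x ^+ (q ^ k)).
Proof. by split=> [x y|c x]; rewrite ?frobDX // exprMn frobjX. Qed.

(* The F_q-linear polynomial x \prod_(w in span bs, w != 0) (1 - x / w). *)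
Fixpoint espan bs x : K :=
  if bs is b :: bs' then
    espan bs' x - espan bs' x ^+ q / espan bs' b ^+ q.-1
  else x.

Lemma espan_fqlin bs : fqlin (espan bs).
Proof.
elim: bs => [//|b bs [IHD IHZ]]; split=> [x y|c x] /=.
  by rewrite IHD frobD mulrDl opprD addrACA.
by rewrite IHZ exprMn frobj mulrBr mulrA.
Qed.

Lemma espan_neq0 bs x : indep bs -> x \notin span bs -> espan bs x != 0.
Proof.
elim: bs x => [|b bs IH] x; first by rewrite /= inE.
move=> /= /andP[hb hbs] hx.
have eb : espan bs b != 0 by exact: IH.
have := prod_shift (espan bs x) (espan bs b).
set P := \prod__ _ => HP.
suff : P != 0.
  apply: contra => /eqP E; apply/eqP; rewrite HP.
  apply: (mulIf (invr_neq0 (expf_neq0 q.-1 eb))).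
  by rewrite mul0r mulrBl mulfK ?expf_neq0 // -opprB E oppr0.
apply/prodf_neq0 => c _; rewrite -(fqlinZ (espan_fqlin bs)).
rewrite -(fqlinN _ (espan_fqlin bs)) -(fqlinD (espan_fqlin bs)); apply: IH => //.
apply: contra hx => h; apply/mem_span_cons; exists c, (x - j c * b).
by rewrite [RHS]addrC subrK.
Qed.

(** The source of all the k-th power identities: the right-hand side is the k-th power of its value
    at k = 1. By induction, the inner sum gives [espan] at x + c b, which is additive in c b, and
    the sum over c is an Artin-Schreier sum. *)
Lemma sum_span_inv bs x k : indep bs -> x \notin span bs -> (0 < k <= q)%N ->
  \sum_(w <- span bs) (x + w) ^- k = espan bs x ^- k.
Proof.
move=> hi hx hk; elim: bs x hi hx => [|b bs IH] x; first by rewrite big_seq1 addr0.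
move=> /= /andP[hb hbs] hx; rewrite sum_span_cons.
have hxc c : x + j c * b \notin span bs.
  apply: contra hx => h; apply/mem_span_cons; exists (- c), (x + j c * b).
  by rewrite rmorphN mulNr [RHS]addrC addrK.
rewrite -artin_schreier_sum ?espan_neq0 // => [|c]; last first.
  by rewrite -(fqlinZ (espan_fqlin bs)) -(fqlinD (espan_fqlin bs)) espan_neq0.
apply: eq_bigr => c _; rewrite -(fqlinZ (espan_fqlin bs)) -(fqlinD (espan_fqlin bs)).
by rewrite -IH //; apply: eq_bigr => w _; rewrite addrA.
Qed.

End FqSpans.

(** * Moore determinants *)

Section MooreDeterminants.
Variables (Fq : finFieldType) (K : fieldType) (j : {rmorphism Fq -> K}).
Local Notation q := #|Fq|.
Local Notation span := (span j).
Local Notation indep := (indep j).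
Local Notation espan := (espan Fq).
Local Notation fqlin := (fqlin j).
Implicit Types (x y b d w : K) (c : Fq) (bs : seq K).

Definition moore2 x y : K := x ^+ q * y - x * y ^+ q.

Lemma moore2_prod x y : moore2 x y = y * \prod_(c : Fq) (x - j c * y).
Proof.
rewrite prod_shift mulrBr mulrC; congr (_ - _).
by rewrite mulrCA -exprS prednK ?card_gt0.
Qed.

(** Partial fractions in x, from moore2 x y = - y^q (x - x^q / y^(q-1)); they reduce the dependence
    on x to terms that [sum_span_inv] can sum. *)
Lemma moore2_inv x y k : y != 0 -> (forall c, x + j c * y != 0) ->
    (0 < k <= q)%N ->
  moore2 x y ^- k = (- y ^+ q) ^- k * \sum_(c : Fq) (x + j c * y) ^- k.
Proof.
move=> y0 xy hk; rewrite artin_schreier_sum // -invfM -exprMn.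
congr ((_ ^+ k)^-1).
rewrite /moore2 -{2 3}(prednK (card_gt0 Fq)) !exprS.
have := expf_neq0 q.-1 y0; move: (y ^+ q.-1) (x ^+ q) => a b a0.
by field.
Qed.

(** After [moore2_inv], the sum over u of (z1 + c z2 + c w + u)^-k does not depend on w, since c w
    lies in the span. The double sum becomes a product, whose factor in w is, up to sign, the
    Frobenius image of the sum of the (z2 + w)^-k. *)
Lemma sum_moore2_span bs z1 z2 k : indep bs -> z2 \notin span bs ->
    z1 \notin span (z2 :: bs) -> (0 < k <= q)%N ->
  \sum_(u <- span bs) \sum_(w <- span bs) moore2 (z1 + u) (z2 + w) ^- k =
  moore2 (espan bs z1) (espan bs z2) ^- k.
Proof.
move=> hi h2 h1 hk; have el := espan_fqlin j bs.
have hz1 c w : w \in span bs -> z1 + j c * z2 + w != 0.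
  move=> hw; apply: contra h1; rewrite addr_eq0 => /eqP E.
  apply/mem_span_cons; exists (- c), (- w); split; first exact: spanN.
  by rewrite rmorphN mulNr -E [RHS]addrC addrK.
have hz2 w : w \in span bs -> z2 + w != 0.
  by move=> hw; apply: contra h2; rewrite addr_eq0 => /eqP ->; rewrite spanN.
have ns c : z1 + j c * z2 \notin span bs.
  by apply/negP => /spanN h; have := hz1 c _ h; rewrite addrN eqxx.
have e2 := espan_neq0 hi h2.
rewrite moore2_inv // => [|c]; last first.
  by rewrite -(fqlinZ el) -(fqlinD el); exact: espan_neq0 hi (ns c).
transitivity (\sum_(w <- span bs) (- (z2 + w) ^+ q) ^- k *
   \sum_(c : Fq) \sum_(u <- span bs) (z1 + j c * z2 + u) ^- k).
  rewrite exchange_big /= big_seq [RHS]big_seq; apply: eq_bigr => w hw.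
  transitivity (\sum_(u <- span bs) (- (z2 + w) ^+ q) ^- k *
      \sum_c (z1 + u + j c * (z2 + w)) ^- k).
    rewrite big_seq [RHS]big_seq; apply: eq_bigr => u hu.
    apply: moore2_inv => // [|c]; first exact: hz2.
    rewrite mulrDr addrACA; apply: hz1; rewrite spanD ?spanZ //.
  rewrite -!mulr_sumr exchange_big /=; congr (_ * _).
  apply: eq_bigr => c _.
  rewrite -[RHS](sum_span_shift _ (spanZ c hw)); apply: eq_bigr => u _.
  by congr ((_ ^+ k)^-1); rewrite mulrDr addrACA.
rewrite -mulr_suml; congr (_ * _); last first.
  apply: eq_bigr => c _; rewrite (sum_span_inv hi) //.
  by rewrite (fqlinD el) (fqlinZ el).
transitivity ((\sum_(w <- span bs) (-1) ^- k * (z2 + w) ^- k) ^+ q).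
  rewrite (frob_sum j); apply: eq_bigr => w _.
  by rewrite -(frobN j) -invfM -exprMn mulN1r exprVn exprAC.
rewrite -mulr_sumr (sum_span_inv hi) // -invfM -exprMn mulN1r.
by rewrite exprVn exprAC (frobN j).
Qed.

(** In coordinates the summand has degree less than q - 1 times the number of variables, so that in
    each monomial some exponent is below q - 1, as in the Chevalley-Warning theorem. *)
Lemma sum_span_prod_lin (I : Type) (F : I -> K -> K) bs (r : seq I) :
  (forall i, fqlin (F i)) -> (size r < size bs * q.-1)%N ->
  \sum_(w <- span bs) \prod_(i <- r) F i w = 0.
Proof.
move=> Fl; elim: bs r => [//|b bs IH] r hr.
(* A partly expanded product: e factors have contributed c times their value at b, those of r2 their
   value at w, and those of r1 are pending. When r1 is empty, either e < q - 1 or r2 is short enough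
   for the induction. *)
have H e (r1 r2 : seq I) : (e + size r1 + size r2 < (size bs).+1 * q.-1)%N ->
   \sum_(c : Fq) \sum_(w <- span bs) j c ^+ e * (\prod_(i <- r2) F i w) *
     \prod_(i <- r1) (j c * F i b + F i w) = 0.
  elim: r1 e r2 => [|i r1 IH1] e r2 /= h.
    under eq_bigr do under eq_bigr do rewrite big_nil mulr1.
    under eq_bigr do rewrite -mulr_sumr.
    rewrite -mulr_suml; have [he|he] := ltnP e q.-1.
      by rewrite sum_jexpr // mul0r.
    rewrite IH ?mulr0 //; move: h he; rewrite mulSn.
    by move: (size bs * q.-1)%N q.-1 => X Y; rewrite addn0; lia.
  transitivity (F i b * (\sum_(c : Fq) \sum_(w <- span bs)
      j c ^+ e.+1 * (\prod_(i <- r2) F i w) *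
      \prod_(i <- r1) (j c * F i b + F i w)) +
    \sum_(c : Fq) \sum_(w <- span bs)
      j c ^+ e * (\prod_(i <- i :: r2) F i w) *
      \prod_(i <- r1) (j c * F i b + F i w)); last first.
    by rewrite !IH1 ?mulr0 ?addr0 //=; lia.
  rewrite mulr_sumr -big_split; apply: eq_bigr => c _.
  rewrite mulr_sumr -big_split; apply: eq_bigr => w _ /=.
  by rewrite !big_cons exprS; ring.
rewrite sum_span_cons -[RHS](H 0%N r [::]) /=; last by rewrite addn0.
apply: eq_bigr => c _; apply: eq_bigr => w _.
rewrite big_nil expr0 !mul1r; apply: eq_bigr => i _.
by rewrite (fqlinD (Fl i)) (fqlinZ (Fl i)).
Qed.

Definition qeval n (Q : 'I_n -> K) x : K := \sum_(i < n) Q i * x ^+ (q ^ i).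

Lemma qeval_fqlin n (Q : 'I_n -> K) : fqlin (qeval Q).
Proof.
split=> [x y|c x]; rewrite /qeval.
  by rewrite -big_split; apply: eq_bigr => i _; rewrite (frobDX j) mulrDr.
by rewrite mulr_sumr; apply: eq_bigr => i _; rewrite exprMn frobjX mulrCA.
Qed.

(* Multiplying (Q w / w)^k by Q w / w = Q 0 + \sum_(i > 0) Q i w^(q^i - 1),
   the terms with i > 0 are products of i (q - 1) F_q-linear functions of w. *)
Lemma sum_span_qeval_ratio n (Q : 'I_n.+1 -> K) bs k :
    indep bs -> size bs = n.+1 -> (0 < k < q)%N ->
  \sum_(w <- span bs) (qeval Q w / w) ^+ k = - Q ord0 ^+ k.
Proof.
move=> hi hs hk; set ev := qeval Q; have evl : fqlin ev by exact: qeval_fqlin.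
(* Removing w = 0 matters for the exponent 0 only: there the sum becomes q^(n+1) - 1 = -1, which
   starts the induction. *)
pose T i := \sum_(w <- span bs | w != 0) (ev w / w) ^+ i.
have -> : \sum_(w <- span bs) (ev w / w) ^+ k = T k.
  rewrite /T [RHS]big_mkcond /=; apply: eq_bigr => w _; case: eqP => // ->.
  by rewrite invr0 mulr0 expr0n; case: k hk.
have T0 : T 0%N = -1.
  rewrite /T (eq_bigr (fun=> 1)) => [|w _]; last by rewrite expr0.
  apply: (addIr 1); rewrite addNr -[X in _ + X]/(1 : K).
  transitivity (\sum_(w <- span bs) (1 : K)).
    rewrite [RHS](bigID (fun w => w != 0)) /=; congr (_ + _).
    rewrite -big_filter big_const_seq count_predT.
    suff -> : [seq i <- span bs | ~~ (i != 0)] = [:: 0] by rewrite /= addr0.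
    have := filter_pred1_uniq (uniq_span hi) (span0 j bs) => <-.
    by apply: eq_filter => w /=; rewrite negbK.
  rewrite big_const_seq count_predT size_span hs expnS iter_addr addr0 mulrnA.
  by rewrite (card_natr0K j) mul0rn.
suff H i : (i < q)%N -> T i = - Q ord0 ^+ i by apply: H; case/andP: hk.
elim: i => [_|i IH hiq]; first by rewrite T0 expr0.
rewrite exprS -mulrN -IH ?(ltnW hiq) //.
pose F (o : option nat) (x : K) : K := if o is Some a then x ^+ (q ^ a) else ev x.
have Fl o : fqlin (F o) by case: o => [a|] //=; exact: fqlin_frob.
have V a : (a < n)%N -> \sum_(w <- span bs | w != 0)
    ev w ^+ i * w ^+ (q ^ a.+1 - i.+1) = 0.
  move=> han.
  (* Digits in base q: q^(a+1) - 1 - i = (q - 1 - i) + (q - 1) (q + ... + q^a). With the i factors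
     [ev] this makes (a + 1) (q - 1) linear factors, fewer than the dimension n + 1 allows. *)
  pose r := fix r a := if a is a'.+1 then nseq q.-1 (Some a) ++ r a'
                       else nseq i None ++ nseq (q.-1 - i) (Some 0%N).
  have sr m : size (r m) = (m.+1 * q.-1)%N.
    elim: m => [|m IHb]; first by rewrite size_cat !size_nseq; lia.
    by rewrite size_cat IHb size_nseq mulSn.
  have qgt m : (i < q ^ m.+1)%N.
    by rewrite expnS; apply: leq_trans (ltnW hiq) _; rewrite leq_pmulr ?expn_gt0 ?card_gt0.
  have pr m w : \prod_(o <- r m) F o w = ev w ^+ i * w ^+ (q ^ m.+1 - i.+1).
    elim: m => [|m IHb].
      rewrite big_cat !big_nseq_cond /= !iter_mulr !mulr1 expn0 expr1.
      by congr (_ * _ ^+ _); rewrite expn1; lia.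
    rewrite big_cat IHb big_nseq_cond /= iter_mulr mulr1 mulrCA; congr (_ * _).
    rewrite -exprM -exprD; congr (_ ^+ _).
    have := qgt m; have := card_gt0 Fq; rewrite [(q ^ m.+2)%N]expnS.
    move: (q ^ m.+1)%N q => X Y; nia.
  rewrite -[RHS](sum_span_prod_lin (r := r a) (bs := bs) Fl); last first.
    by rewrite sr hs ltn_pmul2r //; have := card_gt1 Fq; lia.
  rewrite [LHS]big_mkcond; apply: eq_bigr => w _; rewrite pr; case: eqP => // ->.
  rewrite /= (fqlin0 evl) expr0n; case: (i) (qgt a) (hiq) => [|i'] _ h.
    have : (q <= q ^ a.+1)%N by rewrite expnS leq_pmulr // expn_gt0 card_gt0.
    rewrite mul1r expr0n; case: eqP => // E hq; exfalso.
    by move: E hq h; move: (q ^ a.+1)%N q => X Y; lia.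
  by rewrite mul0r.
have evE w : ev w = Q ord0 * w + \sum_(a < n) Q (lift ord0 a) * w ^+ (q ^ a.+1).
  by rewrite /ev /qeval big_ord_recl expn0 expr1.
clearbody ev.
transitivity (\sum_(w <- span bs | w != 0) (Q ord0 * (ev w / w) ^+ i +
  \sum_(a < n) Q (lift ord0 a) * (ev w ^+ i * w ^+ (q ^ a.+1 - i.+1)))).
  apply: eq_bigr => w w0; rewrite exprSr [X in _ * (X / _)]evE.
  rewrite mulrDl mulfK // mulrDr; congr (_ + _); first by rewrite mulrC.
  rewrite mulr_suml mulr_sumr; apply: eq_bigr => a _.
  have h : (i.+1 <= q ^ a.+1)%N.
    by rewrite expnS; apply: leq_trans (ltnW hiq) _; rewrite leq_pmulr ?expn_gt0 ?card_gt0.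
  rewrite expr_div_n -{1}(subnK h) exprD exprSr.
  have := expf_neq0 i w0; move: (w ^+ i) (w ^+ _) (ev w ^+ i) => x y z x0.
  by field; rewrite w0 x0.
rewrite big_split /= -mulr_sumr exchange_big /= [X in _ + X]big1 ?addr0 // => a _.
by rewrite -mulr_sumr V ?mulr0.
Qed.

End MooreDeterminants.

Lemma det_mx2 (R : comNzRingType) (A : 'M[R]_2) :
  \det A = A 0 0 * A 1 1 - A 0 1 * A 1 0.
Proof.
rewrite (expand_det_row _ 0) big_ord_recl big_ord1 /cofactor !det_mx11 !mxE /=.
rewrite !addn0 expr0 mul1r add0n expr1 mulN1r mulrN.
by congr (A _ _ * A _ _ - A _ _ * A _ _); apply/val_inj.
Qed.

Section MooreMatrices.
Variables (Fq : finFieldType) (K : fieldType) (j : {rmorphism Fq -> K}).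
Local Notation q := #|Fq|.
Local Notation span := (span j).
Local Notation indep := (indep j).
Local Notation espan := (espan Fq).
Local Notation fqlin := (fqlin j).
Local Notation moore2 := (moore2 Fq).
Implicit Types (x y b d w : K) (c : Fq) (bs : seq K).

Definition moore_mx n bs : 'M[K]_n := \matrix_(i, k) bs`_k ^+ (q ^ i).

Lemma fqlin_eq0 f bs : fqlin f -> (forall k, (k < size bs)%N -> f bs`_k = 0) ->
  {in span bs, forall w, f w = 0}.
Proof.
move=> fl; elim: bs => [|b bs IH] h w.
  by rewrite inE => /eqP ->; apply: fqlin0 fl.
move=> /mem_span_cons[c [w' [hw ->]]].
rewrite (fqlinD fl) (fqlinZ fl) (h 0%N) // mulr0 add0r.
by apply: IH hw => k hk; apply: (h k.+1).
Qed.

Definition qpoly n (Q : 'I_n -> K) : {poly K} := \sum_(i < n) Q i *: 'X^(q ^ i).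

Lemma horner_qpoly n (Q : 'I_n -> K) x : (qpoly Q).[x] = qeval Fq Q x.
Proof.
rewrite /qpoly horner_sum; apply: eq_bigr => i _.
by rewrite !hornerE ?hornerXn.
Qed.

Lemma coef_qpoly n (Q : 'I_n -> K) (i : 'I_n) : (qpoly Q)`_(q ^ i) = Q i.
Proof.
rewrite /qpoly coef_sum (bigD1 i) //= coefZ coefXn eqxx mulr1 big1 ?addr0 // => k ki.
rewrite coefZ coefXn eqn_exp2l ?card_gt1 //.
by rewrite [_ == _]eq_sym -val_eqE /= in ki *; rewrite (negPf ki) mulr0.
Qed.

Lemma size_qpoly n (Q : 'I_n.+1 -> K) : (size (qpoly Q) <= (q ^ n).+1)%N.
Proof.
apply: (leq_trans (size_sum _ _ _)); apply/bigmax_leqP => i _.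
apply: leq_trans (size_scale_leq _ _) _; rewrite size_polyXn ltnS.
by rewrite leq_exp2l ?card_gt1 // -ltnS.
Qed.

(** A row vector in the kernel would be a nonzero F_q-linear polynomial of degree at most q^(n-1)
    with the q^n elements of the span as roots. *)
Lemma det_moore_neq0 n bs : size bs = n -> indep bs -> \det (moore_mx n bs) != 0.
Proof.
move=> hs hi; apply/det0P => -[a a0 aM]; case: n hs a a0 aM => [|n] hs a a0 aM.
  by move: a0; rewrite [a]thinmx0 eqxx.
pose Q i := a 0 i.
have Q0 : qpoly Q != 0.
  apply: contra a0 => /eqP p0; apply/eqP/rowP => i.
  by rewrite mxE -[LHS]/(Q i) -coef_qpoly p0 coef0.
have := max_poly_roots Q0 (rs := span bs).
rewrite uniq_span // size_span hs => /(_ _ isT) h.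
suff /h : all (root (qpoly Q)) (span bs).
  move/leq_trans/(_ (size_qpoly Q)); rewrite ltnS.
  by rewrite leq_exp2l ?card_gt1 // ltnn.
apply/allP => w hw; rewrite /root horner_qpoly; apply/eqP.
apply: fqlin_eq0 hw; first exact: qeval_fqlin.
move=> k; rewrite hs => hk; have /matrixP/(_ 0 (Ordinal hk)) := aM.
rewrite !mxE => E; rewrite -[RHS]E; apply: eq_bigr => i _; by rewrite !mxE.
Qed.

Definition moore_row0 n bs (ell : nat -> K) : 'M[K]_n.+1 :=
  \matrix_(i, k) if i == ord0 then ell k else bs`_k ^+ (q ^ i).

(** Cramer's rule; the coefficient [Q ord0] is the one that [sum_span_qeval_ratio] returns. *)
Lemma qeval_interpolation n bs (ell : nat -> K) : size bs = n.+1 -> indep bs ->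
  exists2 Q : 'I_n.+1 -> K, (forall k, (k <= n)%N -> qeval Fq Q bs`_k = ell k)
    & Q ord0 * \det (moore_mx n.+1 bs) = \det (moore_row0 n bs ell).
Proof.
move=> hs hi; set M := moore_mx n.+1 bs.
have M0 : \det M != 0 by exact: det_moore_neq0.
have Mu : M \in unitmx by rewrite unitmxE unitfE.
pose a := (\row_k ell k) *m invmx M; exists (fun i => a 0 i).
  move=> k hk; have : a *m M = \row_k ell k by rewrite mulmxKV.
  move=> /matrixP/(_ 0 (Ordinal (hk : k < n.+1)%N)); rewrite !mxE => <-.
  by apply: eq_bigr => i _; rewrite !mxE.
rewrite /a /invmx Mu -scalemxAr mxE mulrAC mulVf // mul1r !mxE.
rewrite (expand_det_row _ ord0); apply: eq_bigr => k _; rewrite !mxE eqxx.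
congr (_ * _); rewrite /cofactor; congr (_ * \det _).
by apply/matrixP => i l; rewrite !mxE.
Qed.

Lemma prod_span_opp bs (g : K -> K) :
  \prod_(w <- span bs) g (- w) = \prod_(w <- span bs) g w.
Proof.
elim: bs g => [|b bs IH] g; first by rewrite !big_seq1 oppr0.
rewrite !prod_span_cons (reindex_inj oppr_inj); apply: eq_bigr => c _.
rewrite -(IH (fun x => g (_ + x))); apply: eq_bigr => w _; congr g.
by rewrite rmorphN mulNr opprD opprK.
Qed.

(** As a function of b the determinant is an F_q-linear polynomial of degree q^n; the q^n elements
    of the span of bs are all its roots, and its leading coefficient is the cofactor of b^(q^n). *)
Lemma det_moore_cons b bs n : size bs = n -> indep bs ->
  \det (moore_mx n.+1 (b :: bs)) =
  (-1) ^+ n * \det (moore_mx n bs) * \prod_(w <- span bs) (b + w).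
Proof.
move=> hs hi; set M := moore_mx _ (b :: bs).
pose Q i := cofactor M i ord0.
have detE : \det M = (qpoly Q).[b].
  rewrite horner_qpoly (expand_det_col _ ord0); apply: eq_bigr => i _.
  by rewrite mxE mulrC.
have Qmax : Q ord_max = (-1) ^+ n * \det (moore_mx n bs).
  rewrite /Q /cofactor addn0; congr (_ * \det _); apply/matrixP => i k.
  by rewrite !mxE lift0 lift_max.
have Q0 : Q ord_max != 0.
  by rewrite Qmax mulf_neq0 ?det_moore_neq0 // signr_eq0.
have sQ : size (qpoly Q) = (q ^ n).+1.
  apply/eqP; rewrite eqn_leq size_qpoly ltnNge; apply: contra Q0 => h.
  by rewrite -coef_qpoly /= nth_default.
have lQ : lead_coef (qpoly Q) = Q ord_max by rewrite /lead_coef sQ -coef_qpoly.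
have -> : \prod_(w <- span bs) (b + w) = \prod_(w <- span bs) (b - w).
  by rewrite -(prod_span_opp _ (fun x => b + x)).
have := @all_roots_prod_XsubC _ (qpoly Q) (span bs).
rewrite sQ size_span hs uniq_rootsE uniq_span // lQ => /(_ erefl _ isT) H.
rewrite detE H; last first.
  apply/allP => w hw; rewrite /root horner_qpoly; apply/eqP.
  apply: fqlin_eq0 hw; first exact: qeval_fqlin.
  move=> k; rewrite hs => hk; have hk' : (k.+1 < n.+1)%N by [].
  have /matrixP/(_ ord0 (Ordinal hk')) := mul_adj_mx M.
  rewrite !mxE /= mulr0n => E; rewrite -[RHS]E; apply: eq_bigr => i _.
  by rewrite !mxE mulrC.
rewrite hornerZ Qmax horner_prod; congr (_ * _).
by apply: eq_bigr => w _; rewrite !hornerE.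
Qed.

(** For independent bs, the product of the nonzero elements of the span: by [prod_span_add] it is
    the coefficient of x in the product of the x + w. *)
Fixpoint pspan bs : K :=
  if bs is b :: bs' then - (pspan bs' ^+ q * espan bs' b ^+ q.-1) else 1.

Lemma prod_span_add bs x : indep bs ->
  \prod_(w <- span bs) (x + w) = espan bs x * pspan bs.
Proof.
elim: bs x => [|b bs IH] x; first by rewrite big_seq1 addr0 mulr1.
move=> /= /andP[hb hbs]; rewrite prod_span_cons.
have el := espan_fqlin j bs; have eb := espan_neq0 hbs hb.
transitivity (\prod_(c : Fq) ((espan bs x - j c * - espan bs b) * pspan bs)).
  apply: eq_bigr => c _; rewrite mulrN opprK -(fqlinZ el) -(fqlinD el) -IH //.
  by apply: eq_bigr => w _; rewrite addrA.
rewrite big_split /= prod_shift prodr_const (_ : #|_| = q) //.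
set E := espan bs b in eb *; have -> : (- E) ^+ q.-1 = (- 1) ^+ q.-1 * E ^+ q.-1.
  by rewrite -exprMn mulN1r.
have -> : (- 1 : K) ^+ q.-1 = 1.
  have := frobN j 1; rewrite -{1}(prednK (card_gt0 Fq)) exprS expr1n mulN1r.
  by move/oppr_inj.
have := expf_neq0 q.-1 eb; move: (E ^+ _) (_ ^+ q) (_ ^+ q) => e X Y e0.
by field.
Qed.

Lemma signr_odd_card1 i : odd q -> ((-1) ^+ i) ^+ q.-1 = 1 :> K.
Proof.
move=> oq; rewrite -exprM -signr_odd oddM.
suff -> : odd q.-1 = false by rewrite andbF.
by move: oq; rewrite -{1}(prednK (card_gt0 Fq)) /= => /negbTE.
Qed.

(** Both sides satisfy the same recursion, as the signs of the Moore determinants disappear in the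
    even power q - 1. *)
Lemma pspan_det bs n : odd q -> size bs = n -> indep bs ->
  pspan bs = (-1) ^+ n * \det (moore_mx n bs) ^+ q.-1.
Proof.
move=> oq; elim: bs n => [|b bs IH] n <- /=.
  by rewrite det_mx00 expr1n mulr1.
move=> /andP[hb hbs]; rewrite det_moore_cons // prod_span_add //.
have -> : pspan bs ^+ q = pspan bs * pspan bs ^+ q.-1.
  by rewrite -exprS prednK ?card_gt0.
rewrite {1}(IH _ erefl hbs) !exprMn signr_odd_card1 // exprS.
move: (\det _ ^+ _) (pspan bs ^+ _) (espan bs b ^+ _) ((-1) ^+ _) => A B C D.
by ring.
Qed.

(** Apply [det_moore_cons] twice: the factors [pspan] left over combine to the power q + 1, which is
    the power q^2 - 1 of the determinant by [pspan_det]. All that depends on x and y is then in one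
    [moore2]. *)
Lemma det_moore_cons2 x y bs n : odd q -> size bs = n -> indep (x :: y :: bs) ->
  \det (moore_mx n.+2 [:: x, y & bs]) =
  - (\det (moore_mx n bs) ^+ (q ^ 2) * moore2 (espan bs x) (espan bs y)).
Proof.
move=> oq hs /= /and3P[hx hy hbs]; have hyb : indep (y :: bs) by apply/andP.
have ey := espan_neq0 hbs hy.
rewrite !det_moore_cons ?prod_span_add //= ?hs //.
have qS : q = q.-1.+1 by rewrite prednK ?card_gt0.
have Pq : pspan bs ^+ q.+1 = \det (moore_mx n bs) ^+ (q.-1 * q.+1).
  rewrite (pspan_det oq hs hbs) exprMn -!exprM.
  rewrite -signr_odd oddM /= oq andbF expr0 mul1r; congr (_ ^+ _).
have -> : (q ^ 2 = 1 + q.-1 * q.+1)%N by rewrite [in LHS]qS; lia.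
have yq : espan bs y ^+ q = espan bs y * espan bs y ^+ q.-1.
  by rewrite -exprS prednK ?card_gt0.
rewrite exprD expr1 -Pq exprS /moore2 yq.
have key (s M P D ex ey_ A B : K) : A != 0 -> s ^+ 2 = 1 ->
    (-1) * s * (s * M * (ey_ * P)) * ((ex - B / A) * - (D * A)) =
    - (M * (P * D) * (B * ey_ - ex * (ey_ * A))).
  move=> A0 s2; transitivity (s ^+ 2 * - (M * (P * D) * (B * ey_ - ex * (ey_ * A)))).
    by field.
  by rewrite s2 mul1r.
by rewrite exprS; apply: key; rewrite ?expf_neq0 ?sqrr_sign.
Qed.

Lemma det_frob n (M : 'M[K]_n) : \det (map_mx (fun x => x ^+ q) M) = \det M ^+ q.
Proof.
rewrite /determinant (frob_sum j); apply: eq_bigr => s _.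
rewrite exprMn -prodrXl exprAC.
have -> : (-1) ^+ q = -1 :> K by rewrite -[in RHS](expr1n _ q) (frobN j).
by congr (_ * _); apply: eq_bigr => i _; rewrite mxE.
Qed.

Lemma det_moore_scale n bs T : size bs = n ->
  \det (moore_mx n [seq T * b | b <- bs]) =
  (\prod_(i < n) T ^+ (q ^ i)) * \det (moore_mx n bs).
Proof.
move=> hs; have -> : moore_mx n [seq T * b | b <- bs] =
    diag_mx (\row_i T ^+ (q ^ i)) *m moore_mx n bs.
  rewrite mul_diag_mx; apply/matrixP => i k; rewrite !mxE.
  by rewrite (nth_map 0) ?hs // exprMn.
rewrite det_mulmx det_diag; congr (_ * _).
by apply: eq_bigr => i _; rewrite mxE.
Qed.

End MooreMatrices.

(** * Cramer's rule along the tower x, y, T x, T y, .. *)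

Section CarlitzTower.
Variables (Fq : finFieldType) (K : fieldType) (j : {rmorphism Fq -> K}).
Local Notation q := #|Fq|.
Local Notation span := (span j).
Local Notation indep := (indep j).
Local Notation fqlin := (fqlin j).
Local Notation moore2 := (moore2 Fq).
Local Notation moore_mx := (moore_mx Fq).
Variables (T x y : K).

(* x, y, T x, T y, T^2 x, T^2 y, ... *)
Definition tower (k : nat) : K := T ^+ k./2 * (if odd k then y else x).

(* The coefficient a of the vector a x + b y = tower k. *)
Definition tower_coord (k : nat) : K := if odd k then 0 else T ^+ k./2.

Lemma towerSS k : tower k.+2 = T * tower k.
Proof. by rewrite /tower /= negbK exprS mulrA. Qed.

Lemma tower_coordSS k : tower_coord k.+2 = T * tower_coord k.
Proof. by rewrite /tower_coord /= negbK exprS; case: odd; rewrite ?mulr0. Qed.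

Lemma mkseq_tower d :
  mkseq tower d.+2 = [:: x, y & [seq T * b | b <- mkseq tower d]].
Proof.
rewrite /mkseq -map_comp (iotaD 0 2 d) /= {1 2}/tower /= !mul1r; congr [:: _, _ & _].
rewrite (iotaDl 2 0) -map_comp; apply: eq_map => k /=.
by rewrite towerSS.
Qed.

(** The numerator of Cramer's rule before Frobenius: raising its entries to the power q turns the
    lower rows into the rows 1, 2, ... of the Moore matrix and the top row into the values
    [tower_coord i ^+ q]. This is why q-th powers are interpolated. *)
Definition tower_mx d : 'M[K]_(2 + d) :=
  \matrix_(i, k) if (i == 0 :> nat) then tower_coord k else tower k ^+ (q ^ i.-1).

(* Subtracting from the column of T w, w in the tower, T times the column of
   w makes the matrix block triangular. *)
Lemma det_tower_mx d : \det (tower_mx d) =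
  y * (\prod_(i < d) (T ^+ (q ^ i.+1) - T)) * \det (moore_mx d (mkseq tower d)) ^+ q.
Proof.
pose U : 'M[K]_(2 + d) :=
  \matrix_(i, k) ((i == k)%:R - T * (k == i.+2 :> nat)%:R).
have detU : \det U = 1.
  rewrite -det_tr det_trig.
    rewrite big1 // => i _; rewrite !mxE eqxx.
    by rewrite (_ : (_ == _) = false) ?mulr0 ?subr0 //; apply/negbTE; lia.
  apply/is_trig_mxP => i k ik; rewrite !mxE.
  have -> : (k == i) = false by apply/negbTE; rewrite -val_eqE /=; lia.
  by rewrite (_ : (_ == _) = false) ?mulr0 ?subr0 //; apply/negbTE; lia.
have XU i (k : 'I_d) : (tower_mx d *m U) i (rshift 2 k) =
    tower_mx d i (rshift 2 k) - T * tower_mx d i (widen_ord (leq_addl 2 d) k).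
  rewrite mxE; under eq_bigr do rewrite [U _ _]mxE mulrBr.
  rewrite sumrB; congr (_ - _).
    rewrite (bigD1 (rshift 2 k)) //= eqxx mulr1 big1 ?addr0 // => l lk.
    by rewrite (negPf lk) mulr0.
  rewrite (bigD1 (widen_ord (leq_addl 2 d) k)) //= eqxx mulr1 mulrC big1 ?addr0 //.
  move=> l lk; rewrite (_ : (_ == _) = false) ?mulr0 //.
  by apply/negbTE; apply: contra lk; rewrite -val_eqE /=; lia.
have XU0 i (k : 'I_2) : (tower_mx d *m U) i (lshift d k) = tower_mx d i (lshift d k).
  rewrite mxE; under eq_bigr do rewrite [U _ _]mxE mulrBr.
  rewrite sumrB [X in _ - X]big1 ?subr0 => [|l _]; last first.
    by rewrite (_ : (_ == _) = false) ?mulr0 //; apply/negbTE; case: k => k' /=; lia.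
  rewrite (bigD1 (lshift d k)) //= eqxx mulr1 big1 ?addr0 // => l lk.
  by rewrite (negPf lk) mulr0.
rewrite -[LHS]mulr1 -[X in _ * X = _]detU -det_mulmx -[_ *m U]submxK.
have -> : ursubmx (tower_mx d *m U) = 0.
  apply/matrixP => i k; rewrite [LHS]mxE [LHS]mxE XU !mxE /=.
  case: i => -[|[|//]] hi /=; first by rewrite tower_coordSS subrr.
  by rewrite expn0 !expr1 towerSS subrr.
rewrite det_lblock -mulrA; congr (_ * _).
  have E i k : ulsubmx (tower_mx d *m U) i k = tower_mx d (lshift d i) (lshift d k).
    by rewrite [LHS]mxE [LHS]mxE XU0.
  rewrite det_mx2 !E !mxE /= /tower_coord /tower /=.
  by rewrite !mul1r mul0r subr0 expn0 expr1.
have -> : drsubmx (tower_mx d *m U) = diag_mx (\row_i (T ^+ (q ^ i.+1) - T)) *m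
    map_mx (fun x => x ^+ q) (moore_mx d (mkseq tower d)).
  apply/matrixP => i k; rewrite mul_diag_mx [LHS]mxE [LHS]mxE XU !mxE /=.
  rewrite nth_mkseq // -exprM -expnSr towerSS exprMn mulrBl.
  by [].
rewrite det_mulmx det_diag (det_frob j); congr (_ * _).
by apply: eq_bigr => i _; rewrite mxE.
Qed.

Definition tower_const d : K := \prod_(i < d) ((T ^+ (q ^ i.+1) - T) / T ^+ (q ^ i.+1)) ^+ q.

(** The sum is - Q_0^k, where Q_0 is [\det (tower_mx d)] to the power q over a Moore determinant.
    The q^2-th power of the determinant of the shorter tower occurs in both and cancels, leaving
    y^q, [tower_const] and the inverse of a [moore2] of values of [espan], whose k-th power is the
    double sum on the right. *)
Theorem sum_tower_ratio d k : odd q -> T != 0 -> indep (mkseq tower d.+2) ->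
    (0 < k < q)%N ->
  exists2 ev : K -> K,
    fqlin ev /\ (forall i, (i < d.+2)%N -> ev (tower i) = tower_coord i ^+ q) &
    \sum_(w <- span (mkseq tower d.+2)) (ev w / w) ^+ k =
    - (- y ^+ q * tower_const d) ^+ k *
    \sum_(u <- span [seq T * b | b <- mkseq tower d])
      \sum_(w <- span [seq T * b | b <- mkseq tower d])
        moore2 (x + u) (y + w) ^- k.
Proof.
move=> oq T0 hi hk.
have sz : size (mkseq tower d.+2) = d.+2 by rewrite size_mkseq.
have [Q Qv Q0] := qeval_interpolation (fun i => tower_coord i ^+ q) sz hi.
exists (qeval Fq Q).
  split; first exact: qeval_fqlin.
  by move=> i hi'; rewrite -(nth_mkseq 0 tower hi') Qv.
have hi' : indep [:: x, y & [seq T * b | b <- mkseq tower d]].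
  by rewrite -mkseq_tower.
have /= /and3P[hx hy hbs] := hi'.
rewrite (sum_span_qeval_ratio Q hi sz hk).
rewrite sum_moore2_span //; last by case/andP: hk => -> /ltnW.
set bs := [seq _ | _ <- _] in hi' hx hy hbs *.
have sbs : size bs = d by rewrite size_map size_mkseq.
have M0 : \det (moore_mx d.+2 (mkseq tower d.+2)) != 0 by apply: det_moore_neq0 hi.
move: (M0); rewrite mkseq_tower (det_moore_cons2 oq sbs hi') oppr_eq0 mulf_eq0.
case/norP=> D0 mo0.
rewrite mulNr; congr (- _); rewrite -exprVn -exprMn; congr (_ ^+ k).
apply: (mulIf M0); rewrite Q0.
have -> : moore_row0 Fq d.+1 (mkseq tower d.+2) (fun i => tower_coord i ^+ q) =
   map_mx (fun x => x ^+ q) (tower_mx d).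
  apply/matrixP => i k'; rewrite !mxE -val_eqE /=; case: eqP => // /eqP i0.
  rewrite nth_mkseq // -exprM -expnSr prednK // lt0n //.
rewrite (det_frob j) det_tower_mx mkseq_tower (det_moore_cons2 oq sbs hi').
rewrite /bs det_moore_scale ?size_mkseq //.
rewrite /tower_const prodrXl prodf_div.
have P0 : \prod_(i < d) T ^+ (q ^ i) != 0.
  by apply/prodf_neq0 => i _; rewrite expf_neq0.
have PE : \prod_(i < d) T ^+ (q ^ i.+1) = (\prod_(i < d) T ^+ (q ^ i)) ^+ q.
  by rewrite -prodrXl; apply: eq_bigr => i _; rewrite -exprM -expnSr.
rewrite PE !exprMn -!exprM -[(q ^ 2)%N]mulnn.
have key (a b c e m : K) : e != 0 -> m != 0 ->
    a * b * c = (- a) * (b / e) * m^-1 * - (e * c * m).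
  by move=> e0 m0; field; rewrite e0 m0.
by rewrite exprVn -[X in X^-1]exprM; apply: key; rewrite ?expf_neq0.
Qed.

End CarlitzTower.

#[local] Existing Instance totally_filter.

(** * Summation over an ultrametric field *)

Section Ultranorm.
Variables (R : realType) (C : fieldType) (v : ultranorm R C).
Local Notation V := (valued v).
Implicit Types x y : V.

Lemma uabs0 : v 0 = 0.
Proof. by apply/eqP; rewrite uabs_eq0. Qed.

Lemma uabs1 : v 1 = 1.
Proof.
have /mulfI : v 1 != 0 by rewrite uabs_eq0 oner_eq0.
by apply; rewrite -uabsM !mulr1.
Qed.

Lemma uabsX x n : v (x ^+ n) = v x ^+ n.
Proof.
by elim: n => [|n IH]; rewrite ?expr0 ?uabs1 // !exprS uabsM IH.
Qed.

Lemma uabsV x : v x^-1 = (v x)^-1.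
Proof.
have [->|x0] := eqVneq x 0; first by rewrite invr0 uabs0 invr0.
have vx : v x != 0 by rewrite uabs_eq0.
by apply: (mulfI vx); rewrite -uabsM !divff ?uabs1.
Qed.

Lemma uabs_f x y : v (x / y) = v x / v y.
Proof. by rewrite uabsM uabsV. Qed.

Lemma uabs_gt0 x : (0 < v x) = (x != 0).
Proof. by rewrite lt_neqAle eq_sym uabs_eq0 uabs_ge0 andbT. Qed.

Lemma uabsN x : v (- x) = v x.
Proof.
apply/eqP; rewrite -(@eqrXn2 _ 2) ?uabs_ge0 //.
by rewrite -!uabsX sqrrN.
Qed.

Lemma uabsBC x y : v (x - y) = v (y - x).
Proof. by rewrite -uabsN opprB. Qed.

Lemma uabsD_le x y e : v x <= e -> v y <= e -> v (x + y) <= e.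
Proof. by move=> hx hy; rewrite (le_trans (uabsD _ _ _)) // ge_max hx. Qed.

Lemma uabsD_lt x y e : v x < e -> v y < e -> v (x + y) < e.
Proof. by move=> hx hy; rewrite (le_lt_trans (uabsD _ _ _)) // gt_max hx. Qed.

Lemma uabsB_le x y e : v x <= e -> v y <= e -> v (x - y) <= e.
Proof. by move=> hx hy; rewrite uabsD_le ?uabsN. Qed.

Lemma uabsB_lt x y e : v x < e -> v y < e -> v (x - y) < e.
Proof. by move=> hx hy; rewrite uabsD_lt ?uabsN. Qed.

Lemma uabs_trans_lt y x z e : v (x - y) < e -> v (y - z) < e -> v (x - z) < e.
Proof. by move=> h1 h2; rewrite -(subrKA y) uabsD_lt. Qed.

Lemma uabs_sum_lt (I : eqType) (r : seq I) (P : pred I) (F : I -> V) e : 0 < e ->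
  (forall i, i \in r -> P i -> v (F i) < e) -> v (\sum_(i <- r | P i) F i) < e.
Proof.
move=> e0 h; rewrite big_seq_cond; elim/big_ind: _ => //.
- by rewrite uabs0.
- by move=> x y; exact: uabsD_lt.
- by move=> i /andP[]; exact: h.
Qed.

Lemma uabs_sum_le (I : eqType) (r : seq I) (P : pred I) (F : I -> V) e : 0 <= e ->
  (forall i, i \in r -> P i -> v (F i) <= e) -> v (\sum_(i <- r | P i) F i) <= e.
Proof.
move=> e0 h; rewrite big_seq_cond; elim/big_ind: _ => //.
- by rewrite uabs0.
- by move=> x y; exact: uabsD_le.
- by move=> i /andP[]; exact: h.
Qed.

Lemma uabs_prod (I : Type) (r : seq I) (P : pred I) (F : I -> V) :
  v (\prod_(i <- r | P i) F i) = \prod_(i <- r | P i) v (F i).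
Proof.
by elim/big_rec2: _ => [|i x y _ <-]; rewrite ?uabs1 ?uabsM.
Qed.

Lemma uabsD_dom x y : v y < v x -> v (x + y) = v x.
Proof.
move=> h; apply/eqP; rewrite eq_le uabsD_le //= ?(ltW h) // leNgt.
apply/negP => h'; have := uabsB_lt h' h.
by rewrite addrK ltxx.
Qed.

Lemma uabs_small_eq0 x : (forall e, 0 < e -> v x < e) -> x = 0.
Proof.
move=> h; apply/eqP; rewrite -(uabs_eq0 v) eq_le uabs_ge0 andbT leNgt.
by apply/negP => /h; rewrite ltxx.
Qed.

Lemma uabs_close_eq x y : (forall e, 0 < e -> v (x - y) < e) -> x = y.
Proof. by move/uabs_small_eq0/eqP; rewrite subr_eq0 => /eqP. Qed.

Lemma valued_cvgP (T : Type) (F : set_system T) (FF : Filter F) (f : T -> V) (l : V) :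
  f @ F --> l <-> forall e, 0 < e -> \forall t \near F, v (f t - l) < e.
Proof.
split=> [/cvg_ballP h e e0|h].
  by apply: filterS (h e e0) => t; rewrite ballEmdist /= uabsBC.
apply/cvg_ballP => e e0; apply: filterS (h e e0) => t.
by rewrite ballEmdist /= uabsBC.
Qed.

Lemma valued_cvg_lim (T : Type) (F : set_system T) (FF : ProperFilter F)
    (f : T -> V) (l : V) :
  f @ F --> l -> lim (f @ F) = l.
Proof. by apply: cvg_lim; exact: metric_hausdorff. Qed.

(** Ultrametric form of unordered summability: if all terms outside J are below e, every larger
    partial sum stays within e of the one over J, so one finite set for each e is enough. *)
Definition sums (I : choiceType) (F : I -> V) (s : V) : Prop :=
  forall e, 0 < e -> exists2 J : {fset I},
    (forall i, i \notin J -> v (F i) < e) & v (\sum_(i <- J) F i - s) < e.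

Definition nullfam (I : choiceType) (F : I -> V) : Prop :=
  forall e, 0 < e -> exists J : {fset I}, forall i, i \notin J -> v (F i) < e.

Lemma sums_null (I : choiceType) (F : I -> V) s : sums F s -> nullfam F.
Proof. by move=> h e /h[J hJ _]; exists J. Qed.

Lemma sum_fset_sub (I : choiceType) (F : I -> V) (A B : {fset I}) e : 0 < e ->
  (A `<=` B)%fset -> (forall i, i \notin A -> v (F i) < e) ->
  v (\sum_(i <- B) F i - \sum_(i <- A) F i) < e.
Proof.
move=> e0 AB h.
have -> : \sum_(i <- A) F i = \sum_(i <- B | i \in A) F i.
  rewrite -[RHS]big_filter; apply: perm_big.
  apply: uniq_perm; rewrite ?filter_uniq ?fset_uniq //.
  move=> i; rewrite mem_filter; case: (boolP (i \in A)) => //= iA.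
  by rewrite (fsubsetP AB).
rewrite (bigID (fun i => i \in A)) /= addrC addrK.
by apply: uabs_sum_lt => // i _; exact: h.
Qed.

Lemma sums_tail (I : choiceType) (F : I -> V) s (J : {fset I}) e : 0 < e ->
  sums F s -> (forall i, i \notin J -> v (F i) < e) ->
  v (\sum_(i <- J) F i - s) < e.
Proof.
move=> e0 /(_ e e0)[J' h' hs] h.
have h1 := sum_fset_sub e0 (fsubsetUl J J') h.
have h2 := sum_fset_sub e0 (fsubsetUr J J') h'.
apply: uabs_trans_lt hs; apply: uabs_trans_lt h2.
by rewrite uabsBC.
Qed.

Lemma sums_unique (I : choiceType) (F : I -> V) s t : sums F s -> sums F t -> s = t.
Proof.
move=> hs ht; apply: uabs_close_eq => e e0.
have [J hJ h] := hs _ e0; have h' := sums_tail e0 ht hJ.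
by apply: uabs_trans_lt h'; rewrite uabsBC.
Qed.

Lemma sums_totally (I : choiceType) (F : I -> V) s : sums F s ->
  (fun J : {fset I} => \sum_(i <- J) F i) @ totally --> s.
Proof.
move=> h; apply/valued_cvgP => e e0; have [J hJ _] := h _ e0.
exists J => //= J' /= JJ'; apply: sums_tail => // i iJ'.
by apply: hJ; apply: contra iJ' => /(fsubsetP JJ').
Qed.

Lemma sums_unordered_sum (I : choiceType) (D : set I) (F : I -> V) s :
  sums (fun i => if i \in D then F i else 0) s -> unordered_sum D F = s.
Proof.
move=> /sums_totally h; apply: valued_cvg_lim.
by under eq_fun do rewrite big_mkcond.
Qed.

Lemma sums_lt (I : choiceType) (F : I -> V) s e : 0 < e -> sums F s ->
  (forall i, v (F i) < e) -> v s < e.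
Proof.
move=> e0 hs h; have := sums_tail (J := fset0) e0 hs (fun i _ => h i).
by rewrite big_seq_fset0 sub0r uabsN.
Qed.

Lemma sums_le (I : choiceType) (F : I -> V) s e : 0 <= e -> sums F s ->
  (forall i, v (F i) <= e) -> v s <= e.
Proof.
move=> e0 hs h; rewrite leNgt; apply/negP => se.
have : v s < v s by apply: sums_lt hs _ => [|i]; exact: le_lt_trans se.
by rewrite ltxx.
Qed.

Lemma eq_sums (I : choiceType) (F G : I -> V) s : (forall i, F i = G i) ->
  sums F s -> sums G s.
Proof. by move=> /funext ->. Qed.

Lemma sums0 (I : choiceType) : sums (fun _ : I => 0) 0.
Proof.
move=> e e0; exists fset0 => [i _|]; first by rewrite uabs0.
by rewrite big_seq_fset0 subr0 uabs0.
Qed.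

Lemma sumsD (I : choiceType) (F G : I -> V) s t : sums F s -> sums G t ->
  sums (fun i => F i + G i) (s + t).
Proof.
move=> hF hG e e0; have [A hA _] := hF _ e0; have [B hB _] := hG _ e0.
have hA' i : i \notin (A `|` B)%fset -> v (F i) < e.
  by rewrite inE => /norP[/hA].
have hB' i : i \notin (A `|` B)%fset -> v (G i) < e.
  by rewrite inE => /norP[_ /hB].
exists (A `|` B)%fset => [i hi|]; first by rewrite uabsD_lt ?hA' ?hB'.
by rewrite big_split /= opprD addrACA uabsD_lt ?sums_tail.
Qed.

Lemma sumsZ (I : choiceType) (F : I -> V) s a : sums F s ->
  sums (fun i => a * F i) (a * s).
Proof.
move=> hF; have [->|a0] := eqVneq a 0.
  rewrite mul0r; apply: eq_sums (sums0 I) => i; by rewrite mul0r.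
have va : 0 < v a by rewrite uabs_gt0.
move=> e e0; have [|A hA hs] := hF (e / v a); first by rewrite divr_gt0.
exists A => [i /hA|]; rewrite ?uabsM ?[_ * v (F i)]mulrC -?ltr_pdivlMr //.
by rewrite -mulr_sumr -mulrBr uabsM mulrC -ltr_pdivlMr.
Qed.

Lemma sumsN (I : choiceType) (F : I -> V) s : sums F s ->
  sums (fun i => - F i) (- s).
Proof.
by move=> /(sumsZ (-1)); rewrite mulN1r; apply: eq_sums => i; rewrite mulN1r.
Qed.

Lemma sumsB (I : choiceType) (F G : I -> V) s t : sums F s -> sums G t ->
  sums (fun i => F i - G i) (s - t).
Proof. by move=> hF /sumsN; exact: sumsD. Qed.

Lemma sums_sum (I : choiceType) (K : Type) (r : seq K) (F : K -> I -> V) (s : K -> V) :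
  (forall k, sums (F k) (s k)) ->
  sums (fun i => \sum_(k <- r) F k i) (\sum_(k <- r) s k).
Proof.
move=> h; elim: r => [|k r IH].
  by rewrite big_nil; apply: eq_sums (sums0 I) => i; rewrite big_nil.
rewrite big_cons; apply: eq_sums (sumsD (h k) IH) => i.
by rewrite big_cons.
Qed.

Lemma sums_fset (I : choiceType) (F : I -> V) (J : {fset I}) :
  (forall i, i \notin J -> F i = 0) -> sums F (\sum_(i <- J) F i).
Proof.
move=> h e e0; exists J => [i /h ->|]; first by rewrite uabs0.
by rewrite subrr uabs0.
Qed.

Lemma sums_one (I : choiceType) (F : I -> V) i0 :
  (forall i, i != i0 -> F i = 0) -> sums F (F i0).
Proof.
move=> h; have := @sums_fset _ F [fset i0]%fset.
by rewrite big_seq_fset1; apply => i; rewrite inE => /h.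
Qed.

Lemma nullfam_le (I : choiceType) (F G : I -> V) : (forall i, v (F i) <= v (G i)) ->
  nullfam G -> nullfam F.
Proof.
move=> h hG e /hG[J hJ]; exists J => i /hJ; exact: le_lt_trans.
Qed.

(** Regrouping along the fibres of p: a fibre that misses J has a sum below e by the ultrametric
    inequality, so the image of J serves for G. *)
Lemma sums_fiber (I K : choiceType) (p : I -> K) (F : I -> V) (G : K -> V) s :
  sums F s -> (forall k, sums (fun i => if p i == k then F i else 0) (G k)) ->
  sums G s.
Proof.
move=> hs hG e e0; have [J hJ hJs] := hs _ e0.
exists [fset p i | i in J]%fset => [k kJ|].
  apply: sums_lt (hG k) _ => // i; case: eqP => [pi|_]; last by rewrite uabs0.
  by apply: hJ; apply: contra kJ => iJ; apply/imfsetP; exists i.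
rewrite -(subrKA (\sum_(i <- J) F i)) uabsD_lt //.
have -> : \sum_(i <- J) F i =
    \sum_(k <- [fset p i | i in J]%fset) \sum_(i <- J) (if p i == k then F i else 0).
  rewrite exchange_big /= big_seq [RHS]big_seq; apply: eq_bigr => i iJ.
  rewrite (big_fsetD1 (p i)) /=; last by apply/imfsetP; exists i.
  rewrite eqxx big_seq big1 ?addr0 // => k.
  by rewrite !inE eq_sym => /andP[/negPf ->].
rewrite -sumrB; apply: uabs_sum_lt => // k _ _.
rewrite uabsBC; apply: sums_tail (hG k) _ => // i /hJ.
by case: ifP => // _ _; rewrite uabs0.
Qed.

Hypothesis complete : forall F : set_system V, ProperFilter F -> cauchy F -> cvg F.

Lemma nullfam_sums (I : choiceType) (F : I -> V) : nullfam F -> exists s, sums F s.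
Proof.
move=> h; pose S (J : {fset I}) := \sum_(i <- J) F i.
have /complete : cauchy (S @ totally).
  apply: cauchy_exP => e e0; have [J hJ] := h _ e0; exists (S J).
  exists J => //= J' /= JJ'; rewrite ballEmdist.
  change (v (S J - S J') < e); rewrite uabsBC.
  exact: sum_fset_sub.
move=> /cvg_ex[s /valued_cvgP hs]; exists s => e e0.
have [J hJ] := h _ e0; have [J' _ hJ'] := hs _ e0.
exists (J `|` J')%fset => [i|]; first by rewrite inE => /norP[/hJ].
exact/hJ'/fsubsetUr.
Qed.

End Ultranorm.

(** With such a height, a uniform bound on v (F i) * ht i makes F tend to 0 ([nullfam_height]); most
    of the families below are shown to be summable in this way. *)
Definition finite_height (I : choiceType) (ht : I -> nat) : Prop :=
  forall N, exists J : {fset I}, forall i, (ht i <= N)%N -> i \in J.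

Lemma fset_preim_inj (I K : choiceType) (f : I -> K) (J : {fset K}) : injective f ->
  exists J' : {fset I}, forall i, (i \in J') = (f i \in J).
Proof.
move=> fi; pose g k := if pselect (exists i, f i = k) is left h
                       then Some (projT1 (cid h)) else None.
have gf i : g (f i) = Some i.
  rewrite /g; case: pselect => [h|[]]; last by exists i.
  by congr Some; apply: fi; case: (cid h).
exists [fset i in pmap g J]%fset => i; rewrite in_fset mem_pmap.
apply/mapP/idP => [[k kJ]|fJ]; last by exists (f i).
rewrite /g; case: pselect => // h [] ->.
by case: (cid h) => /= i' ->.
Qed.

Lemma finite_height_pair (I K : choiceType) (h : I -> nat) (h' : K -> nat) :
  finite_height h -> finite_height h' ->
  finite_height (fun ik : I * K => h ik.1 + h' ik.2)%N.
Proof.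
move=> H H' N; have [J hJ] := H N; have [J' hJ'] := H' N.
exists [fset ((i, k) : I * K) | i in J, k in J']%fset => -[i k] /= hik.
apply/imfset2P; exists i; first by apply: hJ; apply: leq_trans hik; rewrite leq_addr.
by exists k => //; apply: hJ'; apply: leq_trans hik; rewrite leq_addl.
Qed.

Lemma in_fset_iota n i : (i \in [fset k in iota 0 n]%fset) = (i < n)%N.
Proof. by rewrite in_fset mem_iota. Qed.

Lemma finite_height_nat : finite_height (id : nat -> nat).
Proof. by move=> N; exists [fset i in iota 0 N.+1]%fset => i hi; rewrite in_fset_iota. Qed.

Section SumsReindex.
Variables (R : realType) (C : fieldType) (v : ultranorm R C).
Local Notation V := (valued v).
Hypothesis complete : forall F : set_system V, ProperFilter F -> cauchy F -> cvg F.

Lemma sums_inj (I K : choiceType) (f : I -> K) (F : K -> V) s : injective f ->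
  (forall k, (forall i, f i <> k) -> F k = 0) -> sums (fun i => F (f i)) s -> sums F s.
Proof.
move=> fi F0 hs; apply: (sums_fiber hs (p := f)) => k.
have [[i <-]|h] := pselect (exists i, f i = k).
  have := @sums_one _ _ v _ (fun i' => if f i' == f i then F (f i') else 0) i.
  rewrite eqxx; apply => i' ii'; rewrite ifF //.
  by apply: contra_neqF ii' => /eqP /fi.
rewrite F0 => [|i ik]; last by apply: h; exists i.
apply: eq_sums (sums0 v I) => i; case: eqP => // ik; by case: h; exists i.
Qed.

Lemma inj_sums (I K : choiceType) (f : I -> K) (F : K -> V) s : injective f ->
  (forall k, (forall i, f i <> k) -> F k = 0) -> sums F s -> sums (fun i => F (f i)) s.
Proof.
move=> fi F0 hs; have [t ht] : exists t, sums (fun i => F (f i)) t.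
  apply: (nullfam_sums complete) => e e0; have [J hJ _] := hs _ e0.
  have [J' hJ'] := fset_preim_inj J fi.
  by exists J' => i; rewrite hJ' => /hJ.
by rewrite (sums_unique hs (sums_inj fi F0 ht)).
Qed.

Lemma sums_pair (I K : choiceType) (F : I * K -> V) (G : I -> V) s :
  sums F s -> (forall i, sums (fun k => F (i, k)) (G i)) -> sums G s.
Proof.
move=> hs hG; apply: (sums_fiber hs (p := fst)) => i.
apply: (@sums_inj _ _ (fun k => (i, k))) => [k k' [] //|[i' k] h|].
  by case: eqP => //= E; case: (h k); rewrite E.
by apply: eq_sums (hG i) => k /=; rewrite eqxx.
Qed.

Lemma pair_sums (I K : choiceType) (F : I * K -> V) (G : I -> V) s :
  nullfam F -> (forall i, sums (fun k => F (i, k)) (G i)) -> sums G s -> sums F s.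
Proof.
move=> /(nullfam_sums complete)[t ht] hG hs.
by rewrite (sums_unique hs (sums_pair ht hG)).
Qed.

Lemma nullfam_inj (I K : choiceType) (f : I -> K) (F : K -> V) : injective f ->
  nullfam F -> nullfam (fun i => F (f i)).
Proof.
move=> fi h e e0; have [J hJ] := h _ e0; have [J' hJ'] := fset_preim_inj J fi.
by exists J' => i; rewrite hJ' => /hJ.
Qed.

Lemma pair_sums_swap (I K : choiceType) (F : I * K -> V) (G : I -> V) (H : K -> V) s :
  nullfam F -> (forall i, sums (fun k => F (i, k)) (G i)) ->
  (forall k, sums (fun i => F (i, k)) (H k)) -> sums G s -> sums H s.
Proof.
move=> h0 hG hH hs; have hF := pair_sums h0 hG hs.
apply: (@sums_pair K I (fun ki => F (ki.2, ki.1))) => //.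
apply: (@inj_sums _ _ (fun ki : K * I => (ki.2, ki.1))) => // [[k i] [k' i'] [] -> -> //|].
by move=> [i k] /(_ (k, i)).
Qed.

Lemma nullfam_height (I : choiceType) (ht : I -> nat) (F : I -> V) (B : R) :
  finite_height ht -> (forall i, v (F i) * (ht i)%:R <= B) -> nullfam F.
Proof.
move=> hf hB e e0; have [J hJ] := hf (Num.bound (`|B| / e)).
exists J => i; apply: contraNT; rewrite -leNgt => ei; apply: hJ.
rewrite -(ler_nat R); apply: ltW; apply: le_lt_trans (archi_boundP _); last first.
  by rewrite divr_ge0 // ltW.
rewrite ler_pdivlMr // mulrC; apply: le_trans (ler_norm B).
by apply: le_trans (hB i); rewrite ler_wpM2r.
Qed.

Lemma sums_series (F : nat -> V) s : sums F s -> series F @ \oo --> s.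
Proof.
move=> h; apply/valued_cvgP => e e0; have [J hJ _] := h _ e0.
exists (\max_(i <- J) i).+1 => //= n /= hn; rewrite /series /= big_mkord.
pose J' := [fset i in iota 0 n]%fset.
have -> : \sum_(i < n) F i = \sum_(i <- J') F i.
  rewrite -(big_mkord xpredT F) /index_iota subn0; apply: perm_big.
  apply: uniq_perm; rewrite ?iota_uniq ?fset_uniq // => i.
  by rewrite in_fset.
apply: sums_tail => // i; rewrite inE mem_iota /= add0n -leqNgt => ni.
apply: hJ; apply: contraL ni => iJ; rewrite -ltnNge; apply: leq_trans hn.
by rewrite ltnS; exact: (@leq_bigmax_seq _ (enum_fset J) xpredT id i).
Qed.

Definition vlim (u : nat -> V) (l : V) : Prop :=
  forall e, 0 < e -> exists N, forall n, (N <= n)%N -> v (u n - l) < e.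

Lemma vlim_unique u l l' : vlim u l -> vlim u l' -> l = l'.
Proof.
move=> h h'; apply: uabs_close_eq => e e0.
have [N hN] := h _ e0; have [N' hN'] := h' _ e0.
apply: uabs_trans_lt (hN' (maxn N N') (leq_maxr _ _)).
by rewrite uabsBC hN ?leq_maxl.
Qed.

Lemma vlim_cst a : vlim (fun=> a) a.
Proof. by move=> e e0; exists 0%N => n _; rewrite subrr uabs0. Qed.

Lemma eq_vlim u u' l : (forall n, u n = u' n) -> vlim u l -> vlim u' l.
Proof. by move=> /funext ->. Qed.

Lemma vlimM u u' l l' : vlim u l -> vlim u' l' -> vlim (fun n => u n * u' n) (l * l').
Proof.
move=> h h' e e0; pose B := 1 + v l + v l'.
have vl := uabs_ge0 v l; have vl' := uabs_ge0 v l'.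
have B0 : 0 < B by rewrite /B; lra.
have e1 : 0 < Num.min 1 (e / B) by rewrite lt_min ltr01 divr_gt0.
have [N hN] := h _ e1; have [N' hN'] := h' _ e1; exists (maxn N N') => n.
rewrite geq_max => /andP[/hN + /hN']; rewrite !lt_min => /andP[h1 h2] /andP[h3 h4].
have un : v (u n) < B.
  by rewrite -(subrK l (u n)) uabsD_lt // /B; lra.
have -> : u n * u' n - l * l' = u n * (u' n - l') + (u n - l) * l' by ring.
have eB : (e / B) * B = e by rewrite mulfVK // gt_eqF.
rewrite uabsD_lt // uabsM.
  rewrite -eB mulrC; apply: ltr_pM; rewrite ?uabs_ge0 //.
rewrite -eB; apply: le_lt_trans (_ : v (u n - l) * B < _); last by rewrite ltr_pM2r.
by rewrite ler_wpM2l ?uabs_ge0 // /B; lra.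
Qed.

Lemma vlimX u l k : vlim u l -> vlim (fun n => u n ^+ k) (l ^+ k).
Proof.
move=> h; elim: k => [|k IH]; first exact: vlim_cst.
by rewrite exprS; apply: eq_vlim (vlimM h IH) => n; rewrite exprS.
Qed.

Lemma vlimN u l : vlim u l -> vlim (fun n => - u n) (- l).
Proof.
move=> h; rewrite -mulN1r; apply: eq_vlim (vlimM (vlim_cst (-1)) h) => n.
by rewrite mulN1r.
Qed.

Lemma vlimD u u' l l' : vlim u l -> vlim u' l' -> vlim (fun n => u n + u' n) (l + l').
Proof.
move=> h h' e e0; have [N hN] := h _ e0; have [N' hN'] := h' _ e0.
exists (maxn N N') => n; rewrite geq_max => /andP[/hN h1 /hN' h2].
by rewrite opprD addrACA uabsD_lt.
Qed.

Lemma vlim_sums (I : choiceType) (F : I -> V) s (J : nat -> {fset I}) (ht : I -> nat) :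
  sums F s -> (forall n i, (ht i <= n)%N -> i \in J n) ->
  vlim (fun n => \sum_(i <- J n) F i) s.
Proof.
move=> hs h e e0; have [A hA _] := hs _ e0.
exists (\max_(i <- A) ht i) => n hn; apply: sums_tail => // i iJ.
apply: hA; apply: contra iJ => iA; apply: h; apply: leq_trans hn.
exact: (@leq_bigmax_seq _ (enum_fset A) xpredT ht i).
Qed.

(** In an ultrametric field it is enough that consecutive differences tend to 0, for then the
    telescoping family is summable. *)
Lemma vlim_cauchy (u : nat -> V) :
  (forall e, 0 < e -> exists N, forall n, (N <= n)%N -> v (u n.+1 - u n) < e) ->
  exists l, vlim u l.
Proof.
move=> h; pose F n := if n is k.+1 then u k.+1 - u k else u 0%N.
have FE n : \sum_(i < n.+1) F i = u n.
  elim: n => [|n IH]; first by rewrite big_ord1.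
  by rewrite big_ord_recr IH /= addrC subrK.
have [s hs] : exists s, sums F s.
  apply: (nullfam_sums complete) => e e0; have [N hN] := h _ e0.
  exists [fset i in iota 0 N.+1]%fset => i; rewrite in_fset_iota; case: i => [|i] //=.
  by rewrite ltnS -leqNgt => /hN.
exists s.
have := vlim_sums (J := fun n => [fset i in iota 0 n.+1]%fset) (ht := id) hs.
move=> H; apply: eq_vlim (H _) => [n|n i hi]; last by rewrite in_fset_iota.
rewrite -FE -(big_mkord xpredT F) /index_iota subn0; apply: perm_big.
by apply: uniq_perm; rewrite ?iota_uniq ?fset_uniq // => i; rewrite in_fset.
Qed.

End SumsReindex.

(** Typical use: d is the absolute value of a denominator and h the height of its index. One factor
    of d absorbs h, the others are bounded below by delta. *)
Lemma invX_le (R : realFieldType) (d delta h : R) k : 0 < delta -> delta <= d ->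
  delta * h <= d -> (0 < k)%N -> d ^- k * h <= delta ^- k.
Proof.
move=> d0 dd hd; case: k => // k _.
have dp : 0 < d by exact: lt_le_trans dd.
have hh : h <= delta^-1 * d by rewrite ler_pdivlMl.
apply: le_trans (_ : d ^- k.+1 * (delta^-1 * d) <= _).
  by rewrite ler_wpM2l // invr_ge0 exprn_ge0 // ltW.
have -> : d ^- k.+1 * (delta^-1 * d) = d ^- k * delta^-1.
  by rewrite exprSr; field; rewrite !gt_eqF ?exprn_gt0.
rewrite exprSr invfM ler_pM2r ?invr_gt0 //.
rewrite lef_pV2 ?posrE ?exprn_gt0 //.
by apply: lerXn2r => //; rewrite nnegrE ltW.
Qed.

(** * Enumeration of the polynomials of bounded degree *)

Section Polynomials.
Variable Fq : finFieldType.

Fixpoint polys N : seq {poly Fq} :=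
  if N is N'.+1 then [seq c%:P + 'X * p | c <- enum Fq, p <- polys N'] else [:: 0].

Lemma polyCX (c : Fq) (p : {poly Fq}) : c%:P + 'X * p = cons_poly c p.
Proof. by rewrite cons_poly_def addrC commr_polyX. Qed.

Lemma polyCXE (p : {poly Fq}) : exists c r, p = c%:P + 'X * r /\ size r = (size p).-1.
Proof.
have [c [r E]] : exists c r, p = c%:P + 'X * r.
  elim/poly_ind: p => [|p c _]; first by exists 0, 0; rewrite mulr0 addr0.
  by exists c, p; rewrite polyCX cons_poly_def.
exists c, r; split => //; rewrite E polyCX size_cons_poly nil_poly.
by case: eqVneq => [->|//]; rewrite size_poly0; case: eqP.
Qed.

Lemma size_cXp (c : Fq) (p : {poly Fq}) : (size (c%:P + 'X * p)%R <= (size p).+1)%N.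
Proof. by rewrite polyCX size_cons_poly; case: ifP. Qed.

Lemma cXp_inj (c c' : Fq) (p p' : {poly Fq}) :
  c%:P + 'X * p = c'%:P + 'X * p' -> c = c' /\ p = p'.
Proof.
rewrite !polyCX => E; split; first by have /(congr1 (fun r : {poly Fq} => r`_0)) := E; rewrite !coef_cons.
by apply/polyP => i; have /(congr1 (fun r : {poly Fq} => r`_i.+1)) := E; rewrite !coef_cons.
Qed.

Lemma mem_polys N p : (p \in polys N) = (size p <= N)%N.
Proof.
elim: N p => [|N IH] p; first by rewrite inE size_poly_leq0.
apply/allpairsP/idP => [[[c r] /= [_ hr ->]]|hp].
  by apply: leq_trans (size_cXp _ _) _; rewrite ltnS -IH.
have [c [r [E sr]]] := polyCXE p; exists (c, r); rewrite mem_enum; split => //=.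
by rewrite IH sr; case: (size p) hp.
Qed.

Lemma uniq_polys N : uniq (polys N).
Proof.
elim: N => [//|N IH]; apply: allpairs_uniq => //; first exact: enum_uniq.
by move=> [c p] [c' p'] _ _ /= /cXp_inj[-> ->].
Qed.

Lemma big_polysS (V : nmodType) N (g : {poly Fq} -> V) :
  \sum_(p <- polys N.+1) g p = \sum_(c : Fq) \sum_(p <- polys N) g (c%:P + 'X * p).
Proof. by rewrite big_allpairs_dep big_enum. Qed.

Lemma finite_height_poly : finite_height (fun p : {poly Fq} => size p).
Proof. by move=> N; exists [fset p in polys N]%fset => p hp; rewrite in_fset mem_polys. Qed.

Lemma big_polyset (V : nmodType) N (g : {poly Fq} -> V) :
  \sum_(p <- [fset p in polys N]%fset) g p = \sum_(p <- polys N) g p.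
Proof.
by apply/perm_big/uniq_perm; rewrite ?uniq_polys ?fset_uniq // => p; rewrite in_fset.
Qed.

Definition polys2 N := [seq (a, b) | a <- polys N, b <- polys N].

Lemma mem_polys2 N m : (m \in polys2 N) = (size m.1 <= N)%N && (size m.2 <= N)%N.
Proof.
case: m => a b; rewrite -!mem_polys; apply/allpairsP/andP => [[[x y] /= [? ? [-> ->]]]//|[? ?]].
by exists (a, b).
Qed.

Lemma uniq_polys2 N : uniq (polys2 N).
Proof. by apply: allpairs_uniq; rewrite ?uniq_polys // => -[? ?] [? ?]. Qed.

End Polynomials.

(** * Lattice sums over F_q[T] *)

Section Lattice.
Variables (R : realType) (Fq : finFieldType) (C : fieldType) (v : ultranorm R C).
Local Notation V := (valued v).
Variable iota : {rmorphism {poly Fq} -> V}.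
Local Notation q := #|Fq|.
Implicit Types (p m n : {poly Fq}).

Definition jj : {rmorphism Fq -> V} := iota \o polyC.

Lemma jjE c : jj c = iota c%:P. Proof. by []. Qed.

Hypothesis iota_norm : forall p, p != 0 -> v (iota p) = q%:R ^+ (size p).-1.

Lemma q_gt1 : 1 < q%:R :> R.
Proof. by rewrite ltr1n card_gt1. Qed.

Lemma iota_ge1 p : p != 0 -> 1 <= v (iota p).
Proof. by move=> /iota_norm ->; rewrite exprn_ege1 // ltW // q_gt1. Qed.

Lemma iota_eq0 p : (iota p == 0) = (p == 0).
Proof.
apply/eqP/eqP => [E|->]; last by rewrite rmorph0.
apply/eqP; apply: contraT => /iota_ge1; rewrite E uabs0.
by rewrite ler10.
Qed.

Lemma expq_ge_size (n : nat) : n.+1%:R <= q%:R ^+ n :> R.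
Proof.
by rewrite -natrX ler_nat; apply: ltn_expl; exact: card_gt1.
Qed.

Lemma size_le_iota p : (size p)%:R <= v (iota p).
Proof.
have [->|p0] := eqVneq p 0; first by rewrite size_poly0 uabs_ge0.
rewrite iota_norm //; apply: le_trans (expq_ge_size _).
by rewrite prednK // size_poly_gt0.
Qed.

Lemma iota_polyC (c : Fq) : c != 0 -> v (iota c%:P) = 1.
Proof. by move=> c0; rewrite iota_norm ?polyC_eq0 // size_polyC c0 expr0. Qed.

Lemma iota_X : v (iota 'X) = q%:R.
Proof. by rewrite iota_norm ?polyX_eq0 // size_polyX expr1. Qed.

Lemma T_neq0 : iota 'X != 0.
Proof. by rewrite iota_eq0 polyX_eq0. Qed.

Definition lin (x y : V) (m n : {poly Fq}) : V := iota m * x + iota n * y.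

(** Quantitative independence of x and y over F_infty. It holds for (z, 1) with z in Omega
    ([Omega_nondeg]), and passes to combinations of nonzero determinant ([nondeg_lin]). *)
Definition nondeg (c : R) (x y : V) : Prop :=
  0 < c /\ forall m n, c * v (iota m) <= v (lin x y m n) /\
                       c * v (iota n) <= v (lin x y m n).

Lemma lin_ge c x y m n : nondeg c x y -> (m != 0) || (n != 0) ->
  c <= v (lin x y m n).
Proof.
move=> [c0 h] /orP[m0|n0]; have [h1 h2] := h m n.
  by apply: le_trans h1; rewrite ler_peMr ?iota_ge1 // ltW.
by apply: le_trans h2; rewrite ler_peMr ?iota_ge1 // ltW.
Qed.

Lemma lin_eq0 c x y m n : nondeg c x y -> (lin x y m n == 0) = (m == 0) && (n == 0).
Proof.
move=> h; apply/eqP/andP => [E|[/eqP -> /eqP ->]]; last first.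
  by rewrite /lin rmorph0 !mul0r addr0.
suff : ~~ ((m != 0) || (n != 0)) by rewrite negb_or !negbK => /andP.
apply/negP => /(lin_ge h); rewrite E uabs0 leNgt.
by case: h => ->.
Qed.

Lemma linZ x y (a m n : {poly Fq}) : iota a * lin x y m n = lin x y (a * m) (a * n).
Proof. by rewrite /lin mulrDr !mulrA !rmorphM. Qed.

Lemma linD x y (m n m' n' : {poly Fq}) :
  lin x y m n + lin x y m' n' = lin x y (m + m') (n + n').
Proof. by rewrite /lin addrACA -!mulrDl !rmorphD. Qed.

Lemma linB x y (m n m' n' : {poly Fq}) :
  lin x y m n - lin x y m' n' = lin x y (m - m') (n - n').
Proof. by rewrite /lin opprD addrACA -!mulrBl !rmorphB. Qed.

Lemma lin_lin x y (a b c d m n : {poly Fq}) :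
  lin (lin x y a b) (lin x y c d) m n = lin x y (m * a + n * c) (m * b + n * d).
Proof. by rewrite {1}/lin !linZ linD. Qed.

(* Each of the q+1 factors of the Moore determinant is at least c, and one of
   them is at least c times a given entry. *)
Lemma moore2_ge c x y (a b a' b' : {poly Fq}) : nondeg c x y ->
  a * b' - b * a' != 0 ->
  let d := v (moore2 Fq (lin x y a b) (lin x y a' b')) in
  [/\ c ^+ q.+1 <= d, c ^+ q.+1 * v (iota a) <= d, c ^+ q.+1 * v (iota b) <= d,
      c ^+ q.+1 * v (iota a') <= d & c ^+ q.+1 * v (iota b') <= d].
Proof.
move=> h det0 /=; rewrite (moore2_prod jj) uabsM uabs_prod.
have [c0 hl] := h.
have hy : c <= v (lin x y a' b').
  apply: lin_ge => //; apply: contraNT det0; rewrite negb_or !negbK.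
  by case/andP=> /eqP -> /eqP ->; rewrite !mulr0 subr0.
have E e : lin x y a b - jj e * lin x y a' b' =
    lin x y (a - e%:P * a') (b - e%:P * b').
  by rewrite jjE linZ linB.
have hf e : c <= v (lin x y a b - jj e * lin x y a' b').
  rewrite E; apply: lin_ge => //; apply: contraNT det0; rewrite negb_or !negbK.
  rewrite !subr_eq0 => /andP[/eqP -> /eqP ->].
  by rewrite -mulrA [a' * b']mulrC mulrA.
have hP0 (P : pred Fq) :
    c ^+ #|P| <= \prod_(e | P e) v (lin x y a b - jj e * lin x y a' b').
  rewrite -prodr_const; apply: ler_prod => e _.
  by rewrite hf (ltW c0).
have hP : c ^+ q <= \prod_e v (lin x y a b - jj e * lin x y a' b').
  by have := hP0 predT.
have cq : 0 <= c ^+ q by rewrite exprn_ge0 // ltW.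
have key1 t : c * t <= v (lin x y a' b') -> c ^+ q.+1 * t <=
    v (lin x y a' b') * \prod_e v (lin x y a b - jj e * lin x y a' b').
  move=> ht; rewrite exprSr -mulrA mulrC.
  apply: le_trans (_ : v (lin x y a' b') * c ^+ q <= _).
    by rewrite ler_wpM2r.
  by rewrite ler_wpM2l ?uabs_ge0.
have key2 t : c * t <= v (lin x y a b) -> c ^+ q.+1 * t <=
    v (lin x y a' b') * \prod_e v (lin x y a b - jj e * lin x y a' b').
  move=> ht; rewrite (bigD1 0) //= rmorph0 mul0r subr0.
  have -> : c ^+ q.+1 * t = c * ((c * t) * c ^+ q.-1).
    by rewrite -{1}(prednK (card_gt0 Fq)) !exprS; ring.
  apply: le_trans (_ : c * (v (lin x y a b) * c ^+ q.-1) <= _).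
    by rewrite ler_pM2l // ler_wpM2r // exprn_ge0 // ltW.
  apply: ler_pM => //; first by rewrite ltW.
    by rewrite mulr_ge0 ?uabs_ge0 // exprn_ge0 // ltW.
  rewrite ler_wpM2l ?uabs_ge0 // -(cardC1 (0 : Fq)).
  exact: (hP0 (predC1 0)).
have [h1 h2] := hl a b; have [h3 h4] := hl a' b'.
split; [|exact: key2|exact: key2|exact: key1|exact: key1].
by rewrite -[leLHS]mulr1; apply: key1; rewrite mulr1.
Qed.

(** By Cramer's rule, m D and n D are combinations of the coordinates r and s of the vector with
    coefficients among the matrix entries; as |D| >= 1, dividing c by a bound B of these entries
    suffices. *)
Lemma nondeg_lin c x y (a b a' b' : {poly Fq}) : nondeg c x y ->
  a * b' - b * a' != 0 -> exists c', nondeg c' (lin x y a b) (lin x y a' b').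
Proof.
move=> [c0 h] det0; set D := a * b' - b * a' in det0.
pose B := 1 + v (iota a) + v (iota b) + v (iota a') + v (iota b').
have p0 p : 0 <= v (iota p) := uabs_ge0 v _.
have B0 : 0 < B by rewrite /B; have := p0 a; have := p0 b; have := p0 a'; have := p0 b'; lra.
exists (c / B); split=> [|m n]; first by rewrite divr_gt0.
rewrite lin_lin; set r := m * a + n * a'; set s := m * b + n * b'.
have [h1 h2] := h r s.
have mE : m * D = r * b' - s * a' by rewrite /D /r /s; ring.
have nE : n * D = s * a - r * b by rewrite /D /r /s; ring.
have D1 := iota_ge1 det0.
have key t p1 p2 : t * D = r * p1 - s * p2 -> v (iota p1) <= B -> v (iota p2) <= B ->
    c / B * v (iota t) <= v (lin x y r s).
  move=> E hp1 hp2; rewrite mulrAC ler_pdivrMr //.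
  apply: le_trans (_ : c * v (iota (t * D)) <= _).
    by rewrite ler_pM2l // rmorphM uabsM ler_peMr.
  have rs : v (iota (r * p1 - s * p2)) * c <= v (lin x y r s) * B.
    rewrite rmorphB !rmorphM -ler_pdivlMr //; apply: uabsB_le; rewrite uabsM.
      rewrite ler_pdivlMr // mulrC mulrA.
      by apply: ler_pM; rewrite ?mulr_ge0 ?(ltW c0).
    rewrite ler_pdivlMr // mulrC mulrA.
    by apply: ler_pM; rewrite ?mulr_ge0 ?(ltW c0).
  by rewrite E mulrC.
have b4 : [/\ v (iota a) <= B, v (iota b) <= B, v (iota a') <= B & v (iota b') <= B].
  by have := p0 a; have := p0 b; have := p0 a'; have := p0 b'; rewrite /B; split; lra.
case: b4 => ba bb ba' bb'; split; first exact: key mE bb' ba'.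
by apply: (key n (- b) (- a)); rewrite ?rmorphN ?uabsN // nE; ring.
Qed.

End Lattice.

Section SpanMap.
Variables (Fq : finFieldType) (K : fieldType) (j : {rmorphism Fq -> K}) (T : K).

Lemma sum_span_map bs (g : K -> K) :
  \sum_(w <- span j [seq T * b | b <- bs]) g w = \sum_(w <- span j bs) g (T * w).
Proof.
elim: bs g => [|b bs IH] g; first by rewrite !big_seq1 mulr0.
rewrite map_cons !sum_span_cons; apply: eq_bigr => c _; rewrite IH.
by apply: eq_bigr => w _; congr g; ring.
Qed.

Lemma mem_span_map bs w : w \in span j [seq T * b | b <- bs] ->
  exists2 w', w' \in span j bs & w = T * w'.
Proof.
elim: bs w => [|b bs IH] w.
  by rewrite inE => /eqP ->; exists 0; rewrite ?mulr0 ?inE.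
rewrite map_cons => /mem_span_cons[c [w1 [/IH[w2 h ->] ->]]].
exists (j c * b + w2); last by ring.
by apply/mem_span_cons; exists c, w2.
Qed.

Lemma indep_map bs : T != 0 -> indep j bs -> indep j [seq T * b | b <- bs].
Proof.
move=> T0; elim: bs => [//|b bs IH] /= /andP[hb /IH ->]; rewrite andbT.
apply: contra hb => /mem_span_map[w hw] /(mulfI T0) -> //.
Qed.

Lemma fqlin_sum (f : K -> K) (I : Type) (r : seq I) (c : I -> Fq) (z : I -> K) :
  fqlin j f -> f (\sum_(i <- r) j (c i) * z i) = \sum_(i <- r) j (c i) * f (z i).
Proof.
move=> fl; elim: r => [|i r IH]; first by rewrite !big_nil (fqlin0 fl).
by rewrite !big_cons (fqlinD fl) (fqlinZ fl) IH.
Qed.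

End SpanMap.

Section Towers.
Variables (R : realType) (Fq : finFieldType) (C : fieldType) (v : ultranorm R C).
Local Notation V := (valued v).
Variable iota : {rmorphism {poly Fq} -> V}.
Local Notation q := #|Fq|.
Implicit Types (p m n : {poly Fq}) (x y : V).
Local Notation T := (iota 'X).
Local Notation jj := (jj iota).
Local Notation lin := (lin iota).

Hypothesis iota_norm : forall p, p != 0 -> v (iota p) = q%:R ^+ (size p).-1.

Lemma iota_cXp (c : Fq) p : iota (c%:P + 'X * p) = jj c + T * iota p.
Proof. by rewrite rmorphD rmorphM. Qed.

Definition powers y N : seq V := mkseq (fun k => T ^+ k * y) N.

Lemma powersS y N : powers y N.+1 = y :: [seq T * b | b <- powers y N].
Proof.
rewrite /powers /mkseq -map_comp /= expr0 mul1r (iotaDl 1 0) -map_comp.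
by congr (_ :: _); apply: eq_map => k /=; rewrite exprS mulrA.
Qed.

Lemma sum_powers y N (g : V -> V) :
  \sum_(w <- span jj (powers y N)) g w = \sum_(n <- polys Fq N) g (iota n * y).
Proof.
elim: N g => [|N IH] g; first by rewrite !big_seq1 rmorph0 mul0r.
rewrite powersS sum_span_cons big_polysS; apply: eq_bigr => c _.
rewrite sum_span_map IH; apply: eq_bigr => n _; congr g.
by rewrite iota_cXp; ring.
Qed.

Lemma mem_powers y N w : w \in span jj (powers y N) ->
  exists2 n : {poly Fq}, (size n <= N)%N & w = iota n * y.
Proof.
elim: N w => [|N IH] w.
  by rewrite inE => /eqP ->; exists 0; rewrite ?size_poly0 // rmorph0 mul0r.
rewrite powersS => /mem_span_cons[c [w1 [/mem_span_map[w2 /IH[n hn ->] ->] ->]]].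
exists (c%:P + 'X * n); first by apply: leq_trans (size_cXp _ _) _.
by rewrite iota_cXp; ring.
Qed.

Lemma indep_powers y N : y != 0 -> indep jj (powers y N).
Proof.
move=> y0; elim: N => [//|N IH]; rewrite powersS /= indep_map ?T_neq0 // andbT.
apply/negP => /mem_span_map[w /mem_powers[n _ ->]] /eqP.
rewrite mulrA -[X in X == _]mul1r -(rmorph1 iota) -rmorphM -subr_eq0 -mulrBl -rmorphB.
rewrite mulf_eq0 (negPf y0) orbF iota_eq0 // subr_eq0 => /eqP /(congr1 (fun r : {poly Fq} => r`_0)).
by rewrite coef1 coefXM /= => /eqP; rewrite oner_eq0.
Qed.

(** Since x and y alternate, removing the first two vectors leaves T times the tower for N - 1. The
    span consists of the m x + n y with m and n of size at most N. *)
Definition towers x y N : seq V := mkseq (tower T x y) N.*2.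

Lemma towersS x y N : towers x y N.+1 = [:: x, y & [seq T * b | b <- towers x y N]].
Proof. by rewrite /towers doubleS mkseq_tower. Qed.

Lemma sum_towers x y N (g : V -> V) :
  \sum_(w <- span jj (towers x y N)) g w =
  \sum_(m <- polys Fq N) \sum_(n <- polys Fq N) g (lin x y m n).
Proof.
elim: N g => [|N IH] g; first by rewrite !big_seq1 /lin rmorph0 !mul0r addr0.
rewrite towersS !sum_span_cons big_polysS; apply: eq_bigr => c _.
rewrite sum_span_cons; under [RHS]eq_bigr do rewrite big_polysS.
rewrite [RHS]exchange_big /=; apply: eq_bigr => c' _.
rewrite sum_span_map IH; apply: eq_bigr => m _; apply: eq_bigr => n _; congr g.
by rewrite /lin !iota_cXp; ring.
Qed.

Lemma mem_towers x y N w : w \in span jj (towers x y N) ->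
  exists m n : {poly Fq}, w = lin x y m n.
Proof.
elim: N w => [|N IH] w.
  rewrite inE => /eqP ->; exists 0, 0; by rewrite /lin rmorph0 !mul0r addr0.
rewrite towersS => /mem_span_cons[c [w1 [/mem_span_cons[c' [w2 [+ ->]]] ->]]].
move=> /mem_span_map[w3 /IH[m [n ->]] ->].
exists (c%:P + 'X * m), (c'%:P + 'X * n).
by rewrite /lin !iota_cXp; ring.
Qed.

Lemma indep_towers c x y N : nondeg iota c x y -> indep jj (towers x y N).
Proof.
move=> h; elim: N => [//|N IH]; rewrite towersS.
have one_X p : (1 - 'X * p == 0) = false.
  apply/negP; rewrite subr_eq0 => /eqP /(congr1 (fun r : {poly Fq} => r`_0)).
  by rewrite coef1 coefXM /= => /eqP; rewrite oner_eq0.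
have hy : y \notin span jj [seq T * b | b <- towers x y N].
  apply/negP => /mem_span_map[w /mem_towers[m [n ->]]] /eqP.
  rewrite linZ -subr_eq0 (_ : y - _ = lin x y (- ('X * m)) (1 - 'X * n)).
    by rewrite (lin_eq0 iota_norm _ _ h) one_X andbF.
  by rewrite /lin rmorphB rmorph1 rmorphN; ring.
have hx : x \notin span jj (y :: [seq T * b | b <- towers x y N]).
  apply/negP => /mem_span_cons[e [w1 [/mem_span_map[w2 /mem_towers[m [n ->]] ->]]]] /eqP.
  rewrite linZ -subr_eq0 (_ : x - _ = lin x y (1 - 'X * m) (- e%:P - 'X * n)).
    by rewrite (lin_eq0 iota_norm _ _ h) one_X.
  by rewrite /lin !rmorphB rmorph1 rmorphN jjE; ring.
by rewrite /= hx hy indep_map // T_neq0.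
Qed.

Lemma poly_sum N p : (size p <= N)%N -> p = \sum_(i < N) (p`_i)%:P * 'X^i.
Proof.
move=> hp; apply/polyP => k; rewrite coef_sum.
under eq_bigr do rewrite coefCM coefXn.
have [kN|kN] := ltnP k N.
  rewrite (bigD1 (Ordinal kN)) //= eqxx mulr1 big1 ?addr0 // => i ik.
  by rewrite eq_sym (_ : (_ == _) = false) ?mulr0 //; apply/negbTE.
rewrite nth_default ?(leq_trans hp) // big1 // => i _.
by rewrite (_ : (_ == _) = false) ?mulr0 //; apply/negbTE; case: i => /= i hi; lia.
Qed.

Lemma iota_sum N p : (size p <= N)%N -> iota p = \sum_(i < N) jj p`_i * T ^+ i.
Proof.
move=> /poly_sum {1}->; rewrite rmorph_sum; apply: eq_bigr => i _.
by rewrite rmorphM rmorphXn.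
Qed.

Definition CC M : V := tower_const Fq T M.*2.

(** This is [sum_tower_ratio] in terms of polynomials. On the span, [ev] sends m x + n y to m^q; the
    spans on its right-hand side are made of multiples of T, so that the arguments of [moore2] are
    the rows of matrices congruent to 1 modulo T. *)
Lemma finite_identity c x y M k : odd q -> nondeg iota c x y -> (0 < k < q)%N ->
  \sum_(m <- polys Fq M.+1) iota m ^+ (k * q) *
     \sum_(n <- polys Fq M.+1) lin x y m n ^- k =
  - (- y ^+ q * CC M) ^+ k *
  \sum_(u <- polys2 Fq M) \sum_(w <- polys2 Fq M)
    moore2 Fq (x + T * lin x y u.1 u.2) (y + T * lin x y w.1 w.2) ^- k.
Proof.
move=> oq h hk; have hi := indep_towers M.+1 h.
have := @sum_tower_ratio Fq _ jj T x y M.*2 k oq (T_neq0 iota_norm).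
rewrite -[mkseq _ _.+2]/(towers x y M.+1) => /(_ hi hk)[ev [evl evt]].
rewrite -[mkseq _ _]/(towers x y M) -/(CC M) sum_towers => E.
have evx i : (i < M.+1)%N -> ev (T ^+ i * x) = T ^+ (i * q).
  move=> hM; have := evt i.*2; rewrite /tower /tower_coord odd_double doubleK.
  by rewrite exprM => -> //; rewrite -doubleS ltn_double.
have evy i : (i < M.+1)%N -> ev (T ^+ i * y) = 0.
  move=> hM; have := evt i.*2.+1; rewrite /tower /tower_coord /= odd_double /=.
  rewrite uphalf_double => ->; first by rewrite expr0n; move: (card_gt1 Fq); case: q.
  by lia.
have evlin m n : (size m <= M.+1)%N -> (size n <= M.+1)%N ->
    ev (lin x y m n) = iota m ^+ q.
  move=> hm hn; rewrite /lin (iota_sum hm) (iota_sum hn) (fqlinD evl) !mulr_suml.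
  under eq_bigr do rewrite -mulrA.
  under [in X in _ + X]eq_bigr do rewrite -mulrA.
  rewrite !(fqlin_sum _ _ _ evl) (frob_sum jj) [X in _ + X]big1 ?addr0 => [|i _].
    by apply: eq_bigr => i _; rewrite evx // exprMn (frobj jj) exprM.
  by rewrite evy ?mulr0.
transitivity (\sum_(m <- polys Fq M.+1) \sum_(n <- polys Fq M.+1)
    (ev (lin x y m n) / lin x y m n) ^+ k).
  rewrite big_seq [RHS]big_seq; apply: eq_bigr => m; rewrite mem_polys => hm.
  rewrite mulr_sumr big_seq [RHS]big_seq; apply: eq_bigr => n; rewrite mem_polys => hn.
  by rewrite evlin // expr_div_n -exprM [(k * q)%N]mulnC.
rewrite E; congr (_ * _); rewrite sum_span_map sum_towers big_allpairs_dep.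
apply: eq_bigr => m _; apply: eq_bigr => n _.
rewrite sum_span_map sum_towers big_allpairs_dep.
by apply: eq_bigr => m' _; apply: eq_bigr => n' _.
Qed.

End Towers.

Section Usum.
Variables (R : realType) (C : fieldType) (v : ultranorm R C).
Local Notation V := (valued v).

Definition usum (I : choiceType) (F : I -> V) : V := xget 0 [set s | sums F s].

Lemma usumE (I : choiceType) (F : I -> V) s : sums F s -> usum F = s.
Proof.
move=> hs; rewrite /usum; case: xgetP => [t _ ht|/(_ s)//].
exact: sums_unique ht hs.
Qed.

Lemma vlim_le (u : nat -> V) l B N : vlim u l ->
  (forall n, (N <= n)%N -> v (u n) <= B) -> v l <= B.
Proof.
move=> h hB; rewrite leNgt; apply/negP => lt.
have B0 : 0 <= B := le_trans (uabs_ge0 v _) (hB N (leqnn N)).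
have [N' hN'] := h _ (le_lt_trans B0 lt).
have := hN' _ (leq_maxr N N'); rewrite uabsBC => hlt.
have := uabsD_lt hlt (le_lt_trans (hB _ (leq_maxl N N')) lt).
by rewrite subrK ltxx.
Qed.

Lemma vlim_subseq (u : nat -> V) l (f : nat -> nat) : (forall n, (n <= f n)%N) ->
  vlim u l -> vlim (fun n => u (f n)) l.
Proof.
move=> hf h e /h[N hN]; exists N => n hn; apply: hN.
exact: leq_trans hn (hf n).
Qed.

Lemma vlim_eventually (r : seq nat) (I : eqType) (s : seq I) (u : nat -> I -> V)
    (G : I -> V) e : 0 < e -> (forall i, vlim (u^~ i) (G i)) ->
  exists N, forall i, i \in s -> forall n, (N <= n)%N -> v (u n i - G i) < e.
Proof.
move=> e0 h; elim: s => [|i s [N hN]]; first by exists 0%N.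
have [N' hN'] := h i _ e0; exists (maxn N N') => k; rewrite inE => /orP[/eqP ->|ks] n.
  by rewrite geq_max => /andP[_]; exact: hN'.
by rewrite geq_max => /andP[+ _]; exact: hN.
Qed.

(** Dominated convergence: the bound is uniform in n, so outside one finite set all terms are below
    e for every n >= N0, and on that set the finitely many limits are taken separately. *)
Lemma vlim_tannery (I : choiceType) (ht : I -> nat) (u : nat -> I -> V) (G : I -> V)
    s (J : nat -> {fset I}) (N0 : nat) B : finite_height ht ->
  (forall n i, (N0 <= n)%N -> v (u n i) * (ht i)%:R <= B) ->
  (forall i, vlim (u^~ i) (G i)) -> sums G s ->
  (forall n i, (ht i <= n)%N -> i \in J n) ->
  vlim (fun n => \sum_(i <- J n) u n i) s.
Proof.
move=> hf hB hG hs hJ e e0.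
have [A hA] := hf (Num.bound (`|B| / e)); have [A' hA' _] := hs _ e0.
have hA1 n i : (N0 <= n)%N -> i \notin A -> v (u n i) < e.
  move=> hn; apply: contraNT; rewrite -leNgt => ei; apply: hA.
  rewrite -(ler_nat R); apply: ltW; apply: le_lt_trans (archi_boundP _); last first.
    by rewrite divr_ge0 // ltW.
  rewrite ler_pdivlMr // mulrC; apply: le_trans (ler_norm B).
  by apply: le_trans (hB n i hn); rewrite ler_wpM2r.
pose A2 := (A `|` A')%fset.
have [N1 hN1] := vlim_eventually [::] (enum_fset A2) e0 hG.
exists (maxn N0 (maxn N1 (\max_(i <- A2) ht i))) => n.
rewrite !geq_max => /and3P[n0 n1 n2].
have sub : (A2 `<=` J n)%fset.
  apply/fsubsetP => i iA; apply: hJ; apply: leq_trans n2.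
  exact: (@leq_bigmax_seq _ (enum_fset A2) xpredT ht i).
have -> : \sum_(i <- J n) u n i - s = (\sum_(i <- J n) u n i - \sum_(i <- A2) u n i) +
   ((\sum_(i <- A2) (u n i - G i)) + (\sum_(i <- A2) G i - s)).
  by rewrite sumrB; ring.
apply: uabsD_lt.
  by apply: sum_fset_sub => // i; rewrite inE => /norP[iA _]; apply: hA1.
apply: uabsD_lt.
  by apply: uabs_sum_lt => // i iA _; apply: hN1.
by apply: sums_tail => // i; rewrite inE => /norP[_]; exact: hA'.
Qed.

Hypothesis complete : forall F : set_system V, ProperFilter F -> cauchy F -> cvg F.

Lemma usumP (I : choiceType) (F : I -> V) : nullfam F -> sums F (usum F).
Proof. by move=> /(nullfam_sums complete)[s hs]; rewrite (usumE hs). Qed.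

End Usum.

(** * The series F_k and S_k *)

Section EisensteinSums.
Variables (R : realType) (Fq : finFieldType) (C : fieldType) (v : ultranorm R C).
Local Notation V := (valued v).
Variable iota : {rmorphism {poly Fq} -> V}.
Local Notation q := #|Fq|.
Implicit Types (p m n : {poly Fq}) (x y : V).
Local Notation T := (iota 'X).
Local Notation jj := (jj iota).
Local Notation lin := (lin iota).
Local Notation nondeg := (nondeg iota).

Hypothesis complete : forall F : set_system V, ProperFilter F -> cauchy F -> cvg F.
Hypothesis iota_norm : forall p, p != 0 -> v (iota p) = q%:R ^+ (size p).-1.

(** At m = n = 0 this is 0, as the inverse of 0 is 0; in F_k the weight m^(k q) removes the whole
    line m = 0. *)
Definition tterm k x y m n : V := lin x y m n ^- k.

Lemma tterm_bound c x y m n k : nondeg c x y -> (0 < k)%N ->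
  v (tterm k x y m n) * (size n)%:R <= c ^- k.
Proof.
move=> h k0; have c0 : 0 < c by case: h.
rewrite /tterm uabsV uabsX.
have [/orP mn|mn] := boolP ((m != 0) || (n != 0)).
  apply: invX_le => //; first by apply: (lin_ge iota_norm h); apply/orP.
  apply: le_trans (h.2 m n).2; rewrite ler_pM2l //.
  exact: size_le_iota.
move: mn; rewrite negb_or !negbK => /andP[/eqP -> /eqP ->].
by rewrite size_poly0 mulr0 invr_ge0 exprn_ge0 // ltW.
Qed.

Lemma tterm_null c x y m k : nondeg c x y -> (0 < k)%N -> nullfam (tterm k x y m).
Proof.
move=> h k0; apply: (nullfam_height (finite_height_poly Fq)) => n.
exact: tterm_bound h k0.
Qed.

Definition tsum k x y m : V := usum (tterm k x y m).

Lemma tsumP c x y m k : nondeg c x y -> (0 < k)%N ->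
  sums (tterm k x y m) (tsum k x y m).
Proof. by move=> h k0; apply: (usumP complete); exact: tterm_null h k0. Qed.

Definition tpart k x y N m : V := \sum_(n <- polys Fq N) tterm k x y m n.

Lemma tpart_lim c x y m k : nondeg c x y -> (0 < k)%N ->
  vlim (fun N => tpart k x y N m) (tsum k x y m).
Proof.
move=> h k0; have := vlim_sums (J := fun N => [fset p in polys Fq N]%fset)
  (ht := fun p : {poly Fq} => size p) (tsumP m h k0).
move=> H; apply: eq_vlim (H _) => [N|N p hp]; first by rewrite big_polyset.
by rewrite in_fset mem_polys.
Qed.

Lemma lin_notin_powers c x y m N : nondeg c x y -> m != 0 ->
  iota m * x \notin span jj (powers iota y N).
Proof.
move=> h m0; apply/negP => /mem_powers[n _ E].
have := lin_eq0 iota_norm m (- n) h; rewrite (negPf m0) /= => /negP; apply.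
by rewrite /lin E rmorphN mulNr subrr.
Qed.

Lemma nondeg_neq0 c x y : nondeg c x y -> y != 0.
Proof.
move=> h; have := lin_eq0 iota_norm 0 1 h.
by rewrite /lin rmorph0 rmorph1 mul0r add0r mul1r oner_eq0 andbF => ->.
Qed.

Lemma tpart_espan c x y m N k : nondeg c x y -> m != 0 -> (0 < k <= q)%N ->
  tpart k x y N m = espan Fq (powers iota y N) (iota m * x) ^- k.
Proof.
move=> h m0 hk; rewrite -(sum_span_inv (indep_powers iota_norm N (nondeg_neq0 h))) //.
  by rewrite sum_powers.
exact: lin_notin_powers h m0.
Qed.

Lemma tpart_pow c x y m N k : nondeg c x y -> m != 0 -> (0 < k <= q)%N ->
  tpart k x y N m = tpart 1 x y N m ^+ k.
Proof.
move=> h m0 hk; rewrite !(tpart_espan _ h m0) ?card_gt0 //.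
by rewrite -exprVn expr1 exprVn.
Qed.

Definition tbound c y : R := v (pspan Fq (powers iota y 2)) / c ^+ (q ^ 2).

(** Group the n by their residue modulo T^2. Each group sums to 1 / espan X by [sum_span_inv], and
    espan X is, up to a constant, a product of q^2 numbers of size at least c |m|. Residues modulo T
    would give only |m|^-q, which balances the weight m^q without decay. *)
Lemma tpart_le c x y m N : nondeg c x y -> m != 0 -> (2 <= N)%N ->
  v (tpart 1 x y N m) <= tbound c y / v (iota m) ^+ (q ^ 2).
Proof.
move=> h m0; case: N => [|[|N]] // _; have c0 : 0 < c by case: h.
have y0 := nondeg_neq0 h.
have m1 := iota_ge1 iota_norm m0.
have cm0 : 0 < c * v (iota m) by rewrite mulr_gt0 // (lt_le_trans ltr01).
have bound0 : 0 <= tbound c y / v (iota m) ^+ (q ^ 2).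
  by rewrite /tbound !divr_ge0 ?uabs_ge0 ?exprn_ge0 ?uabs_ge0 // ltW.
pose g (w : V) := (iota m * x + w) ^- 1.
have -> : tpart 1 x y N.+2 m = \sum_(w <- span jj (powers iota y N.+2)) g w.
  by rewrite sum_powers.
have i2 := indep_powers iota_norm 2 y0.
have E2 : powers iota y 2 = [:: y; T * y].
  by rewrite /powers /mkseq /= expr0 mul1r expr1.
have -> : powers iota y N.+2 = [:: y, T * y & [seq T * b | b <- [seq T * b | b <- powers iota y N]]].
  by rewrite powersS powersS.
rewrite !sum_span_cons; under eq_bigr do rewrite sum_span_cons exchange_big /=.
rewrite exchange_big /= !sum_span_map sum_powers.
apply: uabs_sum_le => // n _ _.
have hn u : u \in span jj (powers iota y 2) ->
    c * v (iota m) <= v (iota m * x + T * (T * (iota n * y)) + u).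
  move=> /mem_powers[n' _ ->].
  have -> : iota m * x + T * (T * (iota n * y)) + iota n' * y =
            lin x y m ('X * ('X * n) + n').
    by rewrite /lin !(rmorphD, rmorphM); ring.
  exact: (h.2 _ _).1.
set X := iota m * x + T * (T * (iota n * y)) in hn *.
have Xn : X \notin span jj (powers iota y 2).
  apply/negP => /spanN /hn; rewrite subrr uabs0 leNgt cm0 //.
have -> : \sum_c \sum_c0 g (jj c * y + (jj c0 * (T * y) + T * (T * (iota n * y)))) =
   \sum_(u <- span jj (powers iota y 2)) (X + u) ^- 1.
  rewrite E2 !sum_span_cons; apply: eq_bigr => e _; rewrite sum_span_cons.
  by apply: eq_bigr => e' _; rewrite big_seq1 /g /X; congr (_^-1); congr (_ ^+ 1); ring.
rewrite (sum_span_inv i2 Xn) ?card_gt0 // expr1 uabsV.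
have hc : (c * v (iota m)) ^+ (q ^ 2) <=
    \prod_(u <- span jj (powers iota y 2)) v (X + u).
  have <- : size (span jj (powers iota y 2)) = (q ^ 2)%N.
    by rewrite size_span size_mkseq.
  have cm0' : 0 <= c * v (iota m) by rewrite ltW.
  move: (span _ _) hn => r hn; elim: r hn => [|u r IH] hn.
    by rewrite big_nil expr0.
  rewrite big_cons exprS ler_pM ?exprn_ge0 ?hn ?inE ?eqxx //.
  by apply: IH => u' hu'; apply: hn; rewrite inE hu' orbT.
have := prod_span_add X i2; move/(congr1 v); rewrite uabsM uabs_prod => HP.
have eX : 0 < v (espan Fq (powers iota y 2) X).
  by rewrite uabs_gt0 (espan_neq0 i2 Xn).
rewrite /tbound !ler_pdivlMr ?exprn_gt0 // ?(lt_le_trans ltr01) //.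
by rewrite -mulrA ler_pdivrMl // -HP -exprMn mulrC.
Qed.

Lemma tpart_weighted_le c x y k m N : nondeg c x y -> (0 < k <= q)%N -> (2 <= N)%N ->
  v (iota m ^+ (k * q) * tpart k x y N m) * (size m)%:R <= tbound c y ^+ k.
Proof.
move=> h hk hN; have c0 : 0 < c by case: h.
have k0 : (0 < k)%N by case/andP: hk.
have [->|m0] := eqVneq m 0.
  by rewrite size_poly0 mulr0 exprn_ge0 // /tbound divr_ge0 ?uabs_ge0 // exprn_ge0 // ltW.
have m1 := iota_ge1 iota_norm m0; have mp := lt_le_trans ltr01 m1.
rewrite (tpart_pow N h m0 hk) uabsM !uabsX.
set t := v (tpart 1 x y N m); have ht : t <= tbound c y / v (iota m) ^+ (q ^ 2).
  exact: tpart_le.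
have -> : tbound c y ^+ k = v (iota m) ^+ (k * q ^ 2) *
    (tbound c y / v (iota m) ^+ (q ^ 2)) ^+ k.
  rewrite [in RHS]expr_div_n mulrCA -exprM [(q ^ 2 * k)%N]mulnC divff ?mulr1 //.
  by rewrite expf_neq0 // gt_eqF.
rewrite mulrAC; apply: ler_pM; rewrite ?mulr_ge0 ?exprn_ge0 ?uabs_ge0 //.
  apply: le_trans (_ : v (iota m) ^+ (k * q) * v (iota m) <= _).
    by rewrite ler_pM2l ?exprn_gt0 // size_le_iota.
  rewrite -exprSr ler_weXn2l //.
  by have := card_gt1 Fq; rewrite -mulnn; move: q k0 => Q; nia.
by apply: lerXn2r => //; rewrite nnegrE; rewrite ?uabs_ge0 // (le_trans _ ht) ?uabs_ge0.
Qed.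

Lemma tsum_weighted_le c x y k m : nondeg c x y -> (0 < k <= q)%N ->
  v (iota m ^+ (k * q) * tsum k x y m) * (size m)%:R <= tbound c y ^+ k.
Proof.
move=> h hk; have k0 : (0 < k)%N by case/andP: hk.
have [->|m0] := eqVneq m 0.
  have := tpart_weighted_le 0 h hk (leqnn 2).
  by rewrite size_poly0 !mulr0.
have sm : 0 < (size m)%:R :> R by rewrite ltr0n size_poly_gt0.
rewrite -ler_pdivlMr //.
apply: (vlim_le (N := 2) (vlimM (vlim_cst (iota m ^+ (k * q))) (tpart_lim m h k0))).
by move=> N hN; rewrite ler_pdivlMr //; exact: tpart_weighted_le.
Qed.

Lemma tsum_weighted_null c x y k : nondeg c x y -> (0 < k <= q)%N ->
  nullfam (fun m => iota m ^+ (k * q) * tsum k x y m).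
Proof.
move=> h hk; apply: (nullfam_height (finite_height_poly Fq)) => m.
exact: tsum_weighted_le h hk.
Qed.

Definition Fsum k x y : V := usum (fun m => iota m ^+ (k * q) * tsum k x y m).

Lemma FsumP c x y k : nondeg c x y -> (0 < k <= q)%N ->
  sums (fun m => iota m ^+ (k * q) * tsum k x y m) (Fsum k x y).
Proof. by move=> h hk; apply: (usumP complete); exact: tsum_weighted_null h hk. Qed.

Lemma Fsum_lim c x y k : nondeg c x y -> (0 < k <= q)%N ->
  vlim (fun N => \sum_(m <- polys Fq N) iota m ^+ (k * q) * tpart k x y N m)
    (Fsum k x y).
Proof.
move=> h hk; have k0 : (0 < k)%N by case/andP: hk.
have := @vlim_tannery _ _ v _ (fun p : {poly Fq} => size p)
  (fun N m => iota m ^+ (k * q) * tpart k x y N m) _ _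
  (fun N => [fset p in polys Fq N]%fset) 2 _ (finite_height_poly Fq)
  (fun N m hN => tpart_weighted_le m h hk hN)
  (fun m => vlimM (vlim_cst (iota m ^+ (k * q))) (tpart_lim m h k0)) (FsumP h hk).
move=> H; apply: eq_vlim (H _) => [N|N p hp]; first by rewrite big_polyset.
by rewrite in_fset mem_polys.
Qed.

Notation quad := (({poly Fq} * {poly Fq}) * ({poly Fq} * {poly Fq}))%type.

Definition sterm k x y (w : quad) : V :=
  moore2 Fq (x + T * lin x y w.1.1 w.1.2) (y + T * lin x y w.2.1 w.2.2) ^- k.

Lemma size_le_mulX p : (size p <= size ('X * p)%R)%N.
Proof.
have [->|p0] := eqVneq p 0; first by rewrite mulr0.
by rewrite mulrC size_mulX.
Qed.

Lemma size_le_1X p : (size p <= size (1 + 'X * p)%R)%N.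
Proof.
have [->|p0] := eqVneq p 0; first by rewrite size_poly0.
have -> : 1 + 'X * p = 1%:P + 'X * p by [].
by rewrite polyCX size_cons_poly nil_poly (negPf p0) /= leqnSn.
Qed.

Definition quad_height (w : quad) : nat :=
  ((size w.1.1 + size w.1.2) + (size w.2.1 + size w.2.2))%N.

Lemma finite_height_quad : finite_height quad_height.
Proof.
have h := finite_height_poly Fq.
exact: finite_height_pair (finite_height_pair h h) (finite_height_pair h h).
Qed.

Lemma sterm_args x y (w : quad) :
  x + T * lin x y w.1.1 w.1.2 = lin x y (1 + 'X * w.1.1) ('X * w.1.2) /\
  y + T * lin x y w.2.1 w.2.2 = lin x y ('X * w.2.1) (1 + 'X * w.2.2).
Proof.
by rewrite /lin !(rmorphD, rmorphM) !rmorph1; split; ring.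
Qed.

Lemma quad_det_neq0 (w : quad) :
  (1 + 'X * w.1.1) * (1 + 'X * w.2.2) - 'X * w.1.2 * ('X * w.2.1) != 0.
Proof.
apply/eqP => /(congr1 (fun r : {poly Fq} => r.[0])).
rewrite !(hornerE, mul0r, mulr0, addr0, subr0, mulr1) => /eqP.
by rewrite oner_eq0.
Qed.

(** The height is a sum of four sizes, each at most d / c^(q+1) by [moore2_ge]; hence the constant
    4. *)
Lemma sterm_bound c x y k (w : quad) : nondeg c x y -> (0 < k)%N ->
  v (sterm k x y w) * (quad_height w)%:R <= (c ^+ q.+1 / 4) ^- k.
Proof.
move=> h k0; have c0 : 0 < c by case: h.
have [E1 E2] := sterm_args x y w.
have := moore2_ge iota_norm h (quad_det_neq0 w).
rewrite /sterm E1 E2; set d := v _ => /= -[h0 h1 h2 h3 h4].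
have c1 : 0 < c ^+ q.+1 by rewrite exprn_gt0.
rewrite uabsV uabsX; apply: invX_le => //; rewrite -/d.
- by rewrite divr_gt0.
- by apply: le_trans h0; lra.
have hs p (r : {poly Fq}) : (size p <= size r)%N -> c ^+ q.+1 * v (iota r) <= d ->
    c ^+ q.+1 * (size p)%:R <= d.
  move=> pr; apply: le_trans; rewrite ler_pM2l //.
  by apply: le_trans (size_le_iota iota_norm r); rewrite ler_nat.
have g1 := hs _ _ (size_le_1X _) h1; have g2 := hs _ _ (size_le_mulX _) h2.
have g3 := hs _ _ (size_le_mulX _) h3; have g4 := hs _ _ (size_le_1X _) h4.
rewrite /quad_height !natrD.
by move: g1 g2 g3 g4; move: (_ ^+ _) _%:R _%:R _%:R _%:R => A a1 a2 a3 a4; nra.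
Qed.

Lemma sterm_null c x y k : nondeg c x y -> (0 < k)%N -> nullfam (sterm k x y).
Proof.
move=> h k0; apply: (nullfam_height finite_height_quad) => w.
exact: sterm_bound h k0.
Qed.

Definition Ssum k x y : V := usum (sterm k x y).

Lemma SsumP c x y k : nondeg c x y -> (0 < k)%N -> sums (sterm k x y) (Ssum k x y).
Proof. by move=> h hk; apply: (usumP complete); exact: sterm_null h hk. Qed.

Definition Spart k x y M : V :=
  \sum_(u <- polys2 Fq M) \sum_(w <- polys2 Fq M)
    moore2 Fq (x + T * lin x y u.1 u.2) (y + T * lin x y w.1 w.2) ^- k.

Lemma Spart_lim c x y k : nondeg c x y -> (0 < k)%N ->
  vlim (Spart k x y) (Ssum k x y).
Proof.
move=> h k0; pose r M := [seq (u, w) | u <- polys2 Fq M, w <- polys2 Fq M].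
have ur M : uniq (r M) by apply: allpairs_uniq; rewrite ?uniq_polys2 // => -[? ?] [? ?].
have := vlim_sums (J := fun M => [fset w in r M]%fset) (ht := quad_height) (SsumP h k0).
move=> H; apply: eq_vlim (H _) => [M|M [[a b] [a' b']] hw].
  transitivity (\sum_(w <- r M) sterm k x y w).
    by apply/perm_big/uniq_perm; rewrite ?fset_uniq // => w; rewrite in_fset.
  by rewrite big_allpairs.
rewrite in_fset; apply/allpairsP; exists ((a, b), (a', b')); rewrite !mem_polys2 /=.
by move: hw; rewrite /quad_height /= => hw; split => //; lia.
Qed.

Lemma Spart_pow c x y k M : nondeg c x y -> (0 < k <= q)%N ->
  Spart k x y M = Spart 1 x y M ^+ k.
Proof.
move=> h hk; have := indep_towers iota_norm M.+1 h; rewrite towersS /= => /and3P[hx hy hb].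
have E k' : (0 < k' <= q)%N -> Spart k' x y M =
    moore2 Fq (espan Fq [seq T * b | b <- towers iota x y M] x)
      (espan Fq [seq T * b | b <- towers iota x y M] y) ^- k'.
  move=> hk'; rewrite -(sum_moore2_span hb hy hx hk') sum_span_map sum_towers.
  rewrite /Spart big_allpairs_dep; apply: eq_bigr => m _; apply: eq_bigr => n _.
  by rewrite sum_span_map sum_towers big_allpairs_dep.
by rewrite !E ?card_gt0 // expr1 exprVn.
Qed.

Lemma Ssum_pow c x y k : nondeg c x y -> (0 < k <= q)%N ->
  Ssum k x y = Ssum 1 x y ^+ k.
Proof.
move=> h hk; have k0 : (0 < k)%N by case/andP: hk.
apply: vlim_unique (Spart_lim h k0) _.
apply: eq_vlim (vlimX k (Spart_lim h (ltn0Sn 0))) => M.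
by rewrite -(Spart_pow M h hk).
Qed.

(** [CC] is a partial product of q-th powers of 1 - T / T^(q^(i+1)). These factors have absolute
    value 1 and tend to 1, so the limit exists and has absolute value 1. *)
Lemma CC_lim : exists2 l, vlim (CC iota) l & l != 0.
Proof.
pose b i := T / T ^+ (q ^ i.+1).
have tc d : tower_const Fq T d = \prod_(i < d) (1 - b i) ^+ q.
  apply: eq_bigr => i _; rewrite mulrBl divff ?expf_neq0 ?T_neq0 //.
have vb i : v (b i) * i.+2%:R <= 1.
  have Q0 : q%:R != 0 :> R by rewrite pnatr_eq0 -lt0n card_gt0.
  rewrite /b uabs_f uabsX iota_X // mulrAC ler_pdivrMr ?exprn_gt0 ?ltr0n ?card_gt0 //.
  rewrite mul1r -[in leRHS](prednK (_ : 0 < q ^ i.+1)%N) ?expn_gt0 ?card_gt0 //.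
  rewrite exprS ler_pM2l ?ltr0n ?card_gt0 //.
  apply: le_trans (expq_ge_size _ _ _); rewrite ler_nat ltnS.
  by have := ltn_expl i.+1 (card_gt1 Fq); move: (q ^ i.+1)%N => Q; lia.
have vb1 i : v (b i) < 1.
  have := vb i; have : 2 <= i.+2%:R :> R by rewrite (ler_nat R 2).
  have := uabs_ge0 v (b i); nra.
have v1 i : v (1 - b i) = 1.
  by rewrite uabsD_dom ?uabsN ?uabs1.
have vtc d : v (tower_const Fq T d) = 1.
  by rewrite tc uabs_prod big1 // => i _; rewrite uabsX v1 expr1n.
have [|l hl] := vlim_cauchy complete (u := tower_const Fq T).
  move=> e e0; exists (Num.bound e^-1) => d hd.
  rewrite !tc big_ord_recr /= -[X in _ - X]mulr1 -mulrBr uabsM -tc vtc mul1r.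
  rewrite (frobB jj) expr1n addrAC subrr add0r uabsN uabsX.
  apply: le_lt_trans (_ : v (b d) < _).
    rewrite -[leRHS]expr1; apply: ler_wiXn2l => //; rewrite ?uabs_ge0 ?ltW ?card_gt0 //.
  have he : e^-1 < d.+2%:R.
    apply: lt_le_trans (archi_boundP _) _; first by rewrite invr_ge0 ltW.
    by rewrite ler_nat; apply: leq_trans hd _; rewrite -addn2 leq_addr.
  have := vb d; have := uabs_ge0 v (b d); have ee : e * e^-1 = 1 by rewrite divff ?gt_eqF.
  move=> B0 B1; rewrite -(@ltr_pM2r _ d.+2%:R) ?ltr0n //.
  by apply: le_lt_trans B1 _; rewrite -[ltLHS]ee ltr_pM2l.
exists l.
  apply: (vlim_subseq (f := double) _ hl) => n; lia.
apply/negP => /eqP l0; have [N hN] := hl _ ltr01.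
by have := hN N (leqnn N); rewrite l0 subr0 vtc ltxx.
Qed.

(** The limit of [finite_identity]. As K is the same for all x, y and k, the relation can be used at
    (x, y) and at t (x, y) together, where only the factor y^q changes. *)
Lemma Fsum_Ssum : odd q -> exists2 K : V, K != 0 &
  forall c x y k, nondeg c x y -> (0 < k < q)%N ->
    Fsum k x y = - (K * y ^+ q) ^+ k * Ssum k x y.
Proof.
move=> oq; have [l hl l0] := CC_lim; exists (- l); first by rewrite oppr_eq0.
move=> c x y k h /andP[k0 kq]; have hk : (0 < k <= q)%N by rewrite k0 ltnW.
have F1 := vlim_subseq (f := S) leqnSn (Fsum_lim h hk).
apply: vlim_unique F1 _.
have H := vlimM (vlimN (vlimX k (vlimM (vlim_cst (- y ^+ q)) hl))) (Spart_lim h k0).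
rewrite (_ : - l * y ^+ q = - y ^+ q * l); last by ring.
apply: eq_vlim H => M; rewrite -(finite_identity iota_norm M oq h) ?k0 //.
Qed.

End EisensteinSums.

(** * The Hecke operator *)

Section UnitConstantTerm.
Variable F : fieldType.
Implicit Types p r : {poly F}.

(** The quotient (p - p(0)) / X: it recovers the parameter p of a polynomial 1 + X p. *)
Definition ptail p : {poly F} := drop_poly 1 p.

Lemma ptailE p : p = (p`_0)%:P + 'X * ptail p.
Proof.
apply/polyP => -[|i]; rewrite coefD coefC coefXM /= ?addr0 ?add0r //.
by rewrite coef_drop_poly addn1.
Qed.

Lemma ptail1 p : p`_0 = 1 -> 1 + 'X * ptail p = p.
Proof. by move=> p0; rewrite [RHS]ptailE p0. Qed.

Lemma ptail0 p : p`_0 = 0 -> 'X * ptail p = p.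
Proof. by move=> p0; rewrite [RHS]ptailE p0 add0r. Qed.

Lemma coef0_1X p : (1 + 'X * p)`_0 = 1.
Proof. by rewrite coefD coef1 coefXM addr0. Qed.

Lemma coef0_X p : ('X * p)`_0 = 0.
Proof. by rewrite coefXM. Qed.

Lemma coef0M_1 p r : (p * r)`_0 = 1 -> p`_0 = 1 -> r`_0 = 1.
Proof. by rewrite coef0M => + p0; rewrite p0 mul1r. Qed.

Lemma neq0_1X p : 1 + 'X * p != 0.
Proof.
apply/eqP => /(congr1 (fun r : {poly F} => r`_0)).
by rewrite coef0_1X coef0 => /eqP; rewrite oner_eq0.
Qed.

Lemma ptail_1X p : ptail (1 + 'X * p) = p.
Proof.
have := ptail1 (coef0_1X p) => /addrI /mulfI; apply.
by rewrite polyX_eq0.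
Qed.

Lemma eqp_coef0 p r : p %= r -> p`_0 = 1 -> r`_0 = 1 -> p = r.
Proof.
move=> /eqpf_eq[c c0 ->]; rewrite coefZ => h r1; move: h; rewrite r1 mulr1 => ->.
by rewrite scale1r.
Qed.

Lemma coprimep_X1X p : coprimep 'X (1 + 'X * p).
Proof.
apply/Bezout_eq1_coprimepP; exists (- p, 1) => /=; by ring.
Qed.

(** Normalized by the constant term instead of the leading coefficient, to remain among the
    polynomials congruent to 1 modulo X; this makes sense when p is one of them. *)
Definition gcd1 p r : {poly F} := ((gcdp p r)`_0)^-1 *: gcdp p r.

Lemma gcd1_coef0 p r : p`_0 = 1 -> (gcd1 p r)`_0 = 1.
Proof.
move=> p0; rewrite coefZ mulVf //; apply/eqP => g0.
have /dvdpP[u] := dvdp_gcdl p r; move/(congr1 (fun s : {poly F} => s`_0)).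
by rewrite p0 coef0M g0 mulr0 => /eqP; rewrite oner_eq0.
Qed.

Lemma gcd1_eqp p r : p`_0 = 1 -> gcd1 p r %= gcdp p r.
Proof.
move=> p0; apply: eqp_scale; have := gcd1_coef0 r p0; rewrite coefZ.
by case: eqP => // ->; rewrite mul0r => /esym/eqP; rewrite oner_eq0.
Qed.

Lemma gcd1_dvdl p r : p`_0 = 1 -> gcd1 p r %| p.
Proof. by move=> p0; rewrite (eqp_dvdl _ (gcd1_eqp r p0)) dvdp_gcdl. Qed.

Lemma gcd1_dvdr p r : p`_0 = 1 -> gcd1 p r %| r.
Proof. by move=> p0; rewrite (eqp_dvdl _ (gcd1_eqp r p0)) dvdp_gcdr. Qed.

Lemma gcd1_coprime p r : p`_0 = 1 -> coprimep (p %/ gcd1 p r) (r %/ gcd1 p r).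
Proof.
move=> p0; have p1 : p != 0.
  by apply/eqP => E; move/eqP: p0; rewrite E coef0 eq_sym oner_eq0.
have g0 : gcd1 p r != 0.
  by apply/eqP => E; have /eqP := gcd1_coef0 r p0; rewrite E coef0 eq_sym oner_eq0.
have := gcd1_eqp r p0 => Eg.
have E1 := divpK (gcd1_dvdl r p0); have E2 := divpK (gcd1_dvdr r p0).
have : gcdp (p %/ gcd1 p r * gcd1 p r) (r %/ gcd1 p r * gcd1 p r) %= gcd1 p r.
  by rewrite E1 E2 eqp_sym.
by rewrite (eqp_ltrans (gcdp_mul2r _ _ _)) -[X in _ %= X]mul1r eqp_mul2r // -size_poly_eq1.
Qed.

Lemma gcd1_unique p r (s : {poly F}) : s`_0 = 1 -> (s * p)`_0 = 1 -> coprimep p r ->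
  gcd1 (s * p) (s * r) = s.
Proof.
move=> s0 sp0 cp; apply: eqp_coef0 => //; last exact: gcd1_coef0.
apply: (eqp_trans (gcd1_eqp _ sp0)).
apply: (eqp_trans (gcdp_mul2l _ _ _)).
by rewrite -[X in _ %= X]mulr1; apply: eqp_mull; rewrite -size_poly_eq1.
Qed.

End UnitConstantTerm.

(** * Hermite normal form for matrices congruent to 1 modulo X *)

Section Hermite.
Variable F : fieldType.
Implicit Types p r : {poly F}.
Notation quad := (({poly F} * {poly F}) * ({poly F} * {poly F}))%type.
Notation triple := (({poly F} * {poly F}) * {poly F})%type.

Definition qdet (w : quad) : {poly F} :=
  (1 + 'X * w.1.1) * (1 + 'X * w.2.2) - 'X * w.1.2 * ('X * w.2.1).

Lemma qdet_coef0 w : (qdet w)`_0 = 1.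
Proof. by rewrite /qdet coefB coef0M !coef0_1X coef0M coef0_X mul0r subr0 mulr1. Qed.

(* Entries, minus those of the identity and divided by X, of the product of
   1 + X w and the upper triangular matrix (1 + X a, X b; 0, 1 + X d). *)
Definition qmul (w : quad) (t : triple) : quad :=
  let: ((a, d), b) := t in
  ((w.1.1 + a + 'X * (w.1.1 * a), (1 + 'X * w.1.1) * b + w.1.2 * (1 + 'X * d)),
   (w.2.1 * (1 + 'X * a), 'X * w.2.1 * b + w.2.2 + d + 'X * (w.2.2 * d))).

(** The upper right entry is X b, and b runs over the residues modulo the lower right entry 1 + X
    d. *)
Definition reduced (t : triple) : bool := (size t.2 < size (1 + 'X * t.1.2)%R)%N.

Lemma qmulE w a d b :
  [/\ 1 + 'X * (qmul w ((a, d), b)).1.1 = (1 + 'X * w.1.1) * (1 + 'X * a),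
      'X * (qmul w ((a, d), b)).1.2 = (1 + 'X * w.1.1) * ('X * b) + 'X * w.1.2 * (1 + 'X * d),
      'X * (qmul w ((a, d), b)).2.1 = 'X * w.2.1 * (1 + 'X * a) &
      1 + 'X * (qmul w ((a, d), b)).2.2 = 'X * w.2.1 * ('X * b) + (1 + 'X * w.2.2) * (1 + 'X * d)].
Proof. by split; rewrite /=; ring. Qed.

(** As det w = 1, the first column of the product generates the ideal of 1 + X a, and the constant
    term 1 selects this generator. The determinant then gives 1 + X d, and b is fixed by its residue
    modulo 1 + X d. *)
Lemma qmul_inj w t w' t' : qdet w = 1 -> qdet w' = 1 -> reduced t -> reduced t' ->
  qmul w t = qmul w' t' -> w = w' /\ t = t'.
Proof.
case: w => -[p1 q1] [r1 s1]; case: w' => -[p2 q2] [r2 s2].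
case: t => -[a d] b; case: t' => -[a' d'] b' D1 D2 rb rb' E.
rewrite /qdet /reduced /= in D1 D2 rb rb'.
have [E1 E2 E3 E4] := qmulE ((p1, q1), (r1, s1)) a d b.
have [E1' E2' E3' E4'] := qmulE ((p2, q2), (r2, s2)) a' d' b'.
move: E1 E2 E3 E4; rewrite E E1' E2' E3' E4' => {E E1' E2' E3' E4'} /=.
have X0 : 'X != 0 :> {poly F} by rewrite polyX_eq0.
have P1c := coef0_1X p1; have S1c := coef0_1X s1; have P2c := coef0_1X p2.
have Hac := coef0_1X a; have Ha'c := coef0_1X a'; have Hdc := coef0_1X d.
have Hd'c := coef0_1X d'; have cX := coprimep_X1X d.
have a0 := neq0_1X a; have d0 := neq0_1X d.
have ia := @ptail_1X F a; have ia' := @ptail_1X F a'.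
have id1 := @ptail_1X F d; have id2 := @ptail_1X F d'.
have ip1 := @ptail_1X F p1; have ip2 := @ptail_1X F p2.
have is1 := @ptail_1X F s1; have is2 := @ptail_1X F s2.
move: D1 D2 rb rb' P1c S1c P2c Hac Ha'c Hdc Hd'c cX a0 d0 ia ia' id1 id2 ip1 ip2 is1 is2.
move: (1 + 'X * p1) (1 + 'X * p2) (1 + 'X * s1) (1 + 'X * s2) (1 + 'X * a)
  (1 + 'X * a') (1 + 'X * d) (1 + 'X * d') => P1 P2 S1 S2 ha ha' hd hd'.
move=> D1 D2 rb rb' P1c S1c P2c Hac Ha'c Hdc Hd'c cX a0 d0 ia ia' id1 id2 ip1 ip2 is1 is2.
move=> E1 E2 E3 E4.
have Eha : ha = ha'.
  apply: eqp_coef0 => //; rewrite /eqp; apply/andP; split; apply/dvdpP.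
    exists (S2 * P1 - 'X * q2 * ('X * r1)); rewrite -[LHS]mul1r -D2 !mulrBl.
    transitivity (S2 * (P2 * ha') - 'X * q2 * ('X * r2 * ha')); first by ring.
    by rewrite E1 E3; ring.
  exists (S1 * P2 - 'X * q1 * ('X * r2)); rewrite -[LHS]mul1r -D1 !mulrBl.
  transitivity (S1 * (P1 * ha) - 'X * q1 * ('X * r1 * ha)); first by ring.
  by rewrite -E1 -E3; ring.
subst ha'; have EP : P1 = P2 by apply: (mulIf a0).
have Er : r1 = r2 by apply: (mulfI X0); apply: (mulIf a0).
have Ep : p1 = p2 by rewrite -ip1 EP.
subst P2 p2 r2.
have Ed : hd = hd'.
  have H1 : P1 * ('X * r1 * ('X * b) + S1 * hd) - 'X * r1 * (P1 * ('X * b) + 'X * q1 * hd) = hd.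
    by rewrite -[RHS]mul1r -D1; ring.
  have H2 : P1 * ('X * r1 * ('X * b') + S2 * hd') - 'X * r1 * (P1 * ('X * b') + 'X * q2 * hd') = hd'.
    by rewrite -[RHS]mul1r -D2; ring.
  by rewrite -H1 -H2 E2 E4.
subst hd'.
(* [hd] divides X (b - b'), hence b - b', since it is prime to X; but b - b' has smaller size. *)
have Eb : b = b'.
  apply/eqP; rewrite -subr_eq0; apply: contraTT isT => bb.
  have dv : hd %| 'X * (b - b').
    apply/dvdpP; exists (S1 * ('X * q2 - 'X * q1) - 'X * q1 * (S2 - S1)).
    rewrite -[LHS]mul1r -D1.
    transitivity (S1 * (P1 * ('X * b) - P1 * ('X * b')) -
       'X * q1 * ('X * r1 * ('X * b) - 'X * r1 * ('X * b'))); first by ring.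
    have -> : P1 * ('X * b) - P1 * ('X * b') = ('X * q2 - 'X * q1) * hd.
      transitivity (P1 * ('X * b) + 'X * q1 * hd - P1 * ('X * b') - 'X * q1 * hd); first by ring.
      by rewrite -E2; ring.
    have -> : 'X * r1 * ('X * b) - 'X * r1 * ('X * b') = (S2 - S1) * hd.
      transitivity ('X * r1 * ('X * b) + S1 * hd - 'X * r1 * ('X * b') - S1 * hd); first by ring.
      by rewrite -E4; ring.
    by ring.
  rewrite Gauss_dvdpr 1?coprimep_sym // in dv.
  have := dvdp_leq bb dv; rewrite leqNgt.
  rewrite (leq_ltn_trans (size_polyD _ _)) // gtn_max rb size_polyN rb' //.
subst b'.
have Eq : q1 = q2.
  by apply: (mulfI X0); apply: (mulIf d0); apply: (addrI (P1 * ('X * b))).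
have Es : S1 = S2 by apply: (mulIf d0); apply: (addrI ('X * r1 * ('X * b))).
have Ea : a = a' by rewrite -ia ia'.
have Ed : d = d' by rewrite -id1 id2.
have Es' : s1 = s2 by rewrite -is1 Es is2.
by rewrite ip1 Ea Ed Eq Es'.
Qed.

Lemma hermite (w : quad) : exists w' t, [/\ qdet w' = 1, reduced t & qmul w' t = w].
Proof.
have := qdet_coef0 w; rewrite /qdet; case: w => -[e1 e2] [e3 e4] /=.
set E1 := 1 + 'X * e1; set E2 := 'X * e2; set E3 := 'X * e3; set E4 := 1 + 'X * e4 => D0.
have E10 : E1`_0 = 1 by exact: coef0_1X.
have E20 : E2`_0 = 0 by exact: coef0_X.
have E30 : E3`_0 = 0 by exact: coef0_X.
have E40 : E4`_0 = 1 by exact: coef0_1X.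
pose ha := gcd1 E1 E3; have ha1 : ha`_0 = 1 by exact: gcd1_coef0.
have ha0 : ha != 0 by rewrite -(ptail1 ha1) neq0_1X.
pose p := E1 %/ ha; pose r := E3 %/ ha.
have Ep : p * ha = E1 by apply/divpK/gcd1_dvdl.
have Er : r * ha = E3 by apply/divpK/gcd1_dvdr.
have p1 : p`_0 = 1 by apply: (coef0M_1 (p := ha)); rewrite // mulrC Ep.
have r0 : r`_0 = 0 by move: E30; rewrite -Er coef0M ha1 mulr1.
have /Bezout_eq1_coprimepP[[x0 y0] /= xy0] : coprimep p r by exact: gcd1_coprime.
(* Adding a multiple of (r, - p) to the Bezout coefficients makes y vanish at 0, and therefore x(0)
   = 1; the second column of w' then has the right residue modulo X. *)
pose t := (y0`_0)%:P; pose x := x0 + t * r; pose y := y0 - t * p.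
have xy : x * p + y * r = 1 by rewrite -xy0 /x /y; ring.
have y00 : y`_0 = 0 by rewrite coefB (coef0M t p) coefC p1 mulr1 subrr.
have x00 : x`_0 = 1.
  move/(congr1 (fun s : {poly F} => s`_0)): xy.
  by rewrite coefD (coef0M x p) (coef0M y r) p1 r0 mulr0 addr0 mulr1 coef1.
pose beta := x * E2 + y * E4; pose delta := p * E4 - r * E2.
have beta0 : beta`_0 = 0 by rewrite coefD (coef0M x E2) (coef0M y E4) y00 E20 mulr0 mul0r addr0.
have delta1 : delta`_0 = 1 by rewrite coefB (coef0M p E4) (coef0M r E2) p1 E40 r0 mul0r subr0 mulr1.
(* [beta] is the upper right entry before reduction. After removal of its factor X it is divided by
   [delta], and the quotient moves into the second column of w'. *)
pose Q := ptail beta %/ delta; pose b := ptail beta %% delta.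
have bE : beta = 'X * (Q * delta + b) by rewrite -divp_eq ptail0.
have p0E := ptail1 p1; have r0E := ptail0 r0.
pose z := p * ('X * Q) - y; pose s := r * ('X * Q) + x.
have z0 : z`_0 = 0 by rewrite coefB (coef0M p ('X * Q)) coef0_X mulr0 y00 subr0.
have s1 : s`_0 = 1 by rewrite coefD (coef0M r ('X * Q)) coef0_X mulr0 add0r.
have zE := ptail0 z0; have sE := ptail1 s1.
have haE := ptail1 ha1; have dE := ptail1 delta1.
exists ((ptail p, ptail z), (ptail r, ptail s)), ((ptail ha, ptail delta), b).
have X0 : 'X != 0 :> {poly F} by rewrite polyX_eq0.
split.
- by rewrite /qdet /= p0E zE r0E sE -xy /z /s; ring.
- by rewrite /reduced /= dE ltn_modp -dE neq0_1X.
have [F1 F2 F3 F4] := qmulE ((ptail p, ptail z), (ptail r, ptail s)) (ptail ha) (ptail delta) b.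
case: (qmul _ _) F1 F2 F3 F4 => -[f1 f2] [f3 f4] /=; rewrite p0E zE r0E sE haE dE.
move=> F1 F2 F3 F4; congr ((_, _), (_, _)); apply: (mulfI X0).
- by apply: (addrI 1); rewrite F1 Ep.
- rewrite F2; transitivity (p * beta - y * delta); first by rewrite bE /z; ring.
  by rewrite /beta /delta -/E2 -[RHS]mul1r -xy; ring.
- by rewrite F3 Er.
- apply: (addrI 1); rewrite F4 -/E4.
  transitivity (r * beta + x * delta); first by rewrite bE /s; ring.
  by rewrite /beta /delta -[RHS]mul1r -xy; ring.
Qed.

End Hermite.

(** * Sums over residue classes of polynomials *)

Section ResidueSums.
Variables (R : realType) (Fq : finFieldType) (C : fieldType) (v : ultranorm R C).
Local Notation V := (valued v).
Variable j : {rmorphism Fq -> V}.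
Implicit Types (p m n h b u : {poly Fq}).
Hypothesis complete : forall F : set_system V, ProperFilter F -> cauchy F -> cvg F.

Lemma sum_polys_shift (W : nmodType) N u (g : {poly Fq} -> W) : (size u <= N)%N ->
  \sum_(p <- polys Fq N) g (p + u) = \sum_(p <- polys Fq N) g p.
Proof.
move=> hu; rewrite -(big_map (fun p => p + u) xpredT g); apply/perm_big/uniq_perm.
- by rewrite map_inj_uniq ?uniq_polys //; exact: addIr.
- exact: uniq_polys.
move=> p; rewrite mem_polys; apply/mapP/idP => [[p' + ->]|hp].
  by rewrite mem_polys => hp'; rewrite (leq_trans (size_polyD _ _)) // geq_max hp'.
exists (p - u); last by rewrite subrK.
by rewrite mem_polys (leq_trans (size_polyD _ _)) // geq_max hp size_polyN.
Qed.

Lemma affine_inj m b h : h != 0 -> injective (fun n => m * b + n * h).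
Proof. by move=> h0 n n' /addrI /(mulIf h0). Qed.

Lemma residue_sums (G : {poly Fq} -> V) s m h b : h != 0 -> sums G s ->
  sums (fun n => G (m * b + n * h)) (usum (fun n => G (m * b + n * h))).
Proof.
move=> h0 hs; apply: (usumP complete).
exact: nullfam_inj (affine_inj h0) (sums_null hs).
Qed.

(** For m prime to h, the numbers m b with b of size below that of h represent each class modulo h
    once. *)
Lemma residue_sum_coprime (G : {poly Fq} -> V) s m h : h != 0 -> sums G s ->
  coprimep m h ->
  \sum_(b <- polys Fq (size h).-1) usum (fun n => G (m * b + n * h)) = s.
Proof.
move=> h0 hs /Bezout_eq1_coprimepP[[u w] /= uw].
(* u inverts m modulo h, so s' is of the form m b + n h with b reduced exactly for b = p s'. *)
pose p s' := (s' * u) %% h.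
have sN b : (b \in polys Fq (size h).-1) = (size b < size h)%N.
  by rewrite mem_polys -ltnS prednK // size_poly_gt0.
pose G' b := if b \in polys Fq (size h).-1 then usum (fun n => G (m * b + n * h)) else 0.
have hG' : sums G' s.
  apply: (sums_fiber hs (p := p)) => b; rewrite /G' sN; case: ltnP => hb; last first.
    apply: eq_sums (sums0 _ _) => s'; case: eqP => // E.
    by move: hb; rewrite -E leqNgt ltn_modp h0.
  apply: (sums_inj (f := fun n => m * b + n * h)).
  - exact: affine_inj.
  - move=> s' hs'; case: eqP => // E; case: (hs' (m * ((s' * u) %/ h) + s' * w)).
    transitivity (m * ((s' * u) %/ h * h + b) + s' * w * h); first by ring.
    have <- : s' * u = (s' * u) %/ h * h + b by rewrite -E /p -divp_eq.
    transitivity (s' * (u * m + w * h)); first by ring.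
    by rewrite uw mulr1.
  - apply: eq_sums (residue_sums m b h0 hs) => n.
    suff -> : p (m * b + n * h) = b by rewrite eqxx.
    have -> : p (m * b + n * h) = ((n * u - b * w) * h + b) %% h.
      congr (_ %% h); transitivity (n * u * h + b * (u * m + w * h) - b * w * h).
        by ring.
      by rewrite uw; ring.
    by rewrite modp_addl_mul_small.
have := @sums_fset _ _ v _ G' [fset b in polys Fq (size h).-1]%fset.
rewrite big_polyset => H; have {H} := H _ => H.
rewrite (sums_unique hG' (H _)) => [|b]; last by rewrite in_fset /G' => /negPf ->.
by rewrite big_seq [RHS]big_seq; apply: eq_bigr => b hb; rewrite /G' hb.
Qed.

(* The summand only depends on b modulo h / gcd(m, h), so that the sum is a
   multiple of q. *)
Lemma residue_sum_ncoprime (G : {poly Fq} -> V) s m h : h != 0 -> sums G s ->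
  ~~ coprimep m h ->
  \sum_(b <- polys Fq (size h).-1) usum (fun n => G (m * b + n * h)) = 0.
Proof.
move=> h0 hs ncop; pose H b := usum (fun n => G (m * b + n * h)).
pose g := gcdp m h; pose h' := h %/ g; pose m' := m %/ g.
have g0 : g != 0 by rewrite gcdp_eq0 negb_and h0 orbT.
have Eh : h' * g = h by apply/divpK/dvdp_gcdr.
have Em : m' * g = m by apply/divpK/dvdp_gcdl.
have h'0 : h' != 0 by apply: contra h0 => /eqP E; rewrite -Eh E mul0r.
have sg : (1 < size g)%N.
  move: ncop; rewrite /coprimep -/g; move: g0; rewrite -size_poly_gt0.
  by case: (size g) => [|[|]].
have sh' : (size h' <= (size h).-1)%N.
  rewrite -[in leqRHS]Eh size_mul //; move: sg.
  by move: (size h') (size g) => A B; lia.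
have HD c b : H (b + c%:P * h') = H b.
  apply: usumE; have := residue_sums m b h0 hs; rewrite -/(H b).
  have fi : injective (fun n => n + c%:P * m') by exact: addIr.
  move=> /(inj_sums complete fi (F := fun n => G (m * b + n * h))) hh.
  apply: eq_sums (hh _) => [n|k /(_ (k - c%:P * m'))]; last by rewrite subrK.
  by congr G; rewrite -Em -Eh; ring.
(* sigma moves by c under b -> b + c h', which leaves H b unchanged; so the q fibres of sigma
   contribute equal sums. *)
pose sigma b := b`_(size h').-1 / lead_coef h'.
have lh : lead_coef h' != 0 by rewrite lead_coef_eq0.
have sD c b : sigma (b + c%:P * h') = sigma b + c.
  by rewrite /sigma coefD coefCM mulrDl mulfK.
rewrite -/(\sum_(b <- _) H b).
transitivity (\sum_(b <- polys Fq (size h).-1) \sum_c (if sigma b == c then H b else 0)).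
  apply: eq_bigr => b _; rewrite -/(H b) (bigD1 (sigma b)) //= eqxx big1 ?addr0 // => c.
  by rewrite eq_sym => /negPf ->.
rewrite exchange_big /=.
transitivity (\sum_(c : Fq) \sum_(b <- polys Fq (size h).-1) (if sigma b == 0 then H b else 0)).
  apply: eq_bigr => c _; rewrite -(@sum_polys_shift _ _ (c%:P * h')); last first.
    by rewrite (leq_trans _ sh') // mul_polyC size_scale_leq.
  by apply: eq_bigr => b _; rewrite sD HD -subr_eq0 addrK.
by rewrite sumr_const -mulr_natl (card_natr0K j) mul0r.
Qed.

End ResidueSums.

Section HeckeSums.
Variables (R : realType) (Fq : finFieldType) (C : fieldType) (v : ultranorm R C).
Local Notation V := (valued v).
Variable iota : {rmorphism {poly Fq} -> V}.
Local Notation q := #|Fq|.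
Implicit Types (p m n a b d : {poly Fq}) (x y : V).
Local Notation T := (iota 'X).
Local Notation jj := (jj iota).
Local Notation lin := (lin iota).
Local Notation nondeg := (nondeg iota).
Local Notation quad := (({poly Fq} * {poly Fq}) * ({poly Fq} * {poly Fq}))%type.
Local Notation triple := (({poly Fq} * {poly Fq}) * {poly Fq})%type.
Local Notation sterm := (sterm iota).
Local Notation Ssum := (Ssum iota).

Hypothesis complete : forall F : set_system V, ProperFilter F -> cauchy F -> cvg F.
Hypothesis iota_norm : forall p, p != 0 -> v (iota p) = q%:R ^+ (size p).-1.

Definition cbound (c : R) k : R := (c ^+ q.+1 / 2) ^- k.

(** The size of the determinant is at most the sum of the sizes of two entries, each controlled by
    [moore2_ge]; hence the 2 in [cbound]. *)
Lemma moore2_inv_bound c x y k (a b a' b' : {poly Fq}) : nondeg c x y -> (0 < k)%N ->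
  a * b' - b * a' != 0 ->
  v (moore2 Fq (lin x y a b) (lin x y a' b') ^- k) * (size (a * b' - b * a')%R)%:R
    <= cbound c k.
Proof.
move=> h k0 D0; have c0 : 0 < c by case: h.
have := moore2_ge iota_norm h D0; set d := v _ => /= -[h0 h1 h2 h3 h4].
have c1 : 0 < c ^+ q.+1 by rewrite exprn_gt0.
rewrite uabsV uabsX; apply: invX_le => //; rewrite -/d.
- by rewrite divr_gt0.
- by apply: le_trans h0; lra.
have hs p : c ^+ q.+1 * v (iota p) <= d -> c ^+ q.+1 * (size p)%:R <= d.
  by apply: le_trans; rewrite ler_pM2l // size_le_iota.
have sM (p p' : {poly Fq}) : (size (p * p')%R <= size p + size p')%N.
  by apply: leq_trans (size_polyMleq _ _) _; lia.
have [hle|hle] : (size (a * b' - b * a')%R <= size a + size b')%N \/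
            (size (a * b' - b * a')%R <= size b + size a')%N.
  have := size_polyD (a * b') (- (b * a')); rewrite size_polyN leq_max.
  by case/orP => H; [left|right]; apply: leq_trans H (sM _ _).
- have g1 := hs _ h1; have g4 := hs _ h4.
  have hle' : (size (a * b' - b * a')%R)%:R <= (size a)%:R + (size b')%:R :> R.
    by rewrite -natrD ler_nat.
  have : c ^+ q.+1 * (size (a * b' - b * a')%R)%:R <=
         c ^+ q.+1 * ((size a)%:R + (size b')%:R) by rewrite ler_pM2l.
  by rewrite mulrDr; lra.
- have g1 := hs _ h2; have g4 := hs _ h3.
  have hle' : (size (a * b' - b * a')%R)%:R <= (size b)%:R + (size a')%:R :> R.
    by rewrite -natrD ler_nat.
  have : c ^+ q.+1 * (size (a * b' - b * a')%R)%:R <=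
         c ^+ q.+1 * ((size b)%:R + (size a')%:R) by rewrite ler_pM2l.
  by rewrite mulrDr; lra.
Qed.

Definition fterm k x y (w : quad) : V := if qdet w == 1 then sterm k x y w else 0.

Definition fsum k x y : V := usum (fterm k x y).

Lemma fterm_le k x y (w : quad) : v (fterm k x y w) <= v (sterm k x y w).
Proof. by rewrite /fterm; case: ifP => // _; rewrite uabs0 uabs_ge0. Qed.

Lemma fsumP c x y k : nondeg c x y -> (0 < k)%N -> sums (fterm k x y) (fsum k x y).
Proof.
move=> h k0; apply: (usumP complete).
exact: nullfam_le (fterm_le k x y) (sterm_null iota_norm h k0).
Qed.

Definition tx x y (t : triple) : V := lin x y (1 + 'X * t.1.1) ('X * t.2).
Definition ty x y (t : triple) : V := lin x y 0 (1 + 'X * t.1.2).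

Lemma triple_det_neq0 (t : triple) :
  (1 + 'X * t.1.1) * (1 + 'X * t.1.2) - 'X * t.2 * 0 != 0.
Proof. by rewrite mulr0 subr0 mulf_neq0 ?neq0_1X. Qed.

Lemma nondeg_t c x y t : nondeg c x y -> exists c', nondeg c' (tx x y t) (ty x y t).
Proof. by move=> h; apply: (nondeg_lin iota_norm h); exact: triple_det_neq0. Qed.

Lemma sterm_qmul k x y w t : sterm k (tx x y t) (ty x y t) w = sterm k x y (qmul w t).
Proof.
rewrite /sterm; have [-> ->] := sterm_args iota (tx x y t) (ty x y t) w.
have [-> ->] := sterm_args iota x y (qmul w t).
case: t => -[a d] b; have [-> -> -> ->] := qmulE w a d b.
by rewrite /tx /ty !lin_lin /= !mulr0 !addr0.
Qed.

Lemma hecke_fsum c x y k : nondeg c x y -> (0 < k)%N ->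
  sums (fun t => if reduced t then fsum k (tx x y t) (ty x y t) else 0) (Ssum k x y).
Proof.
move=> h k0.
have /choice[g hg] : forall w : quad, exists tw : triple * quad,
    [/\ qdet tw.2 = 1, reduced tw.1 & qmul tw.2 tw.1 = w].
  by move=> w; have [w' [t ?]] := hermite w; exists (t, w').
pose Phi (tw : triple * quad) : V :=
  if reduced tw.1 then fterm k (tx x y tw.1) (ty x y tw.1) tw.2 else 0.
have hPhi : sums Phi (Ssum k x y).
  apply: (sums_inj (f := g)).
  - move=> w w' E; have [_ _ <-] := hg w; have [_ _ <-] := hg w'.
    by rewrite E.
  - move=> [t w] hgw; rewrite /Phi /fterm /=; case: ifP => // rt; case: eqP => // dw.
    case: (hgw (qmul w t)); have [d' r' E] := hg (qmul w t).
    have [Ew Et] := qmul_inj d' dw r' rt E.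
    by rewrite [g _]surjective_pairing Ew Et.
  - apply: eq_sums (SsumP complete iota_norm h k0) => w.
    have [d' r' E] := hg w; rewrite /Phi r' /fterm d' eqxx sterm_qmul.
    by rewrite E.
apply: sums_pair hPhi _ => t; rewrite /Phi /=; case: ifP => // _; last exact: sums0.
by have [c' h'] := nondeg_t t h; exact: fsumP h' k0.
Qed.

(** The exponent k q is that of y in [Fsum_Ssum], and 1 + X n is the product of the diagonal entries
    of a triangular matrix once a common factor has been collected. *)
Definition zterm k n : V := iota (1 + 'X * n) ^- (k * q).

Definition zeta k : V := usum (zterm k).

Lemma zterm_bound k n : (0 < k)%N -> v (zterm k n) * (size n)%:R <= 1.
Proof.
move=> k0; rewrite /zterm uabsV uabsX.
have h1 := iota_ge1 iota_norm (neq0_1X n).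
have := @invX_le R (v (iota (1 + 'X * n))) 1 (size n)%:R (k * q) ltr01 h1.
rewrite expr1n invr1 mul1r; apply; last by rewrite muln_gt0 k0 card_gt0.
by apply: le_trans (size_le_iota iota_norm _); rewrite ler_nat size_le_1X.
Qed.

Lemma zetaP k : (0 < k)%N -> sums (zterm k) (zeta k).
Proof.
move=> k0; apply: (usumP complete).
by apply: (nullfam_height (finite_height_poly Fq)) => n; exact: zterm_bound.
Qed.

(** The term n = 0 is 1 and dominates all the others. This allows division by zeta without loss in
    the bounds. *)
Lemma zeta_norm k : (0 < k)%N -> v (zeta k) = 1.
Proof.
move=> k0; have := @sums_tail _ _ v _ (zterm k) (zeta k) [fset 0]%fset 1 ltr01 (zetaP k0).
rewrite big_seq_fset1 {2}/zterm mulr0 addr0 rmorph1 expr1n invr1 => H.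
rewrite -(uabs1 v) -[in LHS](subrK 1 (zeta k)) addrC uabsD_dom // uabs1 uabsBC.
apply: H => n; rewrite inE => n0.
rewrite /zterm uabsV uabsX invf_lt1 ?exprn_gt0 //; last first.
  by rewrite (lt_le_trans ltr01) // iota_ge1 // neq0_1X.
rewrite exprn_egt1; first by apply: lt0n_neq0; rewrite muln_gt0 k0 card_gt0.
rewrite iota_norm ?neq0_1X // exprn_egt1 ?q_gt1 //.
have -> : 1 + 'X * n = 1%:P + 'X * n by [].
by rewrite polyCX size_cons_poly nil_poly (negPf n0) /= size_poly_eq0.
Qed.

Lemma zeta_neq0 k : (0 < k)%N -> zeta k != 0.
Proof. by move=> k0; rewrite -(uabs_eq0 v) zeta_norm // oner_eq0. Qed.

(** 1 + T n runs over an affine F_q-space and the exponent q is a Frobenius, so that [sum_span_inv]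
    applies. *)
Lemma zeta_pow k : (0 < k <= q)%N -> zeta k = zeta 1 ^+ k.
Proof.
move=> hk; have k0 : (0 < k)%N by case/andP: hk.
have lim i : (0 < i)%N ->
    vlim (fun N => \sum_(n <- polys Fq N) zterm i n) (zeta i).
  move=> i0; have := vlim_sums (J := fun N => [fset p in polys Fq N]%fset)
    (ht := fun p : {poly Fq} => size p) (zetaP i0).
  move=> H; apply: eq_vlim (H _) => [N|N p hp]; first by rewrite big_polyset.
  by rewrite in_fset mem_polys.
have E i N : (0 < i <= q)%N ->
    \sum_(n <- polys Fq N) zterm i n = espan Fq (powers iota T N) 1 ^- (i * q).
  move=> hi; rewrite exprM -exprVn -(@sum_span_inv _ _ jj) //; last first.
  - apply/negP => /mem_powers[n _]; rewrite -rmorphM -(rmorph1 iota) => /eqP.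
    rewrite -subr_eq0 -rmorphB iota_eq0 // => /eqP /(congr1 (fun r : {poly Fq} => r`_0)).
    by rewrite coefB coef1 coefMX coef0 subr0 => /eqP; rewrite oner_eq0.
  - by apply: indep_powers => //; exact: T_neq0.
  rewrite sum_powers (frob_sum jj); apply: eq_bigr => n _.
  by rewrite /zterm exprVn -exprM rmorphD rmorphM rmorph1 mulrC.
apply: vlim_unique (lim k k0) _.
apply: eq_vlim (vlimX k (lim 1%N isT)) => N.
by rewrite !E ?card_gt0 // -exprVn -exprM mul1n exprVn mulnC.
Qed.

End HeckeSums.

Lemma height_aux1 A D X Y M : (A <= X)%N -> (D <= Y)%N ->
  (0 < X)%N -> (0 < Y)%N -> (0 < M)%N -> (A + D + M <= 4 * (Y * (M + X).-1))%N.
Proof.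
move=> AX DY X0 Y0 M0; have Z0 : (0 < (M + X).-1)%N by lia.
have h1 := leq_pmulr Y Z0; have h2 := leq_pmull (M + X).-1 Y0.
by move: h1 h2; move: (Y * _)%N => W; lia.
Qed.

Lemma height_aux2 A D B X Y : (A <= X)%N -> (D <= Y)%N -> (B < Y)%N -> (0 < X)%N ->
  (A + D + B <= 4 * (X + Y).-1)%N.
Proof. by lia. Qed.

(** * The eigenvalue equation and the comparison of f_k with S_k *)

Section HeckeEigenform.
Variables (R : realType) (Fq : finFieldType) (C : fieldType) (v : ultranorm R C).
Local Notation V := (valued v).
Variable iota : {rmorphism {poly Fq} -> V}.
Local Notation q := #|Fq|.
Implicit Types (p m n a b d : {poly Fq}) (x y : V).
Local Notation jj := (jj iota).
Local Notation lin := (lin iota).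
Local Notation nondeg := (nondeg iota).
Local Notation quad := (({poly Fq} * {poly Fq}) * ({poly Fq} * {poly Fq}))%type.
Local Notation triple := (({poly Fq} * {poly Fq}) * {poly Fq})%type.
Local Notation sterm := (sterm iota).
Local Notation tterm := (tterm iota).
Local Notation tsum := (tsum iota).
Local Notation Fsum := (Fsum iota).
Local Notation Ssum := (Ssum iota).
Local Notation fsum := (fsum iota).
Local Notation tx := (tx iota).
Local Notation ty := (ty iota).
Local Notation zeta := (zeta iota).
Local Notation zterm := (zterm iota).

Hypothesis complete : forall F : set_system V, ProperFilter F -> cauchy F -> cvg F.
Hypothesis iota_norm : forall p, p != 0 -> v (iota p) = q%:R ^+ (size p).-1.

(** What remains, after summation over b, of the terms of F_k at t (x, y) weighted by (1 + T d)^(-k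
    q): the inner sum over n vanishes unless m is prime to 1 + T d. *)
Definition hecke_term k x y (t : ({poly Fq} * {poly Fq}) * {poly Fq}) : V :=
  let: ((a, d), m) := t in
  iota (1 + 'X * d) ^- (k * q) *
    (iota m ^+ (k * q) *
      (if coprimep m (1 + 'X * d) then tsum k x y (m * (1 + 'X * a)) else 0)).

Lemma hecke_term_null c x y k : nondeg c x y -> (0 < k <= q)%N ->
  nullfam (hecke_term k x y).
Proof.
move=> h hk; have k0 : (0 < k)%N by case/andP: hk.
have hf := finite_height_pair (finite_height_pair (finite_height_poly Fq)
  (finite_height_poly Fq)) (finite_height_poly Fq).
apply: (@nullfam_height _ _ v _ _ _ (4 * tbound iota c y ^+ k) hf) => -[[a d] m] /=.
have B0 : 0 <= tbound iota c y ^+ k.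
  rewrite exprn_ge0 // /tbound divr_ge0 ?uabs_ge0 // exprn_ge0 //.
  by case: h => /ltW.
case: ifP => [_|_]; last by rewrite !mulr0 uabs0 mul0r mulr_ge0.
have [->|m0] := eqVneq m 0.
  rewrite rmorph0 expr0n (_ : (k * q == 0)%N = false).
    by rewrite mul0r mulr0 uabs0 mul0r mulr_ge0.
  by apply/negbTE/lt0n_neq0; rewrite muln_gt0 k0 card_gt0.
set hd := 1 + 'X * d; set ha := 1 + 'X * a.
have ha0 : ha != 0 by exact: neq0_1X.
have hd0 : hd != 0 by exact: neq0_1X.
have hd1 := iota_ge1 iota_norm hd0; have ha1 := iota_ge1 iota_norm ha0.
have m1 := iota_ge1 iota_norm m0.
have sa : (size a <= size ha)%N by exact: size_le_1X.
have sd : (size d <= size hd)%N by exact: size_le_1X.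
have H := tsum_weighted_le complete iota_norm (m * ha) h hk.
have zb : v (iota hd ^- (k * q)) * (size hd)%:R <= 1.
  rewrite uabsV uabsX.
  have := @invX_le R (v (iota hd)) 1 (size hd)%:R (k * q) ltr01 hd1.
  rewrite expr1n invr1 mul1r; apply; last by rewrite muln_gt0 k0 card_gt0.
  exact: size_le_iota.
have H2 : v (iota m ^+ (k * q) * tsum k x y (m * ha)) * (size (m * ha)%R)%:R <=
    tbound iota c y ^+ k.
  apply: le_trans H; rewrite ler_wpM2r //.
  rewrite !uabsM ler_wpM2r ?uabs_ge0 // rmorphM exprMn uabsM ler_peMr ?uabs_ge0 //.
  by rewrite uabsX exprn_ege1.
rewrite uabsM.
set z := v (iota hd ^- _) in zb *; set w := v (_ * tsum _ _ _ _) in H2 *.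
have z0 : 0 <= z by exact: uabs_ge0.
have w0 : 0 <= w by exact: uabs_ge0.
apply: le_trans (_ : z * w * (4 * ((size hd)%:R * (size (m * ha)%R)%:R)) <= _).
  rewrite ler_wpM2l ?mulr_ge0 // -!natrM ler_nat size_mul //.
  by apply: height_aux1; rewrite ?size_poly_gt0.
have -> : z * w * (4 * ((size hd)%:R * (size (m * ha)%R)%:R)) =
   4 * ((z * (size hd)%:R) * (w * (size (m * ha)%R)%:R)) by ring.
rewrite ler_pM2l // -[leRHS]mul1r; apply: ler_pM => //; exact: mulr_ge0.
Qed.

(* ((a, d), m) |-> (ad, am) is a bijection from the triples with m prime to d
   to pairs; its inverse divides by the gcd. *)
Lemma hecke_term_sums c x y k : nondeg c x y -> (0 < k <= q)%N ->
  sums (hecke_term k x y) (zeta k * Fsum k x y).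
Proof.
move=> h hk; have k0 : (0 < k)%N by case/andP: hk.
pose f (Nm : {poly Fq} * {poly Fq}) :=
  let hN := 1 + 'X * Nm.1 in let g := gcd1 hN Nm.2 in
  ((ptail g, ptail (hN %/ g)), Nm.2 %/ g).
have fP N m : let g := gcd1 (1 + 'X * N) m in
   [/\ 1 + 'X * ptail g = g, 1 + 'X * ptail ((1 + 'X * N) %/ g) = (1 + 'X * N) %/ g,
       (1 + 'X * N) %/ g * g = 1 + 'X * N & m %/ g * g = m].
  move=> g; have N1 := coef0_1X N; have g1 : g`_0 = 1 by exact: gcd1_coef0.
  have gN : (1 + 'X * N) %/ g * g = 1 + 'X * N by apply/divpK/gcd1_dvdl.
  split=> //; first exact: ptail1.
    by apply: ptail1; apply: (coef0M_1 (p := g)) => //; rewrite mulrC gN.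
  exact/divpK/gcd1_dvdr.
have fi : injective f.
  move=> [N m] [N' m']; rewrite /f /= => -[E1 E2 E3].
  have [a1 a2 a3 a4] := fP N m; have [b1 b2 b3 b4] := fP N' m'.
  have Eg : gcd1 (1 + 'X * N) m = gcd1 (1 + 'X * N') m'.
    by rewrite -a1 -b1 E1.
  rewrite -a4 -b4 E3 Eg; congr (_, _).
  by rewrite -(ptail_1X N) -(ptail_1X N') -a3 -b3 -a2 -b2 E2 Eg.
have Wf Nm : hecke_term k x y (f Nm) =
    zterm k Nm.1 * (iota Nm.2 ^+ (k * q) * tsum k x y Nm.2).
  case: Nm => N m; rewrite /f /hecke_term /=; have [a1 a2 a3 a4] := fP N m.
  rewrite a1 a2 a4 coprimep_sym gcd1_coprime ?coef0_1X //.
  rewrite /zterm -[in RHS]a3 -[X in _ = _ * (iota X ^+ _ * _)]a4 !rmorphM !exprMn.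
  have g0 : iota (gcd1 (1 + 'X * N) m) ^+ (k * q) != 0.
    by rewrite expf_neq0 // iota_eq0 // -a1 neq0_1X.
  have d0 : iota ((1 + 'X * N) %/ gcd1 (1 + 'X * N) m) ^+ (k * q) != 0.
    by rewrite expf_neq0 // iota_eq0 // -a2 neq0_1X.
  by field; rewrite g0 d0.
have W0 := hecke_term_null h hk.
have hZ : sums (fun Nm => zterm k Nm.1 * (iota Nm.2 ^+ (k * q) * tsum k x y Nm.2))
    (zeta k * Fsum k x y).
  apply: (pair_sums complete (G := fun N => zterm k N * Fsum k x y)).
  - apply: nullfam_le (nullfam_inj fi W0) => Nm.
    by rewrite Wf.
  - by move=> N; exact: (sumsZ (zterm k N) (FsumP complete iota_norm h hk)).
  - rewrite mulrC; apply: eq_sums (sumsZ (Fsum k x y) (zetaP complete iota_norm k0)) => N.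
    by rewrite mulrC.
apply: (sums_inj fi).
  move=> [[a d] m] hf; rewrite /hecke_term; case: ifP => cop; last by rewrite !mulr0.
  case: (hf (ptail ((1 + 'X * a) * (1 + 'X * d)), (1 + 'X * a) * m)).
  rewrite /f /=; have c1 : ((1 + 'X * a) * (1 + 'X * d))`_0 = 1.
    by rewrite coef0M !coef0_1X mulr1.
  rewrite ptail1 // gcd1_unique ?coef0_1X //; last by rewrite coprimep_sym.
  by rewrite !mulKp ?neq0_1X // !ptail_1X.
by apply: eq_sums hZ => Nm; rewrite Wf.
Qed.

Lemma reducedE a d b : reduced ((a, d), b) = (b \in polys Fq (size (1 + 'X * d)%R).-1).
Proof. by rewrite /reduced mem_polys /= -[in RHS]ltnS prednK // size_poly_gt0 neq0_1X. Qed.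

Lemma tsum_t k x y a d b m : tsum k (tx x y ((a, d), b)) (ty x y ((a, d), b)) m =
  usum (fun n => tterm k x y (m * (1 + 'X * a)) (m * 'X * b + n * (1 + 'X * d))).
Proof.
congr usum; apply/funext => n; rewrite /tterm /tx /ty lin_lin /=.
by congr ((lin _ _ _ _ ^+ k)^-1); ring.
Qed.

Lemma hecke_inner c x y k a d : nondeg c x y -> (0 < k <= q)%N ->
  sums (fun m => hecke_term k x y ((a, d), m))
    (\sum_(b <- polys Fq (size (1 + 'X * d)%R).-1)
       iota (1 + 'X * d) ^- (k * q) * Fsum k (tx x y ((a, d), b)) (ty x y ((a, d), b))).
Proof.
move=> h hk; have k0 : (0 < k)%N by case/andP: hk.
have := @sums_sum _ _ v _ _ (polys Fq (size (1 + 'X * d)%R).-1)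
  (fun b m => iota (1 + 'X * d) ^- (k * q) *
     (iota m ^+ (k * q) * tsum k (tx x y ((a, d), b)) (ty x y ((a, d), b)) m))
  (fun b => iota (1 + 'X * d) ^- (k * q) * Fsum k (tx x y ((a, d), b)) (ty x y ((a, d), b))).
move=> H; apply: eq_sums (H _) => [m|b]; last first.
  by have [c' h'] := nondeg_t iota_norm ((a, d), b) h; apply: sumsZ; exact: FsumP h' hk.
rewrite -!mulr_sumr /hecke_term; congr (_ * (_ * _)).
under eq_bigr do rewrite tsum_t.
have hs := tsumP complete iota_norm (m * (1 + 'X * a)) h k0.
(* The residues enter as m X b; the additional X is prime to 1 + X d. *)
have -> : coprimep m (1 + 'X * d) = coprimep (m * 'X) (1 + 'X * d).
  by rewrite coprimepMl coprimep_X1X andbT.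
have h0 := neq0_1X d; case: ifP => cop.
  exact: (residue_sum_coprime complete h0 hs cop).
exact: (residue_sum_ncoprime jj complete h0 hs (negbT cop)).
Qed.

Lemma sterm_lin k x y a b (a' b' : {poly Fq}) (w : quad) : exists A B A' B',
  sterm k (lin x y a b) (lin x y a' b') w =
    moore2 Fq (lin x y A B) (lin x y A' B') ^- k /\
  A * B' - B * A' = qdet w * (a * b' - b * a').
Proof.
rewrite /sterm; have [-> ->] := sterm_args iota (lin x y a b) (lin x y a' b') w.
rewrite !lin_lin; do 4!eexists; split; first by reflexivity.
by rewrite /qdet; ring.
Qed.

Lemma qdet_neq0 (w : quad) : qdet w != 0.
Proof.
apply/eqP => E; have := qdet_coef0 w.
by rewrite E coef0 => /eqP; rewrite eq_sym oner_eq0.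
Qed.

Lemma sterm_det_bound c x y k a b (a' b' : {poly Fq}) (w : quad) :
  nondeg c x y -> (0 < k)%N -> a * b' - b * a' != 0 ->
  v (sterm k (lin x y a b) (lin x y a' b') w) * (size (a * b' - b * a')%R)%:R <=
    @cbound R Fq c k.
Proof.
move=> h k0 D0; have [A [B [A' [B' [-> ED]]]]] := sterm_lin k x y a b a' b' w.
have D1 : A * B' - B * A' != 0 by rewrite ED mulf_neq0 ?qdet_neq0.
apply: le_trans (moore2_inv_bound iota_norm h k0 D1).
rewrite ler_wpM2l ?uabs_ge0 // ler_nat ED dvdp_leq ?mulf_neq0 ?qdet_neq0 //.
exact: dvdp_mull.
Qed.

(** The bound depends on the matrix through its determinant only, while the constant c of [nondeg]
    remains that of (x, y); the descent in [fsum_Ssum] rests on this uniformity. *)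
Lemma sums_det_bound c x y k a b (a' b' : {poly Fq}) (F : quad -> V) s :
  nondeg c x y -> (0 < k)%N -> a * b' - b * a' != 0 ->
  (forall w, v (F w) <= v (sterm k (lin x y a b) (lin x y a' b') w)) -> sums F s ->
  v s * (size (a * b' - b * a')%R)%:R <= @cbound R Fq c k.
Proof.
move=> h k0 D0 hF hs; have sD : 0 < (size (a * b' - b * a')%R)%:R :> R.
  by rewrite ltr0n size_poly_gt0.
have cb w := sterm_det_bound w h k0 D0.
rewrite -ler_pdivlMr //; apply: sums_le hs _ => [|w].
  by rewrite divr_ge0 // (le_trans _ (cb ((0, 0), (0, 0)))) // mulr_ge0 ?uabs_ge0.
by apply: le_trans (hF w) _; rewrite ler_pdivlMr.
Qed.

Lemma Ssum_det_bound c x y k a b (a' b' : {poly Fq}) :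
  nondeg c x y -> (0 < k)%N -> a * b' - b * a' != 0 ->
  v (Ssum k (lin x y a b) (lin x y a' b')) * (size (a * b' - b * a')%R)%:R <=
    @cbound R Fq c k.
Proof.
move=> h k0 D0; have [c' h'] := nondeg_lin iota_norm h D0.
by apply: (sums_det_bound h k0 D0 _ (SsumP complete iota_norm h' k0)).
Qed.

Lemma fsum_det_bound c x y k a b (a' b' : {poly Fq}) :
  nondeg c x y -> (0 < k)%N -> a * b' - b * a' != 0 ->
  v (fsum k (lin x y a b) (lin x y a' b')) * (size (a * b' - b * a')%R)%:R <=
    @cbound R Fq c k.
Proof.
move=> h k0 D0; have [c' h'] := nondeg_lin iota_norm h D0.
apply: (sums_det_bound h k0 D0 _ (fsumP complete iota_norm h' k0)).
exact: fterm_le.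
Qed.

(** For reduced t the size of b is below that of 1 + T d, so the height of t is controlled by its
    determinant. *)
Lemma hecke_Ssum_null c x y k : nondeg c x y -> (0 < k)%N ->
  nullfam (fun t : triple => if reduced t then Ssum k (tx x y t) (ty x y t) else 0).
Proof.
move=> h k0.
have hf := finite_height_pair (finite_height_pair (finite_height_poly Fq)
  (finite_height_poly Fq)) (finite_height_poly Fq).
have hb t := Ssum_det_bound h k0 (triple_det_neq0 t).
have cb : 0 <= @cbound R Fq c k.
  by apply: le_trans (hb ((0, 0), 0)); rewrite mulr_ge0 ?uabs_ge0.
apply: (@nullfam_height _ _ v _ _ _ (4 * @cbound R Fq c k) hf) => -[[a d] b] /=.
case: ifP => [|_]; last by rewrite uabs0 mul0r mulr_ge0.
rewrite /reduced /= => rb; have := hb ((a, d), b); rewrite /= mulr0 subr0 => H.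
rewrite /tx /ty /=; set s := v _ in H *.
apply: le_trans (_ : s * (4 * (size ((1 + 'X * a) * (1 + 'X * d))%R)%:R) <= _); last first.
  by rewrite mulrCA ler_pM2l.
rewrite ler_wpM2l ?uabs_ge0 // -natrM ler_nat size_mul ?neq0_1X //.
by apply: height_aux2; rewrite ?size_le_1X ?size_poly_gt0 ?neq0_1X.
Qed.

(** F_k at t (x, y), weighted by (1 + T d)^(-k q), is A times S_k there: the weight cancels the
    change of y^(k q). The weighted sum is zeta F_k, by comparison of the two ways to sum
    [hecke_term]. *)
Lemma hecke_Ssum c x y k : odd q -> nondeg c x y -> (0 < k < q)%N ->
  sums (fun t : triple => if reduced t then Ssum k (tx x y t) (ty x y t) else 0)
    (zeta k * Ssum k x y).
Proof.
move=> oq h hkq; have hk : (0 < k <= q)%N by case/andP: hkq => -> /ltnW.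
have k0 : (0 < k)%N by case/andP: hk.
have [K K0 FS] := Fsum_Ssum complete iota_norm oq.
have y0 := nondeg_neq0 iota_norm h.
pose A := - (K * y ^+ q) ^+ k.
have A0 : A != 0 by rewrite oppr_eq0 expf_neq0 // mulf_neq0 // expf_neq0.
have E t : iota (1 + 'X * t.1.2) ^- (k * q) * Fsum k (tx x y t) (ty x y t) =
    A * Ssum k (tx x y t) (ty x y t).
  have [c' h'] := nondeg_t iota_norm t h; rewrite (FS _ _ _ _ h' hkq) mulrA.
  congr (_ * _); rewrite /A /ty /lin rmorph0 mul0r add0r.
  have d0 : iota (1 + 'X * t.1.2) ^+ (k * q) != 0.
    by rewrite expf_neq0 // iota_eq0 // neq0_1X.
  rewrite [(_ * y) ^+ q]exprMn mulrCA exprMn -exprM [(q * k)%N]mulnC.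
  by rewrite mulrN mulKf.
suff : sums (fun t : triple => A * (if reduced t then Ssum k (tx x y t) (ty x y t) else 0))
    (A * (zeta k * Ssum k x y)).
  move=> /(sumsZ A^-1); rewrite mulKf //; apply: eq_sums => t.
  by rewrite mulKf.
have -> : A * (zeta k * Ssum k x y) = zeta k * Fsum k x y.
  by rewrite (FS _ _ _ _ h hkq) -/A mulrCA.
apply: (pair_sums complete (G := fun ad => \sum_(b <- polys Fq (size (1 + 'X * ad.2)%R).-1)
       iota (1 + 'X * ad.2) ^- (k * q) * Fsum k (tx x y (ad, b)) (ty x y (ad, b)))).
- have := hecke_Ssum_null h k0 => H e e0.
  have [|J hJ] := H (e / v A); first by rewrite divr_gt0 // uabs_gt0.
  exists J => t /hJ; rewrite uabsM [v A * _]mulrC ltr_pdivlMr // uabs_gt0 //.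
- move=> [a d] /=.
  have := @sums_fset _ _ v _ (fun b => A * (if reduced ((a, d), b) then
     Ssum k (tx x y ((a, d), b)) (ty x y ((a, d), b)) else 0))
     [fset b in polys Fq (size (1 + 'X * d)%R).-1]%fset.
  rewrite big_polyset => H.
  have -> : \sum_(b <- polys Fq (size (1 + 'X * d)%R).-1) iota (1 + 'X * d) ^- (k * q) *
      Fsum k (tx x y (a, d, b)) (ty x y (a, d, b)) =
    \sum_(b <- polys Fq (size (1 + 'X * d)%R).-1) A * (if reduced ((a, d), b) then
     Ssum k (tx x y ((a, d), b)) (ty x y ((a, d), b)) else 0).
    rewrite big_seq [RHS]big_seq; apply: eq_bigr => b hb.
    by rewrite (E ((a, d), b)) reducedE hb.
  by apply: H => b; rewrite in_fset -(reducedE a) => /negPf ->; rewrite mulr0.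
- have W := hecke_term_sums h hk.
  by apply: sums_pair W _ => -[a d]; exact: hecke_inner h hk.
Qed.

(* The difference u of the two sides of fsum_Ssum satisfies sum_t u(t) = 0, where
   the determinant of the term t = 0 is strictly smaller than the others; as u
   decays with the determinant, it vanishes. *)
Lemma fsum_Ssum c x y k : odd q -> nondeg c x y -> (0 < k < q)%N ->
  fsum k x y = (zeta k)^-1 * Ssum k x y.
Proof.
move=> oq h hk; have k0 : (0 < k)%N by case/andP: hk.
pose u X Y := fsum k X Y - (zeta k)^-1 * Ssum k X Y.
have z0 := zeta_neq0 complete iota_norm k0.
have vz : v (zeta k)^-1 = 1 by rewrite uabsV zeta_norm // invr1.
have Lu c' X Y : nondeg c' X Y ->
    sums (fun t : triple => if reduced t then u (tx X Y t) (ty X Y t) else 0) 0.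
  move=> h'; have := sumsB (hecke_fsum complete iota_norm h' k0)
    (sumsZ (zeta k)^-1 (hecke_Ssum oq h' hk)).
  rewrite mulKf // subrr; apply: eq_sums => t.
  by case: ifP => // _; rewrite mulr0 subr0.
(* Each round gains 1 in the bound: u is minus the sum of its values at the other reduced t, whose
   determinants have size at least one more, and the previous bound applies to these. *)
have bound j : forall a b (a' b' : {poly Fq}), a * b' - b * a' != 0 ->
    v (u (lin x y a b) (lin x y a' b')) * (size (a * b' - b * a')%R + j)%:R <=
    @cbound R Fq c k.
  elim: j => [|j IH] a b a' b' D0.
    have sD : 0 < (size (a * b' - b * a')%R)%:R :> R by rewrite ltr0n size_poly_gt0.
    rewrite addn0 -ler_pdivlMr //; apply: uabsB_le.
      by rewrite ler_pdivlMr //; exact: fsum_det_bound.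
    by rewrite uabsM vz mul1r ler_pdivlMr //; exact: Ssum_det_bound.
  have sD : 0 < (size (a * b' - b * a')%R + j.+1)%:R :> R.
    by rewrite ltr0n addnS.
  have cb : 0 <= @cbound R Fq c k.
    apply: le_trans (IH a b a' b' D0); rewrite mulr_ge0 ?uabs_ge0 //.
  have [c' h'] := nondeg_lin iota_norm h D0.
  pose t0 : triple := ((0, 0), 0).
  pose U (t : triple) := if reduced t then u (tx (lin x y a b) (lin x y a' b') t)
     (ty (lin x y a b) (lin x y a' b') t) else 0.
  have U0 : U t0 = u (lin x y a b) (lin x y a' b').
    rewrite /U /reduced /= mulr0 addr0 size_poly0 size_poly1 /=.
    by rewrite /tx /ty /= !mulr0 !addr0 !lin_lin !(mul0r, mul1r, add0r, addr0).
  have := sumsB (Lu _ _ _ h') (@sums_one _ _ v _ (fun t => if t == t0 then U t0 else 0) t0 _).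
  rewrite eqxx sub0r => /(_ (fun t ht => ifN _ _ ht)) H.
  rewrite -ler_pdivlMr // -U0 -(uabsN (U t0)); apply: sums_le H _.
    by rewrite divr_ge0 // ltW.
  move=> t; rewrite -/(U t); case: eqP => [->|/eqP tt0].
    by rewrite subrr uabs0 divr_ge0 // ltW.
  rewrite subr0 /U; case: ifP => [rt|_]; last by rewrite uabs0 divr_ge0 // ltW.
  rewrite /tx /ty !lin_lin; set A1 := _ + _; set A2 := _ + _; set A3 := _ + _; set A4 := _ + _.
  have ED : A1 * A4 - A2 * A3 = (1 + 'X * t.1.1) * (1 + 'X * t.1.2) * (a * b' - b * a').
    by rewrite /A1 /A2 /A3 /A4; ring.
  have D1 : A1 * A4 - A2 * A3 != 0 by rewrite ED !mulf_neq0 ?neq0_1X.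
  rewrite ler_pdivlMr //; apply: le_trans (IH _ _ _ _ D1).
  rewrite ler_wpM2l ?uabs_ge0 // ler_nat addnS -addSn leq_add2r ED.
  rewrite size_mul ?mulf_neq0 ?neq0_1X // size_mul ?neq0_1X //.
  have s1 (p : {poly Fq}) : size (1 + 'X * p)%R = if p == 0 then 1%N else (size p).+1.
    case: eqP => [->|/eqP p0]; first by rewrite mulr0 addr0 size_poly1.
    have -> : 1 + 'X * p = 1%:P + 'X * p by [].
    by rewrite polyCX size_cons_poly nil_poly (negPf p0).
  move: D0; rewrite -size_poly_gt0; move: (size (a * b' - b * a')%R) => S S0.
  move: tt0 rt; case: t {A1 A2 A3 A4 ED D1} => -[a1 d1] b1; rewrite /reduced /t0 !s1 /=.
  have [->|a10] := eqVneq a1 0; have [->|d10] := eqVneq d1 0 => /=.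
  - move=> + hb; have -> : b1 = 0 by apply/eqP; rewrite -size_poly_leq0 -ltnS.
    by rewrite eqxx.
  - by move=> _ _; move: d10; rewrite -size_poly_gt0; move: (size d1) => X; lia.
  - by move=> _ _; move: a10; rewrite -size_poly_gt0; move: (size a1) => X; lia.
  - by move=> _ _; move: a10; rewrite -size_poly_gt0; move: (size a1) => X; lia.
(* At the identity matrix, the bounds for arbitrarily large j leave only the value 0. *)
apply/eqP; rewrite -subr_eq0; apply/eqP/(uabs_small_eq0 (v := v)) => e e0.
have D0 : 1 * 1 - 0 * 0 != 0 :> {poly Fq} by rewrite mulr0 subr0 mulr1 oner_eq0.
have E0 : lin x y 1 0 = x /\ lin x y 0 1 = y.
  by rewrite /lin rmorph0 rmorph1 !mul0r !mul1r addr0 add0r.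
have B j := bound j _ _ _ _ D0; rewrite E0.1 E0.2 -/(u x y) in B *.
rewrite ltNge; apply/negP => eu.
have := B (Num.bound (@cbound R Fq c k / e)).
have cb : 0 <= @cbound R Fq c k.
  by apply: le_trans (B 0%N); rewrite mulr_ge0 ?uabs_ge0.
rewrite leNgt => /negP; apply.
have := archi_boundP (divr_ge0 cb (ltW e0)); rewrite ltr_pdivrMr // => /lt_le_trans; apply.
rewrite mulrC; apply: ler_pM => //; first exact: ltW.
by rewrite ler_nat leq_addl.
Qed.

End HeckeEigenform.

(** * The upper half plane and its lattice functions *)

Section LaurentSeries.
Variables (R : realType) (Fq : finFieldType) (C : fieldType) (v : ultranorm R C).
Local Notation V := (valued v).
Variable iota : {rmorphism {poly Fq} -> V}.
Local Notation q := #|Fq|.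
Implicit Types (p m n : {poly Fq}) (x y z : V).
Local Notation T := (iota 'X).
Hypothesis iota_norm : forall p, p != 0 -> v (iota p) = q%:R ^+ (size p).-1.

Lemma q_gt0 : 0 < q%:R :> R.
Proof. by rewrite ltr0n card_gt0. Qed.

Lemma iota_lt1 p : v (iota p) < q%:R -> (size p <= 1)%N.
Proof.
have [->|p0] := eqVneq p 0; first by rewrite size_poly0.
rewrite iota_norm // -[X in _ < X]expr1 ltr_eXn2l ?q_gt1 //.
by case: (size p) => [|[|]].
Qed.

Lemma near_poly_sum (I : Type) (r : seq I) (F : I -> V) :
  (forall i, exists p, v (F i - iota p) < 1) ->
  exists p, v (\sum_(i <- r) F i - iota p) < 1.
Proof.
move=> h; elim: r => [|i r [p hp]].
  by exists 0; rewrite big_nil rmorph0 subr0 uabs0.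
have [p' hp'] := h i; exists (p' + p); rewrite big_cons rmorphD opprD addrACA.
exact: uabsD_lt.
Qed.

Lemma Finfty_near_poly x k : Finfty iota x -> exists p, v (T ^+ k * x - iota p) < 1.
Proof.
move=> [N [a /valued_cvgP h]]; have T0 := T_neq0 iota_norm.
have qk : 0 < (q%:R : R) ^- k by rewrite invr_gt0 exprn_gt0 // q_gt0.
have [n0 _ /(_ n0 (leqnn n0))] := h _ qk; rewrite /series /= => hn0.
have [i|p hp] := @near_poly_sum _ (index_iota 0 n0)
   (fun i => T ^+ k * (embc iota (a i) * T ^ (N - i%:Z))).
  rewrite mulrCA [T ^+ k]exprnP -expfzDr //.
  have [hN|hN] := lerP 0 (k%:Z + (N - i%:Z)).
    exists ((a i)%:P * 'X^`|(k%:Z + (N - i%:Z))%R|).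
    rewrite rmorphM rmorphXn /embc exprnP gez0_abs // subrr uabs0 //.
  exists 0; rewrite rmorph0 subr0 uabsM.
  have va : v (embc iota (a i)) <= 1.
    have [->|a0] := eqVneq (a i) 0; first by rewrite /embc rmorph0 uabs0.
    by rewrite /embc (iota_polyC iota_norm).
  apply: le_lt_trans (_ : v (T ^ (k%:Z + (N - i%:Z))) < 1).
    by rewrite ler_piMl ?uabs_ge0.
  move: hN; case: (k%:Z + _) => // l _; rewrite NegzE -exprnN uabsV uabsX iota_X //.
  by rewrite invf_lt1 ?exprn_gt0 ?q_gt0 // exprn_egt1 ?q_gt1.
exists p; apply: uabs_trans_lt hp; rewrite -mulr_sumr -mulrBr uabsM uabsX iota_X //.
rewrite uabsBC mulrC -ltr_pdivlMr ?exprn_gt0 ?q_gt0 // mul1r.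
exact: hn0.
Qed.

(** With [Finfty_near_poly], a description of F_infty that mentions no series; it gives both that
    F_infty is closed and that it contains the fractions. *)
Lemma near_poly_Finfty x : (forall k, exists p, v (T ^+ k * x - iota p) < 1) ->
  Finfty iota x.
Proof.
move=> /choice[P hP]; have T0 := T_neq0 iota_norm.
(* P (k + 1) - X P k has absolute value below q, hence is a constant: the next digit of x. *)
have step k : exists c : Fq, P k.+1 = c%:P + 'X * P k.
  have : v (iota (P k.+1 - 'X * P k)) < q%:R.
    rewrite rmorphB rmorphM.
    apply: (@uabs_trans_lt _ _ _ (T ^+ k.+1 * x)).
      by rewrite uabsBC; apply: lt_trans (hP k.+1) _; exact: q_gt1.
    rewrite exprS -mulrA -mulrBr uabsM iota_X // -[ltRHS]mulr1 ltr_pM2l ?q_gt0 //.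
  move=> /iota_lt1 /size1_polyC E; exists (P k.+1 - 'X * P k)`_0.
  by rewrite -E subrK.
have {step} /choice[c hc] := step.
pose M := size (P 0%N).
(* The coefficients of P 0, from the top, are the digits at T^(M-1), ..., T^0; the constants c
   follow. *)
exists (M%:Z - 1), (fun i => if (i < M)%N then (P 0%N)`_(M - i.+1) else c (i - M)%N).
have S k : series (fun i : nat => embc iota (if (i < M)%N then (P 0%N)`_(M - i.+1)
    else c (i - M)%N) * T ^ (M%:Z - 1 - i%:Z)) (M + k)%N = iota (P k) / T ^+ k.
  elim: k => [|k IH]; rewrite /series /=.
    rewrite addn0 expr0 divr1 big_mkord (iota_sum iota (leqnn (size (P 0%N)))) -/M.
    rewrite (reindex_inj rev_ord_inj) /=; apply: eq_bigr => -[i hi] _ /=.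
    have -> : (M - i.+1 < M)%N by lia.
    have -> : (M - (M - i.+1).+1)%N = i by lia.
    by congr (_ * _); rewrite exprnP; congr (_ ^ _); lia.
  rewrite addnS big_nat_recr //=; rewrite /series /= in IH; rewrite IH.
  rewrite ifN -?leqNgt ?leq_addr // addKn [P k.+1]hc iota_cXp jjE /embc.
  have -> : M%:Z - 1 - (M + k)%N%:Z = - k.+1%:Z by lia.
  rewrite -exprnN exprS; have Tk : T ^+ k != 0 by rewrite expf_neq0.
  by field; rewrite T0 Tk.
apply/valued_cvgP => e e0; exists (M + Num.bound e^-1)%N => //= n /= hn.
rewrite -(subnKC (leq_trans (leq_addr _ _) hn)) S.
set k := (n - M)%N; have hk : (Num.bound e^-1 <= k)%N by rewrite /k; lia.
have Tk : T ^+ k != 0 by rewrite expf_neq0.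
have -> : iota (P k) / T ^+ k - x = (T ^+ k * x - iota (P k)) * - (T ^+ k)^-1.
  by field.
rewrite uabsM uabsN uabsV uabsX iota_X // -ltr_pdivlMr ?invr_gt0 ?exprn_gt0 ?q_gt0 //.
rewrite invrK; apply: lt_le_trans (hP k) _.
have := archi_boundP (ltW (divr_gt0 ltr01 e0)); rewrite div1r => h1.
have h2 : e^-1 <= q%:R ^+ k.
  apply: ltW; apply: lt_le_trans h1 _; apply: le_trans (expq_ge_size R Fq k).
  by rewrite ler_nat; apply: leq_trans hk _.
by rewrite mulrC -ler_pdivrMr // div1r.
Qed.

Lemma fraction_Finfty m n : m != 0 -> Finfty iota (iota n / iota m).
Proof.
move=> m0; apply: near_poly_Finfty => k; exists (('X^k * n) %/ m).
have im0 : iota m != 0 by rewrite iota_eq0.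
have -> : T ^+ k * (iota n / iota m) - iota (('X^k * n) %/ m) =
    iota (('X^k * n) %% m) / iota m.
  apply: (mulIf im0); rewrite mulfVK // mulrBl -rmorphM mulrA mulfVK //.
  rewrite -[T ^+ k]rmorphXn -rmorphM -rmorphB; congr (iota _).
  by rewrite {1}(divp_eq ('X^k * n) m) addrAC subrr add0r.
rewrite uabs_f ltr_pdivrMr ?uabs_gt0 // mul1r.
have [->|r0] := eqVneq (('X^k * n) %% m) 0; first by rewrite rmorph0 uabs0 uabs_gt0.
rewrite !iota_norm // ltr_eXn2l ?q_gt1 //.
have := ltn_modp ('X^k * n) m; rewrite m0; have := r0; rewrite -size_poly_gt0.
by move: (size _) (size _) => A B; lia.
Qed.

(** F_infty is closed: outside it, some T^k z is at distance at least 1 from all polynomials, which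
    keeps every Laurent series at distance at least q^-k from z. *)
Lemma Omega_dist z : Omega iota z ->
  exists2 c, 0 < c & forall x, Finfty iota x -> c <= v (z - x).
Proof.
move=> hz; have [k hk] : exists k, forall p, 1 <= v (T ^+ k * z - iota p).
  apply: contrapT => h; apply: hz; apply: near_poly_Finfty => k.
  apply: contrapT => h'; apply: h; exists k => p; rewrite leNgt; apply/negP => hp.
  by apply: h'; exists p.
exists (q%:R ^- k); first by rewrite invr_gt0 exprn_gt0 // q_gt0.
move=> x /(Finfty_near_poly k)[p hp]; have := hk p; apply: contraTT; rewrite -!ltNge => h.
apply: uabs_trans_lt hp; rewrite -mulrBr uabsM uabsX iota_X //.
by rewrite mulrC -ltr_pdivlMr ?exprn_gt0 ?q_gt0 // mul1r.
Qed.

(** For m != 0, m z + n is m times the difference of z and a fraction, which bounds it below by c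
    |m|. For n, either |n| > B |m| and n dominates, or |n| is at most B |m|. *)
Lemma dist_nondeg z c B : 0 < c -> c <= 1 -> 1 <= B -> v z <= B ->
  (forall x, Finfty iota x -> c <= v (z - x)) -> nondeg iota (c / B) z 1.
Proof.
move=> c0 c1 B1 zB hx; have B0 : 0 < B := lt_le_trans ltr01 B1.
split=> [|m n]; first by rewrite divr_gt0.
have cB : c / B <= 1 by rewrite ler_pdivrMr // mul1r (le_trans c1).
have [->|m0] := eqVneq m 0.
  rewrite /lin !rmorph0 mul0r add0r mulr1 uabs0 mulr0 uabs_ge0; split => //.
  by rewrite ler_piMl ?uabs_ge0.
have im0 : iota m != 0 by rewrite iota_eq0.
have h1 : c * v (iota m) <= v (lin iota z 1 m n).
  have -> : lin iota z 1 m n = iota m * (z - iota (- n) / iota m).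
    by rewrite /lin rmorphN; field.
  by rewrite uabsM mulrC ler_wpM2l ?uabs_ge0 //; apply/hx/fraction_Finfty.
split.
  apply: le_trans h1; rewrite ler_wpM2r ?uabs_ge0 // ler_pdivrMr //.
  by rewrite ler_peMr // ltW.
have [hn|hn] := ltP (v (iota m) * B) (v (iota n)).
  rewrite /lin mulr1 addrC uabsD_dom; first by rewrite ler_piMl ?uabs_ge0.
  by apply: le_lt_trans hn; rewrite uabsM ler_wpM2l ?uabs_ge0.
apply: le_trans h1; rewrite mulrAC ler_pdivrMr // -mulrA ler_pM2l //.
Qed.

Lemma Omega_nondeg z : Omega iota z -> exists c, nondeg iota c z 1.
Proof.
move=> /Omega_dist[c c0 hc]; exists (Num.min 1 c / Num.max 1 (v z)).
apply: dist_nondeg.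
- by rewrite lt_min ltr01.
- by rewrite ge_min lexx.
- by rewrite le_max lexx.
- by rewrite le_max lexx orbT.
- by move=> x /hc h; rewrite ge_min h orbT.
Qed.

Lemma imnorm_le z x : Finfty iota x -> imnorm iota z <= v (z - x).
Proof.
move=> hx; apply: ge_inf; last by exists x.
by exists 0 => _ [y _ <-]; exact: uabs_ge0.
Qed.

Lemma Omega_n_nondeg (n : nat) z : Omega_n iota n z -> nondeg iota (q%:R ^- n / q%:R ^+ n) z 1.
Proof.
move=> [_ [h1 h2]]; apply: dist_nondeg => //.
- by rewrite invr_gt0 exprn_gt0 // q_gt0.
- by rewrite invf_le1 ?exprn_gt0 ?q_gt0 // exprn_ege1 // ltW // q_gt1.
- by rewrite exprn_ege1 // ltW // q_gt1.
- by move=> x hx; apply: le_trans h2 _; exact: imnorm_le.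
Qed.

End LaurentSeries.

Section SpanProduct.
Variables (Fq : finFieldType) (K : fieldType) (j : {rmorphism Fq -> K}).
Local Notation q := #|Fq|.
Local Notation span := (span j).
Local Notation espan := (espan Fq).

Lemma prod_opp_nonzero : \prod_(c : Fq | c != 0) - j c = -1.
Proof.
have := finField_genPoly Fq; rewrite (bigD1 0) //= subr0.
have -> : 'X^q - 'X = 'X * ('X^(q.-1) - 1) :> {poly Fq}.
  by rewrite mulrBr mulr1 -exprS prednK ?card_gt0.
move/mulfI; rewrite polyX_eq0 => /(_ isT) /(congr1 (fun p => p.[0])).
rewrite horner_prod !hornerE ?hornerXn expr0n.
have -> : (q.-1 == 0)%N = false by have := card_gt1 Fq; case: q => [|[]].
rewrite sub0r => /(congr1 j); rewrite rmorphN1 rmorph_prod => ->.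
by apply: eq_bigr => c _; rewrite !hornerE /= rmorphN.
Qed.

Lemma prod_1sub (y b : K) : b != 0 ->
  y * \prod_(c : Fq | c != 0) (1 - y / (j c * b)) = y - y ^+ q / b ^+ q.-1.
Proof.
move=> b0; have bq : b ^+ q.-1 != 0 by rewrite expf_neq0.
have -> : \prod_(c : Fq | c != 0) (1 - y / (j c * b)) =
   (\prod_(c : Fq | c != 0) (y - j c * b)) / (\prod_(c : Fq | c != 0) (- j c * b)).
  rewrite -prodf_div; apply: eq_bigr => c c0.
  by field; rewrite ?oppr_eq0 ?b0 ?fmorph_eq0 ?c0.
rewrite big_split /= prod_opp_nonzero prodr_const.
have -> : #|[pred c : Fq | c != 0]| = q.-1 by exact: cardC1.
rewrite mulrA; have -> : y * \prod_(c : Fq | c != 0) (y - j c * b) = y ^+ q - y * b ^+ q.-1.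
  by rewrite -(prod_shift j) [RHS](bigD1 0) //= rmorph0 mul0r subr0.
move: bq; move: (b ^+ _) (y ^+ _) => B Y B0; by field; rewrite B0 oppr_eq0 oner_eq0.
Qed.

Lemma espan_prod bs x : indep j bs ->
  espan bs x = x * \prod_(w <- span bs | w != 0) (1 - x / w).
Proof.
elim: bs x => [|b bs IH] x; first by rewrite /= big_cons eqxx /= big_nil mulr1.
move=> /= /andP[hb hbs]; have el := espan_fqlin j bs.
have eb := espan_neq0 hbs hb.
rewrite -(prod_1sub _ eb) {1}(IH x hbs) -mulrA; congr (_ * _).
rewrite [RHS]big_mkcond [RHS]big_allpairs_dep big_enum [RHS](bigD1 0) //=; congr (_ * _).
  rewrite [LHS]big_mkcond; apply: eq_bigr => w _; by rewrite rmorph0 mul0r add0r.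
apply: eq_bigr => c c0.
have cb w : w \in span bs -> (j c * b + w == 0) = false.
  by move=> hw; rewrite (indep_shift _ hb hw) (negPf c0).
have P0 : pspan Fq bs != 0.
  have := prod_span_add b hbs => /esym E.
  have : espan bs b * pspan Fq bs != 0.
    rewrite E prodf_seq_neq0; apply/allP => w hw.
    have := indep_shift 1 hb hw; rewrite rmorph1 mul1r => ->.
    by rewrite oner_eq0.
  by rewrite mulf_eq0 negb_or => /andP[].
have cbn : j c * b \notin span bs.
  by apply/negP => /spanN h; have := cb _ h; rewrite subrr eqxx.
transitivity (\prod_(w <- span bs) ((j c * b - x + w) / (j c * b + w))); last first.
  rewrite big_seq [RHS]big_seq; apply: eq_bigr => w hw; rewrite cb //=.
  by field; rewrite (cb w hw).
rewrite prodf_div !prod_span_add //.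
rewrite (fqlinD el) (fqlinN _ el) (fqlinZ el).
have ec : j c * espan bs b != 0 by rewrite mulf_neq0 // fmorph_eq0.
by field; rewrite P0 eb fmorph_eq0 c0.
Qed.

End SpanProduct.

(** * Infinite products *)

Section UnorderedProducts.
Variables (R : realType) (C : fieldType) (v : ultranorm R C).
Local Notation V := (valued v).
Hypothesis complete : forall F : set_system V, ProperFilter F -> cauchy F -> cvg F.

Definition prods (I : choiceType) (F : I -> V) (l : V) : Prop :=
  forall e, 0 < e -> exists J0 : {fset I}, forall J : {fset I}, (J0 `<=` J)%fset ->
    v (\prod_(i <- J) F i - l) < e.

Lemma uabs_prod_1D (I : eqType) (r : seq I) (P : pred I) (a : I -> V) e : 0 < e -> e <= 1 ->
  (forall i, i \in r -> P i -> v (a i) < e) -> v (\prod_(i <- r | P i) (1 + a i) - 1) < e.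
Proof.
move=> e0 e1 h; rewrite big_seq_cond; elim/big_ind: _ => //.
- by rewrite subrr uabs0.
- move=> x y hx hy; have -> : x * y - 1 = (x - 1) * (y - 1) + ((x - 1) + (y - 1)) by ring.
  apply: uabsD_lt; last exact: uabsD_lt.
  by rewrite uabsM (le_lt_trans _ hx) // ler_piMr ?uabs_ge0 // (le_trans (ltW hy)).
- by move=> i /andP[hi Pi]; rewrite addrAC subrr add0r h.
Qed.

Lemma prod_fset_sub (I : choiceType) (a : I -> V) (A B : {fset I}) e : 0 < e -> e <= 1 ->
  (A `<=` B)%fset -> (forall i, i \notin A -> v (a i) < e) ->
  v (\prod_(i <- B) (1 + a i) - \prod_(i <- A) (1 + a i)) <=
    v (\prod_(i <- A) (1 + a i)) * e.
Proof.
move=> e0 e1 AB h.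
have -> : \prod_(i <- A) (1 + a i) = \prod_(i <- B | i \in A) (1 + a i).
  rewrite -[RHS]big_filter; apply: perm_big.
  apply: uniq_perm; rewrite ?filter_uniq ?fset_uniq //.
  move=> i; rewrite mem_filter; case: (boolP (i \in A)) => //= iA.
  by rewrite (fsubsetP AB).
rewrite (bigID (fun i => i \in A)) /= -[X in _ - X]mulr1 -mulrBr uabsM.
by rewrite ler_wpM2l ?uabs_ge0 // ltW // uabs_prod_1D // => i _; exact: h.
Qed.

(** Once J1 contains all factors at distance at least 1 from 1, enlarging the product cannot
    increase its absolute value; differences of partial products are then controlled by the new a
    i. *)
Lemma prods_ex (I : choiceType) (a : I -> V) : nullfam a ->
  exists l, prods (fun i => 1 + a i) l.
Proof.
move=> ha; pose P (J : {fset I}) := \prod_(i <- J) (1 + a i).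
have [J1 hJ1] := ha _ ltr01; pose B := v (P J1) + 1.
have B0 : 0 < B by rewrite ltr_wpDl ?uabs_ge0.
have hB J : (J1 `<=` J)%fset -> v (P J) <= v (P J1).
  move=> hJ; have := prod_fset_sub ltr01 (lexx 1) hJ hJ1; rewrite mulr1 => H.
  by rewrite -(subrK (P J1) (P J)) uabsD_le.
have key e : 0 < e -> exists2 J0 : {fset I}, (J1 `<=` J0)%fset &
    forall J, (J0 `<=` J)%fset -> v (P J - P J0) < e.
  move=> e0; pose e' := Num.min 1 (e / B).
  have e'0 : 0 < e' by rewrite lt_min ltr01 divr_gt0.
  have e'1 : e' <= 1 by rewrite ge_min lexx.
  have [J2 hJ2] := ha _ e'0; exists (J1 `|` J2)%fset; first exact: fsubsetUl.
  move=> J hJ; have := prod_fset_sub e'0 e'1 hJ (a := a) => H.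
  apply: le_lt_trans (H _) _ => [i|].
    by rewrite inE => /norP[_]; exact: hJ2.
  apply: le_lt_trans (_ : v (P J1) * e' < _).
    by rewrite ler_wpM2r ?(ltW e'0) // hB // fsubsetUl.
  apply: lt_le_trans (_ : B * e' <= _); first by rewrite ltr_pM2r // /B ltrDl.
  by rewrite mulrC -ler_pdivlMr // ge_min lexx orbT.
have /complete : cauchy (P @ totally).
  apply: cauchy_exP => e e0; have [J _ hJ] := key _ e0; exists (P J).
  exists J => //= J' /= JJ'; rewrite ballEmdist.
  change (v (P J - P J') < e); rewrite uabsBC.
  exact: hJ.
move=> /cvg_ex[s /valued_cvgP hs]; exists s => e e0.
by have [J _ hJ] := hs _ e0; exists J => J' JJ'; exact: hJ.
Qed.

Lemma prods_lim (I : choiceType) (F : I -> V) l : prods F l ->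
  lim ((fun J : {fset I} => \prod_(i <- J) F i) @ totally) = l.
Proof.
move=> h; apply: valued_cvg_lim; apply/valued_cvgP => e /h[J hJ].
by exists J => //= J' /= ?; exact: hJ.
Qed.

Lemma vlim_prods (I : choiceType) (F : I -> V) l (J : nat -> {fset I}) :
  prods F l -> (forall A : {fset I}, exists N, forall n, (N <= n)%N -> (A `<=` J n)%fset) ->
  vlim (fun n => \prod_(i <- J n) F i) l.
Proof.
move=> h hJ e /h[A hA]; have [N hN] := hJ A; exists N => n /hN.
exact: hA.
Qed.

End UnorderedProducts.

(** * Exponential functions of lattices as limits of [espan] *)

Section LatticeFunctions.
Variables (R : realType) (Fq : finFieldType) (C : fieldType) (v : ultranorm R C).
Local Notation V := (valued v).
Variable iota : {rmorphism {poly Fq} -> V}.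
Local Notation q := #|Fq|.
Implicit Types (p m n s : {poly Fq}) (x y z : V).
Local Notation T := (iota 'X).
Local Notation jj := (jj iota).
Hypothesis complete : forall F : set_system V, ProperFilter F -> cauchy F -> cvg F.
Hypothesis iota_norm : forall p, p != 0 -> v (iota p) = q%:R ^+ (size p).-1.

Lemma span_map_eq bs (a : V) : span jj [seq a * b | b <- bs] = [seq a * w | w <- span jj bs].
Proof.
elim: bs => [|b bs IH]; first by rewrite /= mulr0.
rewrite map_cons /= IH map_allpairs allpairs_mapr.
by apply: eq_allpairs => c w /=; ring.
Qed.

Lemma span_powers y N : span jj (powers iota y N) = [seq iota n * y | n <- polys Fq N].
Proof.
elim: N => [|N IH]; first by rewrite /= rmorph0 mul0r.
rewrite powersS /= span_map_eq IH -map_comp map_allpairs allpairs_mapr.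
rewrite allpairs_mapr enumT; apply: eq_allpairs => c n /=; by rewrite iota_cXp jjE; ring.
Qed.

Lemma espan_powers_prod y N x : y != 0 ->
  espan Fq (powers iota y N) x =
  x * \prod_(n <- polys Fq N | n != 0) (1 - x / (iota n * y)).
Proof.
move=> y0; rewrite (espan_prod _ (indep_powers iota_norm N y0)) span_powers big_map.
congr (_ * _); apply: eq_bigl => n.
by rewrite mulf_eq0 (negPf y0) orbF iota_eq0.
Qed.

Lemma fset_polys_sub (A : {fset {poly Fq}}) :
  exists N, forall i, (N <= i)%N -> (A `<=` [fset p in polys Fq i])%fset.
Proof.
exists (\max_(p <- A) size p) => n hn; apply/fsubsetP => p pA.
rewrite in_fset mem_polys; apply: leq_trans hn.
exact: (@leq_bigmax_seq _ (enum_fset A) xpredT (fun p : {poly Fq} => size p) p).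
Qed.

Lemma ratio_null y x : y != 0 -> nullfam (fun n => if n != 0 then - (x / (iota n * y)) else 0).
Proof.
move=> y0; apply: (nullfam_height (B := v (x / y)) (finite_height_poly Fq)) => n.
case: eqVneq => [_|n0] /=; first by rewrite uabs0 mul0r uabs_ge0.
rewrite uabsN invfM mulrCA uabsM uabsV mulrAC ler_piMl ?uabs_ge0 //.
rewrite mulrC ler_pdivrMr ?(lt_le_trans ltr01 (iota_ge1 iota_norm n0)) // mul1r.
exact: size_le_iota.
Qed.

(* The limit is the exponential function of the lattice y A. *)
Lemma espan_lim y x : y != 0 ->
  exists l, vlim (fun N => espan Fq (powers iota y N) x) l.
Proof.
move=> y0; have [l hl] := prods_ex complete (ratio_null x y0).
exists (x * l); have := vlim_prods hl fset_polys_sub => /(vlimM (vlim_cst x)).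
apply: eq_vlim => N; rewrite espan_powers_prod //; congr (_ * _).
rewrite [RHS]big_mkcond; apply: eq_trans (_ : \prod_(n <- polys Fq N) _ = _).
  apply/perm_big/uniq_perm; rewrite ?uniq_polys ?fset_uniq // => p.
  by rewrite in_fset.
by apply: eq_bigr => n _; case: ifP => _; rewrite ?addr0.
Qed.

Definition lattice y : set V := [set iota n * y | n in [set: {poly Fq}]].

Lemma espan_unordered_prod y x l : y != 0 ->
  vlim (fun N => espan Fq (powers iota y N) x) l ->
  x * unordered_prod (lattice y `\ 0) (fun b => 1 - x / b) = l.
Proof.
move=> y0 hl.
pose a (b : V) : V := if b \in lattice y `\ 0 then - (x / b) else 0.
have fi : injective (fun n : {poly Fq} => iota n * y).
  move=> n n' /(mulIf y0) /eqP; rewrite -subr_eq0 -rmorphB iota_eq0 // subr_eq0.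
  by move/eqP.
have memL n : (iota n * y \in lattice y `\ 0) = (n != 0).
  apply/idP/idP => [|n0].
    rewrite inE => -[_ /eqP]; apply: contra => /eqP ->.
    by rewrite rmorph0 mul0r.
  rewrite inE; split; first by exists n.
  by apply/eqP; rewrite mulf_neq0 // iota_eq0.
have af n : a (iota n * y) = if n != 0 then - (x / (iota n * y)) else 0.
  by rewrite /a memL.
have ha : nullfam a.
  move=> e e0; have [J hJ] := ratio_null x y0 e0.
  exists [fset iota n * y | n in J]%fset => b hb; rewrite /a.
  case: ifP => [|_]; last by rewrite uabs0.
  rewrite inE => -[[n _ E] _]; rewrite -E in hb *.
  have := hJ n; rewrite -af /a memL; case: eqVneq => [->|n0 H].
    by move=> _; rewrite rmorph0 mul0r invr0 mulr0 oppr0 uabs0.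
  by apply: H; apply: contra hb => nJ; apply/imfsetP; exists n.
have [l' hl'] := prods_ex complete ha.
have -> : unordered_prod (lattice y `\ 0) (fun b => 1 - x / b) = l'.
  rewrite /unordered_prod.
  have -> : (fun J : {fset V} => \prod_(i <- J | i \in lattice y `\ 0) (1 - x / i)) =
      (fun J : {fset V} => \prod_(i <- J) (1 + a i)).
    apply/funext => J; rewrite big_mkcond; apply: eq_bigr => b _.
    by rewrite /a; case: ifP => _; rewrite ?addr0.
  exact: prods_lim hl'.
pose JN N := [fset iota n * y | n in [fset n in polys Fq N]]%fset.
have lim : vlim (fun N => \prod_(b <- JN N) (1 + a b)) l'.
  move=> e /hl'[A hA]; have [A' hA'] := fset_preim_inj A fi.
  have [N hN] := fset_polys_sub A'; exists N => n /hN /fsubsetP hn.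
  (* The sets [JN n] are not cofinal among the finite subsets of C. Adding A is harmless: its
     lattice points other than 0 are already in [JN n], and the other factors are 1. *)
  suff -> : \prod_(b <- JN n) (1 + a b) = \prod_(b <- (A `|` JN n)%fset) (1 + a b).
    by apply: hA; exact: fsubsetUl.
  apply: (big_fset_incl _ (fsubsetUr A (JN n))).
  move=> b; rewrite inE => /orP[bA|->//] bJ; rewrite /a; case: ifP => [|_]; last first.
    by rewrite addr0.
  rewrite inE => -[[p _ E] _]; case/negP: bJ; apply/imfsetP; exists p => //.
  by apply: hn; rewrite hA' E.
apply: (vlim_unique (vlimM (vlim_cst x) lim)); apply: eq_vlim hl => N.
rewrite espan_powers_prod //; congr (_ * _).
rewrite big_imfset /=; last by move=> n n' _ _; exact: fi.
rewrite big_mkcond; apply: eq_trans (_ : \prod_(n <- polys Fq N) _ = _); last first.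
  apply/perm_big/uniq_perm; rewrite ?uniq_polys ?fset_uniq // => p.
  by rewrite in_fset.
by apply: eq_bigr => n _; rewrite af; case: ifP => _; rewrite ?addr0.
Qed.

Lemma lattice_sum_null y z : y != 0 -> nullfam (fun n => (z + iota n * y)^-1).
Proof.
move=> y0; have vy : 0 < v y by rewrite uabs_gt0.
have [N hN] : exists N : nat, v z / v y < N%:R.
  by exists (Num.bound (v z / v y)); apply: archi_boundP; rewrite divr_ge0 ?uabs_ge0 ?ltW.
have hbig n : (N <= size n)%N -> v (z + iota n * y) = v (iota n * y).
  move=> hn; rewrite addrC uabsD_dom // uabsM -ltr_pdivrMr //.
  apply: lt_le_trans hN _; apply: le_trans (size_le_iota iota_norm n).
  by rewrite ler_nat.
move=> e e0; have [J hJ] := finite_height_poly Fq (maxn N (Num.bound (e * v y)^-1)).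
exists J => n nJ; have : (maxn N (Num.bound (e * v y)^-1) < size n)%N.
  by rewrite ltnNge; apply: contra nJ; exact: hJ.
rewrite gtn_max => /andP[/ltnW /hbig hn1 hn2].
have ey : 0 < e * v y by rewrite mulr_gt0.
rewrite uabsV hn1 uabsM; have hb : (e * v y)^-1 < v (iota n).
  apply: lt_le_trans (archi_boundP _) _; first by rewrite invr_ge0 ltW.
  by apply: le_trans (size_le_iota iota_norm n); rewrite ler_nat ltnW.
have n0 : 0 < v (iota n) by apply: lt_trans hb; rewrite invr_gt0.
rewrite -[ltRHS]invrK ltf_pV2 ?posrE ?mulr_gt0 ?invr_gt0 //.
by rewrite -ltr_pdivrMr // -invfM.
Qed.

Lemma espan_sum y z N : y != 0 -> (forall n, z + iota n * y != 0) ->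
  \sum_(n <- polys Fq N) (z + iota n * y)^-1 = (espan Fq (powers iota y N) z)^-1.
Proof.
move=> y0 hz; have := @sum_span_inv _ _ jj _ z 1 (indep_powers iota_norm N y0).
rewrite expr1 => <-; rewrite ?card_gt0 //.
  by rewrite sum_powers; apply: eq_bigr => n _; rewrite expr1.
apply/negP => /mem_powers[n _ E]; have := hz (- n).
by rewrite E rmorphN mulNr subrr eqxx.
Qed.

Lemma lattice_sum_lim y z : y != 0 ->
  vlim (fun N => \sum_(n <- polys Fq N) (z + iota n * y)^-1)
    (usum (fun n => (z + iota n * y)^-1)).
Proof.
move=> y0; have := vlim_sums (J := fun N => [fset p in polys Fq N]%fset)
  (ht := fun p : {poly Fq} => size p) (usumP complete (lattice_sum_null z y0)).
move=> H; apply: eq_vlim (H _) => [N|N p hp]; first by rewrite big_polyset.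
by rewrite in_fset mem_polys.
Qed.

(** The limit of [sum_span_inv] at k = 1, written as a product so that it also shows l to be
    nonzero. *)
Lemma lattice_sum_espan y z l : y != 0 -> (forall n, z + iota n * y != 0) ->
  vlim (fun N => espan Fq (powers iota y N) z) l ->
  usum (fun n => (z + iota n * y)^-1) * l = 1.
Proof.
move=> y0 hz hl; apply: vlim_unique (vlimM (lattice_sum_lim z y0) hl) _.
apply: eq_vlim (vlim_cst 1) => N; rewrite espan_sum // mulVf //.
apply: espan_neq0 (indep_powers iota_norm N y0) _.
apply/negP => /mem_powers[n _ E]; have := hz (- n).
by rewrite E rmorphN mulNr subrr eqxx.
Qed.

Lemma tlatt_lattice y z : y != 0 -> (forall n, z + iota n * y != 0) ->
  tlatt (lattice y) z = usum (fun n => (z + iota n * y)^-1).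
Proof.
move=> y0 hz; have [l hl] := espan_lim z y0.
rewrite /tlatt /elatt (espan_unordered_prod y0 hl).
have E := lattice_sum_espan y0 hz hl; have l0 : l != 0.
  by apply/eqP => l0; move/eqP: E; rewrite l0 mulr0 eq_sym oner_eq0.
by rewrite -[LHS]mul1r -E mulfK.
Qed.

Lemma lattA_lattice : lattA iota = lattice 1.
Proof.
apply/seteqP; split=> _ [n _ <-]; exists n => //; by rewrite mulr1.
Qed.

Lemma lattTA_lattice : lattTA iota = lattice T.
Proof.
by apply/seteqP; split=> _ [n _ <-]; exists n => //; rewrite rmorphM mulrC.
Qed.

End LatticeFunctions.

(** * The sums over Gamma(T) and over the cosets of K *)

Section Matrices2.
Variable K : comNzRingType.
Implicit Types g h : 'M[K]_2.

Lemma mulmx2 g h i k : (g *m h) i k = g i 0 * h 0 k + g i 1 * h 1 k.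
Proof. by rewrite mxE big_ord_recl big_ord1; congr (_ + g i _ * h _ k); apply: val_inj. Qed.

Lemma matrix2P g h : g 0 0 = h 0 0 -> g 0 1 = h 0 1 -> g 1 0 = h 1 0 ->
  g 1 1 = h 1 1 -> g = h.
Proof.
move=> h1 h2 h3 h4; apply/matrixP => i k.
have E (l : 'I_2) : l = 0 \/ l = 1.
  by case: l => [[|[|]]] // hl; [left|right]; apply: val_inj.
by case: (E i) => ->; case: (E k) => ->.
Qed.

Definition mx2 (a b c d : K) : 'M[K]_2 :=
  \matrix_(i, k) if i == 0 then (if k == 0 then a else b) else
                  if k == 0 then c else d.

Lemma mx2E a b c d : [/\ mx2 a b c d 0 0 = a, mx2 a b c d 0 1 = b,
  mx2 a b c d 1 0 = c & mx2 a b c d 1 1 = d].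
Proof. by rewrite !mxE. Qed.

Lemma det_mx2' a b c d : \det (mx2 a b c d) = a * d - b * c.
Proof. by rewrite det_mx2 !mxE. Qed.

Definition adj2 g : 'M[K]_2 := mx2 (g 1 1) (- g 0 1) (- g 1 0) (g 0 0).

Lemma mul_adj2 g : \det g = 1 -> g *m adj2 g = 1%:M.
Proof.
rewrite det_mx2 => E.
have [h1 h2 h3 h4] := mx2E (g 1 1) (- g 0 1) (- g 1 0) (g 0 0).
apply: matrix2P; rewrite mulmx2 /adj2 ?h1 ?h2 ?h3 ?h4 [RHS]mxE /=.
- by rewrite -E; ring.
- by ring.
- by ring.
- by rewrite -E; ring.
Qed.

End Matrices2.

Section CongruenceSubgroup.
Variable Fq : finFieldType.
Local Notation mat := 'M[{poly Fq}]_2.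
Local Notation quad := (({poly Fq} * {poly Fq}) * ({poly Fq} * {poly Fq}))%type.
Implicit Types g h : mat.

Definition ev0 g : 'M[Fq]_2 := map_mx (horner_eval 0) g.
Definition cst (A : 'M[Fq]_2) : mat := map_mx polyC A.

Lemma ev0M g h : ev0 (g *m h) = ev0 g *m ev0 h.
Proof. exact: map_mxM. Qed.

Lemma ev0E g i k : ev0 g i k = (g i k)`_0.
Proof. by rewrite mxE /= horner_evalE horner_coef0. Qed.

Lemma cstM A B : cst (A *m B) = cst A *m cst B.
Proof. exact: map_mxM. Qed.

Lemma ev0_cst A : ev0 (cst A) = A.
Proof. by apply/matrixP => i k; rewrite ev0E mxE coefC eqxx. Qed.

Lemma det_cst A : \det (cst A) = (\det A)%:P.
Proof. exact: det_map_mx. Qed.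

Lemma det_ev0 g : \det (ev0 g) = (\det g)`_0.
Proof. by rewrite det_map_mx /= horner_evalE horner_coef0. Qed.

Lemma GL2AE g : GL2A g <-> exists2 c, c != 0 & \det g = c%:P.
Proof.
rewrite /GL2A /= unitmxE poly_unitE; split=> [/andP[/size_poly1P[c c0 ->] _]|[c c0 ->]].
  by exists c.
by rewrite size_polyC c0 coefC eqxx unitfE c0.
Qed.

(** The determinant is a constant whose reduction modulo T is 1, so it is 1. *)
Lemma GammaTE g : GammaT g <-> \det g = 1 /\ ev0 g = 1%:M.
Proof.
split=> [[/GL2AE[c c0 E] h]|[h1 h2]].
  have e : ev0 g = 1%:M.
    apply/matrixP => i k; rewrite ev0E; have := h i k.
    rewrite -['X]subr0 -[X in 'X - X]polyC0 dvdp_XsubCl /root !mxE.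
    rewrite hornerD hornerN subr_eq0 -horner_coef0 => /eqP ->.
    by case: eqP => _; rewrite ?mulr1n ?mulr0n ?hornerC ?horner0.
  split=> //; have := det_ev0 g; rewrite e det1 E coefC eqxx /= => <-.
  by rewrite polyC1.
split; first by rewrite /GL2A /= unitmxE h1 unitr1.
move=> i k; rewrite -['X]subr0 -[X in 'X - X]polyC0 dvdp_XsubCl /root.
move/matrixP: h2 => /(_ i k); rewrite ev0E !mxE hornerD hornerN -horner_coef0 => ->.
by rewrite -polyC_natr hornerC subrr.
Qed.

Lemma GammaTM g h : GammaT g -> GammaT h -> GammaT (g *m h).
Proof.
move=> /GammaTE[d1 e1] /GammaTE[d2 e2]; apply/GammaTE.
by rewrite det_mulmx d1 d2 mulr1 ev0M e1 e2 mulmx1.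
Qed.

Lemma GammaT_unit g : GammaT g -> g \in unitmx.
Proof. by case. Qed.

Lemma ev0V g : g \in unitmx -> ev0 g *m ev0 (invmx g) = 1%:M.
Proof. by move=> gu; rewrite -ev0M mulmxV // /ev0 map_mx1. Qed.

Lemma GammaTV g : GammaT g -> GammaT (invmx g).
Proof.
move=> hg; have gu := GammaT_unit hg; case/GammaTE: hg => d1 e1; apply/GammaTE.
by rewrite det_inv d1 invr1; split=> //; have := ev0V gu; rewrite e1 mul1mx.
Qed.

Lemma invmx_adj2 g : GammaT g -> invmx g = adj2 g.
Proof.
move=> hg; have gu := GammaT_unit hg; case/GammaTE: hg => d1 _.
by rewrite -[LHS]mulmx1 -(mul_adj2 d1) mulKmx.
Qed.

Lemma GammaT_conj g A : A \in unitmx -> GammaT g ->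
  GammaT (cst (invmx A) *m g *m cst A).
Proof.
move=> Au /GammaTE[d1 e1]; apply/GammaTE; rewrite !det_mulmx d1 mulr1 !det_cst.
rewrite -polyCM -det_mulmx mulVmx // det1; split=> //.
by rewrite !ev0M !ev0_cst e1 mulmx1 mulVmx.
Qed.

Definition qmat (w : quad) : mat :=
  mx2 (1 + 'X * w.1.1) ('X * w.1.2) ('X * w.2.1) (1 + 'X * w.2.2).

Lemma qmatE w : [/\ qmat w 0 0 = 1 + 'X * w.1.1, qmat w 0 1 = 'X * w.1.2,
  qmat w 1 0 = 'X * w.2.1 & qmat w 1 1 = 1 + 'X * w.2.2].
Proof. exact: mx2E. Qed.

Lemma qmat_inj : injective qmat.
Proof.
move=> w w' E; have [a1 a2 a3 a4] := qmatE w; have [b1 b2 b3 b4] := qmatE w'.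
have X0 : 'X != 0 :> {poly Fq} by rewrite polyX_eq0.
move: a1 a2 a3 a4; rewrite E b1 b2 b3 b4.
move=> /addrI/(mulfI X0) e1 /(mulfI X0) e2 /(mulfI X0) e3 /addrI/(mulfI X0) e4.
by case: w w' {E b1 b2 b3 b4} e1 e2 e3 e4 => [[? ?] [? ?]] [[? ?] [? ?]] /= -> -> -> ->.
Qed.

Lemma GammaT_qmat w : qmat w \in (@GammaT Fq) = (qdet w == 1).
Proof.
have [a1 a2 a3 a4] := qmatE w.
have -> : qdet w = \det (qmat w) by rewrite det_mx2 a1 a2 a3 a4.
apply/idP/eqP; rewrite inE GammaTE; first by case.
move=> ->; split=> //; apply: matrix2P; rewrite !ev0E ?a1 ?a2 ?a3 ?a4 mxE /=;
  by rewrite ?coef0_1X ?coef0_X.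
Qed.

Lemma qmat_onto g : GammaT g -> exists w, qmat w = g.
Proof.
move=> /GammaTE[_ e].
have h i k : (g i k)`_0 = (i == k)%:R by rewrite -ev0E e mxE.
have hX (p : {poly Fq}) : p`_0 = 0 -> 'X * ptail p = p.
  by move=> p0; exact: ptail0.
exists ((ptail (g 0 0), ptail (g 0 1)), (ptail (g 1 0), ptail (g 1 1))).
by apply: matrix2P; rewrite !mxE /= ?ptail1 ?ptail0 ?h.
Qed.

End CongruenceSubgroup.

Section GammaSum.
Variables (R : realType) (Fq : finFieldType) (C : fieldType) (v : ultranorm R C).
Local Notation V := (valued v).
Variable iota : {rmorphism {poly Fq} -> V}.
Local Notation q := #|Fq|.
Local Notation mat := 'M[{poly Fq}]_2.
Implicit Types (p m n : {poly Fq}) (x y z : V) (g h : mat).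
Local Notation lin := (lin iota).
Local Notation embc := (embc iota).
Hypothesis complete : forall F : set_system V, ProperFilter F -> cauchy F -> cvg F.
Hypothesis iota_norm : forall p, p != 0 -> v (iota p) = q%:R ^+ (size p).-1.

Definition act g (u : V * V) : V * V :=
  (lin u.1 u.2 (g 0 0) (g 0 1), lin u.1 u.2 (g 1 0) (g 1 1)).

Definition moore (u : V * V) : V := moore2 Fq u.1 u.2.

Lemma actM g h u : act (g *m h) u = act g (act h u).
Proof. by rewrite /act /= !lin_lin !mulmx2. Qed.

Lemma moore_cst (A : 'M[Fq]_2) u : moore (act (cst A) u) = embc (\det A) * moore u.
Proof.
rewrite /moore /act /= /moore2 det_mx2 /lin /= !mxE.
have fr c : iota c%:P ^+ q = iota c%:P := frobj (jj iota) c.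
have frD a b (s t : V) : (iota a%:P * s + iota b%:P * t) ^+ q
    = iota a%:P * s ^+ q + iota b%:P * t ^+ q.
  by rewrite (frobD (jj iota)) !exprMn !fr.
rewrite !frD /Defs.embc polyCB !polyCM rmorphB !rmorphM.
by ring.
Qed.

Definition gterm k (u : V * V) g : V := if g \in @GammaT Fq then moore (act g u) ^- k else 0.

Lemma gterm_qmat k u w : gterm k u (qmat w) = fterm iota k u.1 u.2 w.
Proof.
rewrite /gterm /fterm GammaT_qmat /sterm; case: eqP => // _.
have [-> ->] := sterm_args iota u.1 u.2 w.
by have [e1 e2 e3 e4] := qmatE w; rewrite /moore /act e1 e2 e3 e4.
Qed.

Lemma sums_gterm c x y k : nondeg iota c x y -> (0 < k)%N ->
  sums (gterm k (x, y)) (fsum iota k x y).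
Proof.
move=> h k0; apply: (sums_inj (@qmat_inj Fq)).
  move=> g hg; rewrite /gterm; case: ifP => //; rewrite inE => /qmat_onto[w E].
  by case: (hg w).
by apply: eq_sums (fsumP complete iota_norm h k0) => w; rewrite gterm_qmat.
Qed.

Lemma gterm_unique c x y k s : nondeg iota c x y -> (0 < k)%N ->
  sums (gterm k (x, y)) s -> s = fsum iota k x y.
Proof. by move=> h k0 hs; apply: sums_unique hs (sums_gterm h k0). Qed.

Lemma act_nondeg g c x y : nondeg iota c x y -> \det g != 0 ->
  exists c', nondeg iota c' (act g (x, y)).1 (act g (x, y)).2.
Proof.
by rewrite det_mx2 => h d0; apply: (nondeg_lin iota_norm h).
Qed.

Lemma fsum_GammaT c x y k g : nondeg iota c x y -> (0 < k)%N -> GammaT g ->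
  fsum iota k (act g (x, y)).1 (act g (x, y)).2 = fsum iota k x y.
Proof.
move=> h k0 hg; have gu := GammaT_unit hg.
have [c' h'] : exists c', nondeg iota c' (act g (x, y)).1 (act g (x, y)).2.
  by apply: act_nondeg h _; case/GammaTE: hg => -> _; rewrite oner_eq0.
symmetry; apply: (gterm_unique h' k0); rewrite -surjective_pairing.
have fi : injective (fun a : mat => a *m g) by move=> a b /(can_inj (mulmxK gu)).
have := sums_gterm h k0.
move=> /(inj_sums complete fi) hh; apply: eq_sums (hh _) => [a|a /(_ (a *m invmx g))].
  rewrite /gterm -actM.
  have -> // : (a *m g \in @GammaT Fq) = (a \in @GammaT Fq).
  apply/idP/idP; rewrite !inE => ha; last exact: GammaTM.
  by rewrite -[a](mulmxK gu); apply: GammaTM (GammaTV hg).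
by rewrite mulmxKV.
Qed.

(** Reindexing by conjugation with A, which preserves Gamma(T), moves A to the left, where it
    multiplies D by its determinant. This transports the expansion at infinity to all cusps. *)
Lemma fsum_cst c x y k (A : 'M[Fq]_2) : nondeg iota c x y -> (0 < k)%N ->
  A \in unitmx ->
  fsum iota k (act (cst A) (x, y)).1 (act (cst A) (x, y)).2 =
  embc (\det A) ^- k * fsum iota k x y.
Proof.
move=> h k0 Au.
have cVA : cst (invmx A) *m cst A = 1%:M by rewrite -cstM mulVmx // /cst map_mx1.
have cAV : cst A *m cst (invmx A) = 1%:M by rewrite -cstM mulmxV // /cst map_mx1.
have [c' h'] : exists c', nondeg iota c' (act (cst A) (x, y)).1 (act (cst A) (x, y)).2.
  apply: act_nondeg h _; rewrite det_cst polyC_eq0.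
  by move: Au; rewrite unitmxE unitfE.
symmetry; apply: (gterm_unique h' k0); rewrite -surjective_pairing.
pose f (a : mat) := cst (invmx A) *m a *m cst A.
have fK : cancel (fun a => cst A *m a *m cst (invmx A)) f.
  by move=> a; rewrite /f !mulmxA cVA mul1mx -mulmxA cVA mulmx1.
have fK' : cancel f (fun a => cst A *m a *m cst (invmx A)).
  by move=> a; rewrite /f !mulmxA cAV mul1mx -mulmxA cAV mulmx1.
have := sums_gterm h k0.
move=> /(inj_sums complete (can_inj fK')) hh.
have {}hh := hh (fun a ha => False_ind _ (ha _ (fK a))).
apply: eq_sums (sumsZ (embc (\det A) ^- k) hh) => a.
rewrite /gterm.
have -> : (f a \in @GammaT Fq) = (a \in @GammaT Fq).
  apply/idP/idP; rewrite !inE => ha; last exact: GammaT_conj.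
  rewrite -[a]fK' -{1}[A]invmxK; apply: GammaT_conj => //.
  by rewrite unitmx_inv.
case: ifP => _; last by rewrite mulr0.
rewrite -actM -exprVn -[X in _ * X]exprVn -exprMn -invfM -moore_cst -actM.
by rewrite /f !mulmxA cAV mul1mx exprVn.
Qed.

Lemma moore_scale d x y : moore (d * x, d * y) = d ^+ q.+1 * moore (x, y).
Proof. by rewrite /moore /moore2 /= !exprMn exprS; ring. Qed.

Lemma act_scale g d x y : act g (d * x, d * y) = (d * (act g (x, y)).1, d * (act g (x, y)).2).
Proof. by rewrite /act /lin /=; congr pair; ring. Qed.

Lemma nondeg_scale c x y d : nondeg iota c x y -> d != 0 ->
  nondeg iota (v d * c) (d * x) (d * y).
Proof.
move=> [c0 h] d0; split=> [|m n]; first by rewrite mulr_gt0 // uabs_gt0.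
have -> : lin (d * x) (d * y) m n = d * lin x y m n by rewrite /lin; ring.
by have [h1 h2] := h m n; rewrite uabsM -!mulrA; split; apply: ler_wpM2l; rewrite ?uabs_ge0.
Qed.

Lemma fsum_scale c x y k d : nondeg iota c x y -> (0 < k)%N -> d != 0 ->
  fsum iota k (d * x) (d * y) = d ^- (k * q.+1) * fsum iota k x y.
Proof.
move=> h k0 d0; symmetry; apply: (gterm_unique (nondeg_scale h d0) k0).
apply: eq_sums (sumsZ (d ^- (k * q.+1)) (sums_gterm h k0)) => g.
rewrite /gterm act_scale; case: ifP => _; last by rewrite mulr0.
rewrite moore_scale -surjective_pairing mulnC exprM -[(_ * _) ^- k]exprVn invfM exprMn.
by rewrite !exprVn.
Qed.

End GammaSum.

Lemma prod_option (I : finType) (K : comNzRingType) (F : option I -> K) :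
  \prod_x F x = F None * \prod_i F (Some i).
Proof.
rewrite (bigD1 None) //=; congr (_ * _).
rewrite (reindex_omap Some id) /=; last by case.
by apply: eq_bigl => i; rewrite eqxx.
Qed.

(** * The terms of f_kappa^T as powers of 1 / D *)

Section PairSum.
Variables (R : realType) (Fq : finFieldType) (C : fieldType) (v : ultranorm R C).
Local Notation V := (valued v).
Variable iota : {rmorphism {poly Fq} -> V}.
Local Notation q := #|Fq|.
Local Notation mat := 'M[{poly Fq}]_2.
Implicit Types (p m n : {poly Fq}) (x y z : V) (g h : mat).
Local Notation lin := (lin iota).
Local Notation embc := (embc iota).
Hypothesis complete : forall F : set_system V, ProperFilter F -> cauchy F -> cvg F.
Hypothesis iota_norm : forall p, p != 0 -> v (iota p) = q%:R ^+ (size p).-1.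

Definition pden (s t : V) (x : option Fq) : V :=
  if x is Some c then s - embc c * t else - t.

(** The determinant with columns b and a, in homogeneous coordinates (c, 1) for c finite and (1, 0)
    for infinity. *)
Definition wedge (a b : option Fq) : Fq :=
  match a, b with
  | Some c, Some d => d - c
  | None, Some _ => -1
  | Some _, None => 1
  | None, None => 0
  end.

Definition pnum (g : 'M[V]_2) (x : option Fq) : V :=
  if x is Some c then g 1 0 * embc c + g 1 1 else g 1 0.

(** (s, t) is the adjugate of g applied to (z, 1). When g sends x to infinity both sides are 0,
    since then the numerator [pnum] vanishes. *)
Lemma polarE (g : 'M[V]_2) z (x : option Fq) (s := g 1 1 * z - g 0 1) (t := g 0 0 - g 1 0 * z) :
  pden s t x != 0 ->
  polar z (moebiusP1 g (omap embc x)) = pnum g x / pden s t x.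
Proof.
case: x => [c|] /= h; rewrite /autj; case: eqP => h0 /=; rewrite /polar.
- by rewrite h0 mul0r.
- rewrite /moebius /autj.
  have -> : z - (g 0 0 * embc c + g 0 1) / (g 1 0 * embc c + g 1 1)
    = (s - embc c * t) / (g 1 0 * embc c + g 1 1).
    by rewrite /s /t; field; apply/eqP.
  by rewrite invf_div.
- by rewrite h0 mul0r.
- have -> : z - g 0 0 / g 1 0 = - t / g 1 0 by rewrite /t; field; apply/eqP.
  by rewrite invf_div.
Qed.

Lemma upairE (g : 'M[V]_2) z (a b : option Fq) (s := g 1 1 * z - g 0 1) (t := g 0 0 - g 1 0 * z) :
  g 0 0 * g 1 1 - g 0 1 * g 1 0 = 1 -> pden s t a != 0 -> pden s t b != 0 ->
  upair z (moebiusP1 g (omap embc a)) (moebiusP1 g (omap embc b)) =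
  embc (wedge a b) / (pden s t a * pden s t b).
Proof.
move=> d1 ha hb; rewrite /upair !polarE //.
have -> : pnum g b / pden s t b - pnum g a / pden s t a =
   (pnum g b * pden s t a - pnum g a * pden s t b) / (pden s t a * pden s t b).
  by field; rewrite ha hb.
congr (_ / _); rewrite /pnum /wedge /pden /s /t /Defs.embc.
case: a b ha hb => [c|] [d|] _ _; rewrite ?polyCB ?polyCN ?polyC1 ?polyC0 ?rmorphB ?rmorphN ?rmorph1 ?rmorph0 -[RHS]mulr1 -[X in _ = _ * X]d1; ring.
Qed.

Lemma prod_pden s t : \prod_x pden s t x = - moore2 Fq s t.
Proof. by rewrite prod_option /= mulNr (moore2_prod (jj iota)). Qed.

Lemma prod_pair r (a b : 'I_r -> option Fq) (F : option Fq -> V) :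
  pair_decomposition a b -> \prod_(i < r) (F (a i) * F (b i)) = \prod_x F x.
Proof.
move=> hb; rewrite (reindex _ (onW_bij _ hb)) /= big_sumType /= -big_split.
by [].
Qed.

Definition pair_const r (a b : 'I_r -> option Fq) : Fq := \prod_(i < r) wedge (a i) (b i).

Lemma pair_decomposition_inj r (a b : 'I_r -> option Fq) : pair_decomposition a b ->
  [/\ injective a, injective b & forall i k, a i != b k].
Proof.
move=> /bij_inj hi; split=> [i k E|i k E|i k].
- by have [] := hi (inl i) (inl k) E.
- by have [] := hi (inr i) (inr k) E.
by apply/eqP => E; have := hi (inl i) (inr k) E.
Qed.

(** The pair i0 that contains infinity is the one missing from C0, and e is its contribution. *)
Lemma pair_const_C0 r (a b : 'I_r -> option Fq) i0 (e : Fq) : wedge (a i0) (b i0) = e ->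
  (forall i, (i == i0) = ~~ ((a i != None) && (b i != None))) ->
  pair_const a b = e * C0 a b.
Proof.
move=> he h; rewrite /pair_const (bigD1 i0) //= he; congr (_ * _).
rewrite /C0; apply: eq_big => [i|i]; first by rewrite h negbK.
by rewrite h negbK; case: (a i) (b i) => [c|] [d|].
Qed.

Lemma pair_const_a r (a b : 'I_r -> option Fq) : pair_decomposition a b ->
  (exists i, a i = None) -> pair_const a b = - C0 a b.
Proof.
move=> /pair_decomposition_inj[ia ib hab] [i0 h0].
rewrite -mulN1r; apply: (@pair_const_C0 _ _ _ i0).
  by rewrite h0; case: (b i0) (hab i0 i0) => //; rewrite h0.
move=> i; rewrite -(inj_eq ia) h0 negb_and !negbK.
have := hab i0 i; rewrite h0 eq_sym => /negPf ->; by rewrite orbF.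
Qed.

Lemma pair_const_b r (a b : 'I_r -> option Fq) : pair_decomposition a b ->
  (exists i, b i = None) -> pair_const a b = C0 a b.
Proof.
move=> /pair_decomposition_inj[ia ib hab] [i0 h0].
rewrite -[RHS]mul1r; apply: (@pair_const_C0 _ _ _ i0).
  by rewrite h0; case: (a i0) (hab i0 i0) => //; rewrite h0.
move=> i; rewrite -(inj_eq ib) h0 negb_and !negbK.
have := hab i i0; rewrite h0 => /negPf ->; by [].
Qed.

Lemma embA_det (g : mat) : \det g = 1 ->
  embA iota g 0 0 * embA iota g 1 1 - embA iota g 0 1 * embA iota g 1 0 = 1.
Proof. by rewrite det_mx2 !mxE -!rmorphM -rmorphB => ->; rewrite rmorph1. Qed.

Lemma prod_upair c z k r (a b : 'I_r -> option Fq) g : nondeg iota c z 1 ->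
  pair_decomposition a b -> GammaT g ->
  \prod_(i < r) upair z (moebiusP1 (embA iota g) (omap embc (a i)))
      (moebiusP1 (embA iota g) (omap embc (b i))) ^+ k =
  embc (- pair_const a b) ^+ k * moore Fq (act iota (invmx g) (z, 1)) ^- k.
Proof.
move=> h hab hg; rewrite prodrXl.
have [d1 _] := (GammaTE g).1 hg; have D := embA_det d1.
rewrite invmx_adj2 // /moore /act /adj2 /=.
have [-> -> -> ->] := mx2E (g 1 1) (- g 0 1) (- g 1 0) (g 0 0).
set G := embA iota g.
have Es : lin z 1 (g 1 1) (- g 0 1) = G 1 1 * z - G 0 1.
  by rewrite /lin /G !mxE rmorphN mulr1.
have Et : lin z 1 (- g 1 0) (g 0 0) = G 0 0 - G 1 0 * z.
  by rewrite /lin /G !mxE rmorphN mulr1 mulNr addrC.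
have pd (x : option Fq) : pden (G 1 1 * z - G 0 1) (G 0 0 - G 1 0 * z) x != 0.
  have M0 : moore2 Fq (G 1 1 * z - G 0 1) (G 0 0 - G 1 0 * z) != 0.
    rewrite -Es -Et -(uabs_gt0 (v := v)).
    have dd : g 1 1 * g 0 0 - - g 0 1 * - g 1 0 != 0.
      by move: d1; rewrite det_mx2 mulrNN [g 1 1 * _]mulrC => ->; rewrite oner_eq0.
    have [h0 _ _ _ _] := moore2_ge iota_norm h dd.
    by apply: lt_le_trans h0; rewrite exprn_gt0 //; case: h.
  move: M0; rewrite -oppr_eq0 -prod_pden => /prodf_neq0 H; exact: H.
rewrite (eq_bigr (fun i => embc (wedge (a i) (b i)) *
    ((pden (G 1 1 * z - G 0 1) (G 0 0 - G 1 0 * z) (a i)) *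
     (pden (G 1 1 * z - G 0 1) (G 0 0 - G 1 0 * z) (b i)))^-1)); last first.
  by move=> i _; rewrite upairE.
rewrite big_split /= prodfV (prod_pair (pden _ _) hab) prod_pden Es Et.
rewrite exprMn -[(_ ^+ k)^-1]exprVn invrN -!exprMn mulrN -mulNr; congr ((_ * _) ^+ k).
by rewrite /pair_const /Defs.embc polyCN rmorphN [in RHS]rmorph_prod [in RHS]rmorph_prod.
Qed.

Lemma fT_fsum c z k r (a b : 'I_r -> option Fq) : nondeg iota c z 1 -> (0 < k)%N ->
  pair_decomposition a b ->
  fT iota k a b z = embc (- pair_const a b) ^+ k * fsum iota k z 1.
Proof.
move=> h k0 hab; apply: sums_unordered_sum.
have iK : involutive (@invmx {poly Fq} 2) by exact: invmxK.
have := sums_gterm complete iota_norm h k0.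
move=> /(inj_sums complete (inv_inj iK)) hh.
have {}hh := hh (fun g hg => False_ind _ (hg _ (iK g))).
apply: eq_sums (sumsZ (embc (- pair_const a b) ^+ k) hh) => g.
rewrite /gterm.
have -> : (invmx g \in @GammaT Fq) = (g \in @GammaT Fq).
  by apply/idP/idP; rewrite !inE; [rewrite -{2}[g]iK|]; exact: GammaTV.
case: ifP => [|_]; last by rewrite mulr0.
by rewrite inE => hg; rewrite (prod_upair _ h).
Qed.

End PairSum.

(** * Cosets of K *)

Section CosetMatrices.
Variable Fq : finFieldType.
Local Notation mat := 'M[{poly Fq}]_2.
Implicit Types g h : mat.

Definition umat (x : Fq) (p : {poly Fq}) : mat := mx2 x%:P p 0 1.

Lemma det_umat x p : \det (umat x p) = x%:P.
Proof. by rewrite det_mx2' mulr1 mulr0 subr0. Qed.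

Lemma umat_Ksub x p : x != 0 -> Ksub (umat x p).
Proof. by move=> x0; exists x, p; have [-> -> -> ->] := mx2E x%:P p 0 1. Qed.

Lemma KsubP k : Ksub k -> exists x p, x != 0 /\ k = umat x p.
Proof.
move=> [x [p [x0 h1 h2 h3 h4]]]; exists x, p; split=> //.
by have [e1 e2 e3 e4] := mx2E x%:P p 0 1; apply: matrix2P; rewrite ?e1 ?e2 ?e3 ?e4.
Qed.

Lemma umatM x p y r : umat x p *m umat y r = umat (x * y) (x%:P * r + p).
Proof.
have [e1 e2 e3 e4] := mx2E x%:P p 0 1; have [f1 f2 f3 f4] := mx2E y%:P r 0 1.
have [g1 g2 g3 g4] := mx2E (x * y)%:P (x%:P * r + p) 0 1.
by apply: matrix2P; rewrite mulmx2 ?e1 ?e2 ?e3 ?e4 ?f1 ?f2 ?f3 ?f4 ?g1 ?g2 ?g3 ?g4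
  ?polyCM ?mulr0 ?mul0r ?mulr1 ?addr0 ?add0r.
Qed.

Lemma umat1 : umat 1 0 = 1%:M.
Proof.
have [e1 e2 e3 e4] := mx2E (1 : {poly Fq}) 0 0 1.
by apply: matrix2P; rewrite /umat ?polyC1 ?e1 ?e2 ?e3 ?e4 mxE.
Qed.

Lemma Kcoset_refl g : Kcoset g g.
Proof.
by exists 1%:M; [rewrite -umat1; apply: umat_Ksub; rewrite oner_eq0 | rewrite mul1mx].
Qed.

Lemma Kcoset_umat x p g : x != 0 -> Kcoset (umat x p *m g) = Kcoset g.
Proof.
move=> x0; apply/seteqP; split=> _ [k /KsubP[y [r [y0 ->]]] <-].
  exists (umat y r *m umat x p); last by rewrite mulmxA.
  by rewrite umatM; apply: umat_Ksub; rewrite mulf_neq0.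
exists (umat (y * x^-1) (r - (y * x^-1)%:P * p)); last first.
  by rewrite mulmxA umatM divfK // addrC subrK.
by apply: umat_Ksub; rewrite mulf_neq0 ?invr_eq0.
Qed.

Lemma Kcoset_eq g h : Kcoset g h -> exists x p, [/\ x != 0, h = umat x p *m g & Kcoset h = Kcoset g].
Proof.
move=> [k /KsubP[x [p [x0 ->]]] <-]; exists x, p; split=> //; exact: Kcoset_umat.
Qed.

(** For r nonzero, a representative in SL_2(F_q) of the matrices with bottom row r. Left
    multiplication by K preserves bottom rows, so r labels the reduction of a coset modulo T. *)
Definition bottom (r : Fq * Fq) : 'M[Fq]_2 :=
  if r.2 == 0 then mx2 0 (- r.1^-1) r.1 0 else mx2 r.2^-1 0 r.1 r.2.

Lemma bottomE r : bottom r 1 0 = r.1 /\ bottom r 1 1 = r.2.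
Proof.
rewrite /bottom; case: eqP => [->|_].
  by have [_ _ -> ->] := mx2E 0 (- r.1^-1) r.1 0.
by have [_ _ -> ->] := mx2E r.2^-1 0 r.1 r.2.
Qed.

Lemma det_bottom r : r != (0, 0) -> \det (bottom r) = 1.
Proof.
case: r => r1 r2; rewrite /bottom xpair_eqE /=; case: (r2 =P 0) => [_|/eqP r0]; rewrite ?andbT det_mx2' => h.
  by rewrite mul0r sub0r mulNr opprK mulVf.
by rewrite mulVf // mul0r subr0.
Qed.

Lemma same_bottom (A B : 'M[Fq]_2) : \det A = 1 -> \det B = 1 ->
  A 1 0 = B 1 0 -> A 1 1 = B 1 1 -> exists c, B = mx2 1 c 0 1 *m A.
Proof.
rewrite !det_mx2 => dA dB e1 e2; exists (B 0 1 * A 0 0 - B 0 0 * A 0 1).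
set c := (_ - _); have [f1 f2 f3 f4] := mx2E 1 c 0 1.
apply: matrix2P; rewrite mulmx2 ?f1 ?f2 ?f3 ?f4 ?e1 ?e2; last 2 first.
- by ring.
- by ring.
- rewrite -e1 -e2 in dB; rewrite mul1r /c -e1.
  transitivity (B 0 0 * (A 0 0 * A 1 1 - A 0 1 * A 1 0)
    + A 0 0 * (1 - (B 0 0 * A 1 1 - B 0 1 * A 1 0))); last by ring.
  by rewrite dA dB; ring.
- rewrite -e1 -e2 in dB; rewrite mul1r /c -e2.
  transitivity (B 0 1 * (A 0 0 * A 1 1 - A 0 1 * A 1 0)
    + A 0 1 * (1 - (B 0 0 * A 1 1 - B 0 1 * A 1 0))); last by ring.
  by rewrite dA dB; ring.
Qed.

Lemma ev0_umat x p : ev0 (umat x p) = mx2 x p`_0 0 1.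
Proof.
have [e1 e2 e3 e4] := mx2E x%:P p 0 1; have [f1 f2 f3 f4] := mx2E x p`_0 0 1.
by apply: matrix2P; rewrite ev0E ?e1 ?e2 ?e3 ?e4 ?f1 ?f2 ?f3 ?f4 ?coefC ?coef1.
Qed.

End CosetMatrices.

Section SumsFinite.
Variables (R : realType) (C : fieldType) (v : ultranorm R C).

Lemma sums_finite (I : finType) (F : I -> valued v) : sums F (\sum_i F i).
Proof.
have -> : \sum_i F i = \sum_(i <- [fset i in enum I]%fset) F i.
  rewrite -big_enum; apply/perm_big/uniq_perm; rewrite ?enum_uniq ?fset_uniq //.
  by move=> i; rewrite in_fset.
by apply: sums_fset => i; rewrite in_fset mem_enum.
Qed.

End SumsFinite.

Section Hform.
Variables (R : realType) (Fq : finFieldType) (C : fieldType) (v : ultranorm R C).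
Local Notation V := (valued v).
Variable iota : {rmorphism {poly Fq} -> V}.
Local Notation q := #|Fq|.
Local Notation mat := 'M[{poly Fq}]_2.
Implicit Types (m n : {poly Fq}) (x y z : V) (g h : mat).
Local Notation lin := (lin iota).
Local Notation embc := (embc iota).
Hypothesis complete : forall F : set_system V, ProperFilter F -> cauchy F -> cvg F.
Hypothesis iota_norm : forall p, p != 0 -> v (iota p) = q%:R ^+ (size p).-1.

Lemma act_umat (a : Fq) p (u : V * V) :
  act iota (umat a p) u = (embc a * u.1 + iota p * u.2, u.2).
Proof.
rewrite /act /umat /lin; have [-> -> -> ->] := mx2E a%:P p 0 1.
by rewrite rmorph0 rmorph1 mul0r add0r mul1r.
Qed.

Lemma nondeg_div c x y : nondeg iota c x y -> exists c', nondeg iota c' (x / y) 1.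
Proof.
move=> h; have y0 := nondeg_neq0 iota_norm h.
exists (v y^-1 * c); rewrite [x / y]mulrC -[X in nondeg _ _ _ X](mulVf y0).
by apply: nondeg_scale => //; rewrite invr_eq0.
Qed.

Lemma tlatt_sums c x y (a : Fq) : nondeg iota c x y -> a != 0 ->
  sums (fun m => (embc a * x + iota m * y)^-1) (tlatt (lattA iota) (x / y) / (embc a * y)).
Proof.
move=> h a0; have y0 := nondeg_neq0 iota_norm h; have [c' h'] := nondeg_div h.
have ea0 : embc a != 0 by rewrite /Defs.embc (fmorph_eq0 (jj iota)).
have E m : lin (x / y) 1 1 m = x / y + iota m * 1 by rewrite /lin rmorph1 mul1r.
rewrite lattA_lattice (tlatt_lattice complete iota_norm) ?oner_eq0 //; last first.
  by move=> n; rewrite -E (lin_eq0 iota_norm _ _ h') oner_eq0.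
have hs := tsumP complete iota_norm 1 h' (ltn0Sn 0).
have fi : injective (fun m => a^-1%:P * m).
  by move=> m n; apply: mulfI; rewrite polyC_eq0 invr_eq0.
have := inj_sums complete fi _ hs => hh.
have aK m : a^-1%:P * (a%:P * m) = m by rewrite mulrA -polyCM mulVf // mul1r.
have {}hh := hh (fun m hm => False_ind _ (hm (a%:P * m) (aK m))).
have -> : usum (fun n => (x / y + iota n * 1)^-1) = tsum iota 1 (x / y) 1 1.
  by congr usum; apply: funext => n; rewrite /tterm E expr1.
rewrite [_ / (embc a * y)]mulrC; apply: eq_sums (sumsZ (embc a * y)^-1 hh) => m.
rewrite /tterm expr1 E mulr1 rmorphM.
have -> : iota a^-1%:P = (embc a)^-1 by exact: (fmorphV (jj iota)).
rewrite -invfM; congr (_^-1); move: (embc a) ea0 (iota m) => A A0 M.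
by field; rewrite A0 y0.
Qed.

(** By [moore2_inv] with k = 1, each term is a sum over d in F_q of the inverses of a x + (c0 + d +
    T n) y. As c0 + d + T n takes every value in A once, the whole is a sum over A, which is t_A up
    to a factor. *)
Lemma moore_coset_sum c x y (a c0 : Fq) : nondeg iota c x y -> a != 0 ->
  sums (fun n => (moore Fq (act iota (umat a (c0%:P + 'X * n)) (x, y)))^-1)
    (- (tlatt (lattA iota) (x / y) / (embc a * y ^+ q.+1))).
Proof.
move=> h a0; have y0 := nondeg_neq0 iota_norm h.
have hs := tlatt_sums h a0.
pose f (i : {poly Fq} * Fq) := c0%:P + i.2%:P + 'X * i.1.
have fi : injective f.
  move=> [n d] [n' d'] E.
  have := congr1 (fun p : {poly Fq} => p`_0) E.
  rewrite /f /= !(coefD, coefC, coefXM) /= !addr0 => /addrI e; move: E.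
  by rewrite /f /= e => /addrI /mulfI -> //; rewrite polyX_eq0.
have fs m : f (ptail m, m`_0 - c0) = m.
  by rewrite /f /= polyCB addrCA subrr addr0 -ptailE.
have := inj_sums complete fi _ hs => hh.
have {}hh := hh (fun m hm => False_ind _ (hm _ (fs m))).
have := sums_pair hh (fun n => sums_finite _) => {}hh.
have -> : - (tlatt (lattA iota) (x / y) / (embc a * y ^+ q.+1)) =
   (- y ^+ q)^-1 * (tlatt (lattA iota) (x / y) / (embc a * y)).
  rewrite exprS invrN mulNr; congr (- _); rewrite !invfM; ring.
apply: eq_sums (sumsZ _ hh) => n.
rewrite act_umat /moore /=.
have E d : embc a * x + iota (c0%:P + 'X * n) * y + jj iota d * y
   = embc a * x + iota (f (n, d)) * y.
  rewrite /f /= !rmorphD /Defs.embc; ring.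
have q1 : (0 < 1 <= q)%N by rewrite card_gt0.
have M := @moore2_inv Fq _ (jj iota) (embc a * x + iota (c0%:P + 'X * n) * y) y 1 y0 _ q1.
rewrite expr1 in M; rewrite M => [|d]; last first.
  rewrite E; have -> : embc a * x + iota (f (n, d)) * y = lin x y a%:P (f (n, d)) by [].
  by rewrite (lin_eq0 iota_norm _ _ h) polyC_eq0 (negPf a0).
rewrite expr1; congr (_ * _); apply: eq_bigr => d _; by rewrite expr1 E.
Qed.

(** One copy of the terms of f_1 for each nonzero row r, so that the total is (q^2 - 1) f_1 = -
    f_1. *)
Definition hfam (u : V * V) (i : (Fq * Fq) * mat) : V :=
  if i.1 != (0, 0) then gterm iota 1 u i.2 else 0.

Lemma sum_nonzero_pairs (s : V) : \sum_(r : Fq * Fq) (if r != (0, 0) then s else 0) = - s.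
Proof.
rewrite -big_mkcond sumr_const.
have -> : #|[pred r : Fq * Fq | r != (0, 0)]| = (q * q).-1 by rewrite cardC1 card_prod.
apply/eqP; rewrite -addr_eq0 -mulrSr prednK ?muln_gt0 ?card_gt0 //.
by rewrite -mulr_natr natrM (card_natr0K (jj iota)) !mulr0.
Qed.

Lemma sums_hfam c x y : nondeg iota c x y -> sums (hfam (x, y)) (- fsum iota 1 x y).
Proof.
move=> h; have hs := sums_gterm complete iota_norm h (ltn0Sn 0).
rewrite -sum_nonzero_pairs.
pose F r (i : (Fq * Fq) * mat) := if i.1 == r then hfam (x, y) i else 0.
have hF r : sums (F r) (if r != (0, 0) then fsum iota 1 x y else 0).
  apply: (sums_inj (f := fun g : mat => (r, g))) => [g g' [] //|[r' g]|].
    by rewrite /F /=; case: eqP => // -> hg; case: (hg g).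
  rewrite /F /hfam /= eqxx; case: ifP => _; first exact: eq_sums hs.
  exact: sums0.
apply: eq_sums (sums_sum (index_enum _) hF) => i.
by rewrite (bigD1 i.1) //= /F eqxx big1 ?addr0 // => r /negPf; rewrite eq_sym => ->.
Qed.

(* Each coset of K in G contains products bottom r *m g, with g in Gamma(T), for
   exactly one r, and these g form one coset of the translations by T A; summing
   over the q^2 - 1 = -1 values of r gives the opposite of both sides. *)
Lemma hform_fsum c z : nondeg iota c z 1 -> hform iota z = fsum iota 1 z 1.
Proof.
move=> h; apply: sums_unordered_sum; rewrite -[fsum _ _ _ _]opprK.
set D := _ @` _.
have unit_SL A : \det (A : 'M[Fq]_2) = 1 -> A \in unitmx.
  by rewrite unitmxE => ->; rewrite unitr1.
pose p (i : (Fq * Fq) * mat) := Kcoset (cst (bottom i.1) *m i.2).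
suff hf : sums (fun X => - (if X \in D then hterm iota (xget 1%:M X) z else 0))
    (- fsum iota 1 z 1).
  by apply: eq_sums (sumsN hf) => X; rewrite opprK.
apply: (sums_fiber (sums_hfam h) (p := p)) => X.
have [|hX] := boolP (X \in D); last first.
  rewrite oppr0; apply: eq_sums (sums0 _ _) => -[r g]; case: eqP => // E.
  rewrite /hfam /gterm /=; case: eqP => //= /eqP r0; case: ifP => //.
  rewrite inE => hg; case/negP: hX; rewrite inE; exists (cst (bottom r) *m g) => //.
  apply/GL2AE; exists 1; rewrite ?oner_eq0 // det_mulmx det_cst det_bottom //.
  by case/GammaTE: hg => ->; rewrite mulr1.
rewrite inE => -[g0 /GL2AE[d0 d00 Ed0] EX].
have hg1 : X (xget 1%:M X).
  by apply: (@xgetPex _ 1%:M X); exists g0; rewrite -EX; exact: Kcoset_refl.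
move: hg1; set g1 := xget _ _; clearbody g1; rewrite -EX => /Kcoset_eq[b [pb [b0 Eg1 EK]]].
rewrite -EK {X EX EK}.
have [d d_0 Ed] : exists2 d, d != 0 & \det g1 = d%:P.
  exists (b * d0); first by rewrite mulf_neq0.
  by rewrite Eg1 det_mulmx det_umat Ed0 polyCM.
have g1u : g1 \in unitmx by apply/GL2AE; exists d.
have dV0 : d^-1 != 0 by rewrite invr_eq0.
pose r0 := (ev0 g1 1 0, ev0 g1 1 1).
have r00 : r0 != (0, 0).
  apply/eqP => -[e1 e2]; have := det_ev0 g1; rewrite det_mx2 e1 e2 !mulr0 subr0 Ed coefC eqxx /=.
  by move/esym/eqP; rewrite (negPf d_0).
have uB (x : Fq) k : (mx2 x k 0 1 *m ev0 g1) 1 0 = ev0 g1 1 0 /\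
    (mx2 x k 0 1 *m ev0 g1) 1 1 = ev0 g1 1 1.
  by have [_ _ e3 e4] := mx2E x k 0 1; rewrite !mulmx2 e3 e4 !mul0r !add0r !mul1r.
have [c0 Ec0] : exists c0, bottom r0 = mx2 d^-1 c0 0 1 *m ev0 g1.
  have [|||c0] := @same_bottom _ (mx2 d^-1 0 0 1 *m ev0 g1) (bottom r0) _ (det_bottom r00).
  - by rewrite det_mulmx det_mx2' det_ev0 Ed coefC eqxx mulr1 mulr0 subr0 mulVf.
  - by rewrite (uB _ _).1 (bottomE _).1.
  - by rewrite (uB _ _).2 (bottomE _).2.
  move=> ->; exists c0; rewrite mulmxA; congr (_ *m _).
  have [e1 e2 e3 e4] := mx2E 1 c0 0 1; have [f1 f2 f3 f4] := mx2E d^-1 0 0 1.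
  have [k1 k2 k3 k4] := mx2E d^-1 c0 0 1.
  by apply: matrix2P; rewrite mulmx2 ?e1 ?e2 ?e3 ?e4 ?f1 ?f2 ?f3 ?f4 ?k1 ?k2 ?k3 ?k4;
    rewrite ?mul0r ?mulr0 ?mul1r ?mulr1 ?addr0 ?add0r.
have nu1 := det_bottom r00; have nuu := unit_SL _ nu1.
have cstu : cst (bottom r0) \in unitmx.
  by apply/GL2AE; exists 1; rewrite ?oner_eq0 // det_cst nu1.
(* These are the elements of the coset of determinant 1 and reduction [bottom r0]: the determinant
   forces the scalar 1 / d, and the reduction the constant term c0. *)
pose hn n := umat d^-1 (c0%:P + 'X * n) *m g1.
pose f n : (Fq * Fq) * mat := (r0, invmx (cst (bottom r0)) *m hn n).
have hnd n : \det (hn n) = 1 by rewrite det_mulmx det_umat Ed -polyCM mulVf.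
have hn0 n : ev0 (hn n) = bottom r0.
  by rewrite ev0M ev0_umat coefD coefC coefXM /= addr0 Ec0.
have fG n : GammaT (f n).2.
  apply/GammaTE; rewrite /f /= det_mulmx hnd mulr1 det_inv det_cst nu1 polyC1 invr1.
  by split=> //; rewrite ev0M hn0 -[X in _ *m X](ev0_cst (bottom r0)) -ev0M mulVmx // /ev0 map_mx1.
have fi : injective f.
  move=> n n' [] /(can_inj (mulKVmx cstu)) /(can_inj (mulmxK g1u)) /matrixP/(_ 0 1).
  have [_ -> _ _] := mx2E (d^-1)%:P (c0%:P + 'X * n) 0 1.
  have [_ -> _ _] := mx2E (d^-1)%:P (c0%:P + 'X * n') 0 1.
  by move=> /addrI /mulfI -> //; rewrite polyX_eq0.
pose u := act iota g1 (z, 1).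
have [c' hu] : exists c', nondeg iota c' u.1 u.2.
  by apply: (act_nondeg iota_norm h); rewrite Ed polyC_eq0.
apply: (sums_inj fi).
  move=> [r g] hrg; rewrite /p /=; case: eqP => // E; rewrite /hfam /gterm /=.
  case: eqP => //= /eqP rn0; case: ifP => //; rewrite inE => hg; exfalso.
  have [dg eg] := (GammaTE g).1 hg.
  have /Kcoset_eq[e [k [e0 E1 _]]] : Kcoset g1 (cst (bottom r) *m g).
    by rewrite -E; exact: Kcoset_refl.
  have ed : e = d^-1.
    have := congr1 determinant E1; rewrite !det_mulmx det_cst det_bottom // dg det_umat Ed.
    rewrite mulr1 -polyCM => /polyC_inj e1; apply: (mulIf d_0); by rewrite mulVf // -e1.
  have E2 : bottom r = mx2 d^-1 k`_0 0 1 *m ev0 g1.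
    by rewrite -ed -ev0_umat -ev0M -E1 ev0M ev0_cst eg mulmx1.
  have er : r = r0.
    rewrite [r]surjective_pairing -(bottomE r).1 -(bottomE r).2 E2.
    by rewrite (uB _ _).1 (uB _ _).2.
  have k0 : k`_0 = c0.
    have ev1u : ev0 g1 \in unitmx.
      by rewrite unitmxE det_ev0 Ed coefC eqxx unitfE.
    move: E2; rewrite er Ec0 => /(can_inj (mulmxK ev1u)) /matrixP/(_ 0 1).
    have [_ -> _ _] := mx2E d^-1 c0 0 1; by have [_ -> _ _] := mx2E d^-1 k`_0 0 1.
  apply: (hrg (ptail k)); rewrite /f er; congr pair.
  by rewrite /hn -k0 -ptailE -ed -E1 er mulKmx.
have := moore_coset_sum c0 hu dV0 => hh.
have -> : - hterm iota g1 z =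
   - (tlatt (lattA iota) (u.1 / u.2) / (embc d^-1 * u.2 ^+ q.+1)).
  congr (- _); rewrite /hterm /moebius /autj /u /act /lin !mxE /= Ed.
  have -> : embc d^-1 = (embc d)^-1 by exact: (fmorphV (jj iota)).
  by rewrite !mulr1 invfM invrK [LHS]mulrC.
apply: eq_sums hh => n.
rewrite /p /= mulKVmx // Kcoset_umat // eqxx /hfam /= r00 /gterm.
have /mem_set -> := fG n; rewrite expr1.
have <- : embc (\det (bottom r0)) * moore Fq (act iota (f n).2 (z, 1)) =
    moore Fq (act iota (f n).2 (z, 1)).
  by rewrite nu1 /Defs.embc polyC1 rmorph1 mul1r.
by rewrite -moore_cst -actM mulKVmx // /hn actM.
Qed.

End Hform.

(** * Modularity and expansions at the cusps *)

Section Modularity.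
Variables (R : realType) (Fq : finFieldType) (C : fieldType) (v : ultranorm R C).
Local Notation V := (valued v).
Variable iota : {rmorphism {poly Fq} -> V}.
Local Notation q := #|Fq|.
Local Notation mat := 'M[{poly Fq}]_2.
Implicit Types (p m n : {poly Fq}) (x y z : V) (g h : mat).
Local Notation lin := (lin iota).
Local Notation embc := (embc iota).
Hypothesis complete : forall F : set_system V, ProperFilter F -> cauchy F -> cvg F.
Hypothesis iota_norm : forall p, p != 0 -> v (iota p) = q%:R ^+ (size p).-1.

Lemma fsum_pow c x y k : odd q -> nondeg iota c x y -> (0 < k < q)%N ->
  fsum iota k x y = fsum iota 1 x y ^+ k.
Proof.
move=> oq h hk; have q1 := card_gt1 Fq.
have hk' : (0 < k <= q)%N by case/andP: hk => -> /ltnW.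
have F k' := fsum_Ssum complete iota_norm (k := k') oq h.
rewrite !F // (Ssum_pow complete iota_norm h hk') (zeta_pow complete iota_norm hk').
by rewrite exprMn exprVn.
Qed.

Lemma lin_act z g : ((act iota g (z, 1)).1 = embA iota g 0 0 * z + embA iota g 0 1) /\
  ((act iota g (z, 1)).2 = autj (embA iota g) z).
Proof. by rewrite /act /autj /embA /lin !mxE /= !mulr1. Qed.

Lemma nondeg_moebius c z g : nondeg iota c z 1 -> \det g != 0 ->
  exists c', nondeg iota c' (moebius (embA iota g) z) 1.
Proof.
move=> h d0; have [c1 h1] := act_nondeg iota_norm h d0.
have [c2 h2] := nondeg_div iota_norm h1; exists c2; move: h2.
by have [-> ->] := lin_act z g.
Qed.

Lemma fsum_moebius c z g k : nondeg iota c z 1 -> \det g != 0 -> (0 < k)%N ->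
  fsum iota k (moebius (embA iota g) z) 1 =
  autj (embA iota g) z ^+ (k * q.+1) * fsum iota k (act iota g (z, 1)).1 (act iota g (z, 1)).2.
Proof.
move=> h d0 k0; have [c1 h1] := act_nondeg iota_norm h d0.
have y0 := nondeg_neq0 iota_norm h1; have [e1 e2] := lin_act z g.
have := fsum_scale complete iota_norm h1 k0 (d := (act iota g (z, 1)).2^-1) => H.
have {H} := H _; rewrite invr_eq0 => /(_ y0).
rewrite mulVf // exprVn invrK [_^-1 * _]mulrC e2 => <-.
by rewrite {1}e1.
Qed.

Lemma autj_neq0 c z g : nondeg iota c z 1 -> \det g != 0 -> autj (embA iota g) z != 0.
Proof.
move=> h d0; have [c1 h1] := act_nondeg iota_norm h d0.
by have := nondeg_neq0 iota_norm h1; have [_ ->] := lin_act z g.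
Qed.

Lemma embA_cst (A : 'M[Fq]_2) : embA iota (cst A) = map_mx embc A.
Proof. by apply/matrixP => i k; rewrite !mxE. Qed.

Definition linp m n : {poly V} := (iota m)%:P * 'X + (iota n)%:P.

Lemma linpE m n z : (linp m n).[z] = lin z 1 m n.
Proof. by rewrite /linp !hornerE /lin mulr1. Qed.

Definition sterm_poly k (w : ({poly Fq} * {poly Fq}) * ({poly Fq} * {poly Fq})) : {poly V} :=
  let a := linp (1 + 'X * w.1.1) ('X * w.1.2) in
  let b := linp ('X * w.2.1) (1 + 'X * w.2.2) in
  (a ^+ q * b - a * b ^+ q) ^+ k.

Lemma horner_moore2 (a b : {poly V}) z :
  (a ^+ q * b - a * b ^+ q).[z] = moore2 Fq a.[z] b.[z].
Proof. by rewrite /moore2 hornerD hornerN !hornerM !horner_exp. Qed.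

Lemma sterm_polyE k w z : ((sterm_poly k w).[z])^-1 = sterm iota k z 1 w.
Proof.
rewrite /sterm; have [-> ->] := sterm_args iota z 1 w.
by rewrite /sterm_poly horner_exp horner_moore2 !linpE.
Qed.

Lemma sterm_poly_neq0 c k w z : nondeg iota c z 1 -> (sterm_poly k w).[z] != 0.
Proof.
move=> h; rewrite /sterm_poly horner_exp horner_moore2 !linpE.
rewrite expf_neq0 // -(uabs_gt0 (v := v)).
have [h0 _ _ _ _] := moore2_ge iota_norm h (quad_det_neq0 w).
by apply: lt_le_trans h0; rewrite exprn_gt0 //; case: h.
Qed.

Lemma sum_inv_fraction (I : Type) (s : seq I) (D : I -> {poly V}) (b : pred I) (S : set V) :
  (forall i z, S z -> (D i).[z] != 0) ->
  exists P Q : {poly V}, forall z, S z ->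
    Q.[z] != 0 /\ \sum_(i <- s | b i) ((D i).[z])^-1 = P.[z] / Q.[z].
Proof.
move=> hD; elim: s => [|i s [P [Q hPQ]]].
  by exists 0, 1 => z _; rewrite big_nil hornerC horner0 oner_eq0 mul0r.
case bi : (b i); last by exists P, Q => z hz; rewrite big_cons bi; exact: hPQ.
exists (Q + P * D i), (D i * Q) => z hz; have [Q0 E] := hPQ z hz; have D0 := hD i z hz.
rewrite big_cons bi E !hornerE mulf_neq0 //; split=> //.
by move: (D i).[z] Q.[z] P.[z] D0 Q0 => a b' c a0 b0; field; rewrite ?a0 ?b0.
Qed.

(** On an affinoid, [nondeg] holds with one constant c. The bound of [sterm_bound] is therefore
    uniform, and one finite set of terms, a rational function of z, approximates everywhere. *)
Lemma fsum_holo k (K : V) : (0 < k)%N ->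
  rigid_holomorphic iota (fun z => K * fsum iota k z 1).
Proof.
move=> k0 n e e0; set c := q%:R ^- n / q%:R ^+ n : R.
have hnd z : Omega_n iota n z -> nondeg iota c z 1 by exact: (Omega_n_nondeg iota_norm).
pose B := (c ^+ q.+1 / 4) ^- k.
pose e' := e / (1 + v K).
have e'0 : 0 < e' by rewrite divr_gt0 // ltr_wpDr ?uabs_ge0.
have [J hJ] := finite_height_quad Fq (Num.bound (B / e')).
have [P [Q hPQ]] := @sum_inv_fraction _ J (sterm_poly k) (fun w => qdet w == 1)
  (Omega_n iota n) (fun w z hz => sterm_poly_neq0 k w (hnd z hz)).
exists (K%:P * P), Q => z hz; have [Q0 E] := hPQ z hz; split=> //.
have h := hnd z hz; rewrite hornerM hornerC -mulrA -E -mulrBr uabsM uabsBC.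
have -> : \sum_(i <- J | qdet i == 1) (sterm_poly k i).[z]^-1 = \sum_(i <- J) fterm iota k z 1 i.
  by rewrite big_mkcond; apply: eq_bigr => i _; rewrite /fterm sterm_polyE.
have : v (\sum_(i <- J) fterm iota k z 1 i - fsum iota k z 1) < e'.
  apply: sums_tail => //; first exact: (fsumP complete iota_norm h k0).
  move=> w wJ; rewrite /fterm; case: ifP => _; last by rewrite uabs0.
  have hw : (Num.bound (B / e') < quad_height w)%N.
    by rewrite ltnNge; apply: contra wJ; exact: hJ.
  have hb := sterm_bound iota_norm w h k0; rewrite -/B in hb.
  have B0 : 0 < B.
    by rewrite invr_gt0 exprn_gt0 // divr_gt0 // exprn_gt0 //; case: h.
  have hq0 : B / e' < (quad_height w)%:R.
    apply: lt_trans (_ : (Num.bound (B / e'))%:R < _); last by rewrite ltr_nat.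
    by apply: archi_boundP; rewrite divr_ge0 // ltW.
  have q0 : 0 < (quad_height w)%:R :> R by apply: lt_trans hq0; rewrite divr_gt0.
  move: hb; rewrite -ler_pdivlMr // => hb; apply: le_lt_trans hb _.
  by rewrite ltr_pdivrMr // mulrC -ltr_pdivrMr.
rewrite /e' ltr_pdivlMr; last by rewrite ltr_wpDr ?uabs_ge0.
apply: le_lt_trans; rewrite mulrC ler_wpM2l ?uabs_ge0 //.
by rewrite lerDr.
Qed.

End Modularity.

(** * Products and powers of power series *)

Section PowerSeries.
Variables (R : realType) (C : fieldType) (v : ultranorm R C).
Local Notation V := (valued v).
Hypothesis complete : forall F : set_system V, ProperFilter F -> cauchy F -> cvg F.
Implicit Types (c d : nat -> V) (t : V) (B : R).

(** The ratio 1/2 leaves room for a factor n, so that n can serve as the height in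
    [nullfam_height]. *)
Lemma expr_half_le (a : R) (n : nat) : 0 <= a -> a <= 1 / 2 -> a ^+ n * n%:R <= 1.
Proof.
move=> a0 a2; apply: le_trans (_ : (1 / 2) ^+ n * n%:R <= 1).
  by rewrite ler_wpM2r // lerXn2r // nnegrE.
rewrite expr_div_n expr1n mul1r mulrC ler_pdivrMr ?exprn_gt0 // mul1r.
by rewrite -natrX ler_nat ltnW // ltn_expl.
Qed.

Lemma power_series_null c t B : 0 < B -> v t * B <= 1 / 2 ->
  (forall i, v (c i) <= B ^+ i) -> nullfam (fun i => c i * t ^+ i).
Proof.
move=> B0 ht hc; apply: (nullfam_height (B := 1) finite_height_nat) => i.
apply: le_trans (expr_half_le i (mulr_ge0 (uabs_ge0 v t) (ltW B0)) ht).
rewrite ler_wpM2r // uabsM uabsX exprMn mulrC ler_wpM2l ?exprn_ge0 ?uabs_ge0 //.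
Qed.

Lemma geometric_sum t : v t <= 1 / 2 -> sums (fun i => t ^+ i) (1 - t)^-1.
Proof.
move=> ht; have n0 : nullfam (fun i => t ^+ i).
  have : nullfam (fun i => 1 * t ^+ i).
    apply: (@power_series_null (fun=> 1) t 1 ltr01); first by rewrite mulr1.
    by move=> i; rewrite uabs1 expr1n.
  by congr nullfam; apply: funext => i; rewrite mul1r.
have hs := usumP complete n0; set S := usum _ in hs.
have t1 : 1 - t != 0.
  apply/eqP => E; have : v 1 <= 1 / 2 by rewrite -[1](subrK t) E add0r.
  by rewrite uabs1; lra.
have h1 : sums (fun i => if i is i'.+1 then t ^+ i'.+1 else 0) (t * S).
  apply: (sums_inj (f := succn)) => [i k []//|[|i] // /(_ i)//|].
  by apply: eq_sums (sumsZ t hs) => i; rewrite exprS.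
have h2 : sums (fun i : nat => if i == 0%N then 1 else 0 : V) 1.
  have := @sums_one _ _ v _ (fun i : nat => if i == 0%N then 1 else 0 : V) 0%N; apply.
  by move=> i /negPf ->.
have E : S = 1 + t * S.
  by apply: (sums_unique hs); apply: eq_sums (sumsD h2 h1) => -[|i]; rewrite ?addr0 ?add0r.
suff -> : (1 - t)^-1 = S by [].
apply: (mulfI t1); rewrite divff // mulrBl mul1r {1}E addrK //.
Qed.

Definition conv c d j : V := \sum_(i < j.+1) c i * d (j - i)%N.

Lemma conv_bound c d B j : 0 <= B -> (forall i, v (c i) <= B ^+ i) ->
  (forall i, v (d i) <= B ^+ i) -> v (conv c d j) <= B ^+ j.
Proof.
move=> B0 hc hd; apply: uabs_sum_le; first exact: exprn_ge0.
move=> i _ _; rewrite uabsM.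
have -> : B ^+ j = B ^+ i * B ^+ (j - i) by rewrite -exprD subnKC // -ltnS.
by rewrite ler_pM ?uabs_ge0.
Qed.

Lemma conv_low c d a b j : (forall i, (i < a)%N -> c i = 0) ->
  (forall i, (i < b)%N -> d i = 0) -> (j < a + b)%N -> conv c d j = 0.
Proof.
move=> hc hd hj; rewrite /conv big1 // => i _.
have [hi|hi] := ltnP i a; first by rewrite hc ?mul0r.
rewrite hd ?mulr0 //; have := ltn_ord i; rewrite ltnS => ij.
by rewrite ltn_subLR //; apply: leq_trans hj _; rewrite leq_add2r.
Qed.

Lemma sums_conv c d t B s s' : 0 < B -> v t * B <= 1 / 2 ->
  (forall i, v (c i) <= B ^+ i) -> (forall i, v (d i) <= B ^+ i) ->
  sums (fun i => c i * t ^+ i) s -> sums (fun i => d i * t ^+ i) s' ->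
  sums (fun j => conv c d j * t ^+ j) (s * s').
Proof.
move=> B0 ht hc hd hs hs'.
pose F (p : nat * nat) := (c p.1 * t ^+ p.1) * (d p.2 * t ^+ p.2).
have hF : sums F (s * s').
  apply: (pair_sums complete (G := fun i => c i * t ^+ i * s')).
  - have fh := finite_height_pair finite_height_nat finite_height_nat.
    apply: (nullfam_height (B := 1) fh) => -[i k] /=.
    have a0 : 0 <= v t * B by rewrite mulr_ge0 ?uabs_ge0 // ltW.
    apply: le_trans (expr_half_le (i + k) a0 ht).
    rewrite ler_wpM2r // /F /= !uabsM !uabsX exprD !exprMn.
    by rewrite ler_pM ?mulr_ge0 ?exprn_ge0 ?uabs_ge0 // mulrC ler_wpM2l ?exprn_ge0 ?uabs_ge0.
  - by move=> i; exact: (sumsZ (c i * t ^+ i) hs').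
  by rewrite mulrC; apply: eq_sums (sumsZ s' hs) => i; rewrite mulrC.
apply: (sums_fiber hF (p := fun p => (p.1 + p.2)%N)) => j.
rewrite /conv mulr_suml.
apply: (sums_inj (f := fun i : 'I_j.+1 => (nat_of_ord i, (j - i)%N))).
- by move=> i i' [/val_inj].
- move=> [i k] /= h; case: eqP => // E; case: (h (inord i)).
  by rewrite inordK ?ltnS -?E ?leq_addr // addKn.
have := @sums_finite _ _ v _ (fun i : 'I_j.+1 => c i * d (j - i)%N * t ^+ j).
apply: eq_sums => i /=.
have ij : (i <= j)%N by rewrite -ltnS.
by rewrite subnKC // eqxx /F /= mulrACA -exprD subnKC.
Qed.

Fixpoint pconv c k : nat -> V :=
  if k is k'.+1 then conv c (pconv c k') else fun i => (i == 0%N)%:R.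

Lemma pconv_bound c B k j : 0 <= B -> (forall i, v (c i) <= B ^+ i) ->
  v (pconv c k j) <= B ^+ j.
Proof.
move=> B0 hc; elim: k j => [|k IH] j /=; last exact: conv_bound.
by case: j => [|j]; rewrite /= ?uabs1 ?uabs0 ?exprn_ge0.
Qed.

Lemma pconv_low c a k j : (forall i, (i < a)%N -> c i = 0) -> (j < k * a)%N ->
  pconv c k j = 0.
Proof.
move=> hc; elim: k j => [|k IH] j //=; rewrite mulSn => hj.
exact: (conv_low hc IH hj).
Qed.

Lemma sums_pconv c t B s k : 0 < B -> v t * B <= 1 / 2 ->
  (forall i, v (c i) <= B ^+ i) -> sums (fun i => c i * t ^+ i) s ->
  sums (fun j => pconv c k j * t ^+ j) (s ^+ k).
Proof.
move=> B0 ht hc hs; elim: k => [|k IH] /=; last first.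
  rewrite exprS; apply: (sums_conv B0 ht hc _ hs IH) => i.
  by apply: pconv_bound => //; exact: ltW.
have := @sums_one _ _ v _ (fun j : nat => (j == 0%N)%:R * t ^+ j : V) 0%N.
by rewrite expr0 mulr1; apply=> i /negPf ->; rewrite mul0r.
Qed.

End PowerSeries.

(** * The expansion at infinity *)

Section CuspExpansion.
Variables (R : realType) (Fq : finFieldType) (C : fieldType) (v : ultranorm R C).
Local Notation V := (valued v).
Variable iota : {rmorphism {poly Fq} -> V}.
Local Notation q := #|Fq|.
Implicit Types (m s : {poly Fq}) (x y z : V).
Local Notation T := (iota 'X).
Local Notation lin := (lin iota).
Hypothesis complete : forall F : set_system V, ProperFilter F -> cauchy F -> cvg F.
Hypothesis iota_norm : forall p, p != 0 -> v (iota p) = q%:R ^+ (size p).-1.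

Let T0 : T != 0 := T_neq0 iota_norm.

(** The exponential function of T A, taken as a limit of [espan] so as to inherit F_q-linearity. *)
Definition eT x : V := xget 0 [set l | vlim (fun N => espan Fq (powers iota T N) x) l].

Lemma eTP x : vlim (fun N => espan Fq (powers iota T N) x) (eT x).
Proof. by have [l hl] := espan_lim complete iota_norm x T0; apply: (@xgetPex _ 0 _); exists l. Qed.

Lemma eT_fqlin : fqlin (jj iota) eT.
Proof.
split=> [x y|c x].
  apply: (vlim_unique (eTP (x + y))); apply: eq_vlim (vlimD (eTP x) (eTP y)) => N.
  by rewrite (fqlinD (espan_fqlin (jj iota) _)).
apply: (vlim_unique (eTP _)); apply: eq_vlim (vlimM (vlim_cst _) (eTP x)) => N.
by rewrite (fqlinZ (espan_fqlin (jj iota) _)).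
Qed.

Lemma eT_le x : v x <= 1 -> v (eT x) <= 1.
Proof.
move=> hx; apply: (@vlim_le _ _ _ _ _ 1 0 (eTP x)) => N _.
rewrite (espan_powers_prod iota_norm) // uabsM; apply: mulr_ile1 => //; rewrite ?uabs_ge0 //.
set P := \prod_(_ <- _ | _) _; suff : v (P - 1) < 1.
  by move=> h; rewrite -(subrK 1 P) uabsD_le ?uabs1 // ltW.
apply: uabs_prod_1D => // n _ n0; rewrite uabsN uabsM uabsV uabsM (iota_X iota_norm).
have n1 := iota_ge1 iota_norm n0.
rewrite ltr_pdivrMr ?mulr_gt0 ?q_gt0 ?(lt_le_trans ltr01) // mul1r.
apply: le_lt_trans hx _; apply: lt_le_trans (q_gt1 R Fq) _.
by rewrite ler_peMl // ltW // q_gt0.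
Qed.

Lemma nondeg_z_neq0 c z m s n : nondeg iota c z 1 -> m != 0 ->
  z + iota s / iota m + iota n * T != 0.
Proof.
move=> h m0; have im0 : iota m != 0 by rewrite (iota_eq0 iota_norm).
have := lin_eq0 iota_norm m (s + n * 'X * m) h; rewrite (negPf m0) /= => /negbT.
rewrite /lin mulr1 rmorphD !rmorphM; apply: contraNneq => E.
rewrite -[X in _ == X](mulr0 (iota m)) -E; apply/eqP.
by move: (iota m) im0 (iota s) (iota n) (T) => M M0 S N U; field.
Qed.

Lemma usumZ (I : choiceType) (F : I -> V) (a : V) : nullfam F ->
  usum (fun i => a * F i) = a * usum F.
Proof. by move=> hF; apply: usumE; apply: sumsZ; exact: usumP. Qed.

Lemma tlattT_sums c z : nondeg iota c z 1 ->
  sums (fun n => (z + iota n * T)^-1) (tlatt (lattTA iota) z).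
Proof.
move=> h; rewrite lattTA_lattice (tlatt_lattice complete iota_norm) //.
  by apply: (usumP complete); exact: (lattice_sum_null iota_norm).
move=> n; have := nondeg_z_neq0 0 n h (oner_neq0 _).
by rewrite rmorph0 mul0r addr0.
Qed.

Lemma tlattT_eT c z : nondeg iota c z 1 -> tlatt (lattTA iota) z * eT z = 1.
Proof.
move=> h; rewrite -(usumE (tlattT_sums h)); apply: (lattice_sum_espan complete iota_norm) => //.
  by move=> n; have := nondeg_z_neq0 0 n h (oner_neq0 _); rewrite rmorph0 mul0r addr0.
exact: eTP.
Qed.

(** As e is additive, 1 / e(z + s/m) = 1 / (e(z) + rho), with e(z) = 1 / t. *)
Lemma tlattT_shift c z m s (t := tlatt (lattTA iota) z) (rho := eT (iota s / iota m)) :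
  nondeg iota c z 1 -> m != 0 ->
  usum (fun n => (z + iota s / iota m + iota n * T)^-1) = t / (1 + t * rho).
Proof.
move=> h m0; have := lattice_sum_espan complete iota_norm T0
  (fun n => nondeg_z_neq0 s n h m0) (eTP _).
rewrite (fqlinD eT_fqlin) -/rho; have := tlattT_eT h; rewrite -/t.
move: (usum _) (eT z) t rho => U e t rho te Ue.
have t0 : t != 0 by apply: contra_eqN te => /eqP ->; rewrite mul0r eq_sym oner_neq0.
have E : 1 + t * rho = t * (e + rho) by rewrite mulrDr te.
have e0 : e + rho != 0.
  by apply: contra_eqN Ue => /eqP ->; rewrite mulr0 eq_sym oner_neq0.
by rewrite E invfM mulrA divff // mul1r; apply: (mulIf e0); rewrite Ue mulVf.
Qed.

(* Sort the n in the sum of 1 / (m z + n) by their residues s modulo T m. *)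
Lemma tsum_cusp c z m (t := tlatt (lattTA iota) z) : nondeg iota c z 1 -> m != 0 ->
  tsum iota 1 z 1 m =
  (iota m)^-1 * \sum_(s <- polys Fq (size m)) t / (1 + t * eT (iota s / iota m)).
Proof.
move=> h m0; have im0 : iota m != 0 by rewrite (iota_eq0 iota_norm).
have hs := tsumP complete iota_norm m h (ltn0Sn 0).
have Xm0 : 'X * m != 0 by rewrite mulf_neq0 // polyX_eq0.
rewrite -(residue_sum_coprime complete Xm0 hs (coprime1p _)) mulrC size_mulX //= mulr_sumr.
apply: eq_bigr => s _; rewrite -(tlattT_shift s h m0) -usumZ; last first.
  by have := lattice_sum_null iota_norm (z + iota s / iota m) T0.
congr usum; apply: funext => n; rewrite /tterm expr1 /lin mul1r mulr1 -invfM.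
congr (_^-1); rewrite rmorphD !rmorphM.
by move: (iota m) im0 (iota s) (iota n) (T) => M M0 S N U; field.
Qed.

(** Every term of the sum for t is at most 1 / (2 q) once |z|_i > 2 q. The coefficients of the
    expansion grow at most like q^i, whence the product with q. *)
Lemma tlattT_small c z : nondeg iota c z 1 -> 2 * q%:R < imnorm iota z ->
  v (tlatt (lattTA iota) z) * q%:R <= 1 / 2.
Proof.
move=> h hB; have q0 := q_gt0 R Fq.
suff : v (tlatt (lattTA iota) z) <= (2 * q%:R)^-1.
  by move=> ht; rewrite -ler_pdivlMr //; apply: le_trans ht _; rewrite invfM mul1r.
have B0 : 0 < 2 * q%:R :> R by rewrite mulr_gt0.
apply: (sums_le _ (tlattT_sums h)) => [|n]; first by rewrite invr_ge0 ltW.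
rewrite uabsV; have hn : imnorm iota z <= v (z + iota n * T).
  have := @imnorm_le _ _ _ _ iota z (- (iota n * T)); rewrite opprK; apply.
  have := fraction_Finfty iota_norm (- (n * 'X)) (oner_neq0 _).
  by rewrite rmorph1 divr1 rmorphN rmorphM.
have := lt_le_trans hB hn => h1.
by rewrite lef_pV2 ?posrE ?ltW // (lt_trans B0).
Qed.

(** The coefficient of t^(i+1) in m^q \sum_n (m z + n)^-1, from the geometric series of t / (1 + t
    rho) over the residues s; one factor m is lost to the 1 / m of [tsum_cusp]. *)
Definition cusp_coef m i : V :=
  (-1) ^+ i * iota m ^+ q.-1 * \sum_(s <- polys Fq (size m)) eT (iota s / iota m) ^+ i.

Lemma sum_eT_pow0 m i : (i < size m * q.-1)%N ->
  \sum_(s <- polys Fq (size m)) eT (iota s / iota m) ^+ i = 0.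
Proof.
move=> hi; pose f w := eT (w / iota m).
have fl (k : unit) : fqlin (jj iota) f.
  split=> [x y|c x]; first by rewrite /f mulrDl (fqlinD eT_fqlin).
  by rewrite /f -mulrA (fqlinZ eT_fqlin).
have := @sum_span_prod_lin Fq _ (jj iota) unit (fun=> f) (powers iota 1 (size m)) (nseq i tt) fl.
rewrite size_nseq size_mkseq => /(_ hi).
rewrite (sum_powers iota 1 (size m) (fun w => \prod_(k <- nseq i tt) f w)) => E.
rewrite -[RHS]E; apply: eq_bigr => s _; rewrite big_const_seq count_predT size_nseq.
by rewrite /f mulr1; elim: i {hi E} => //= i <-; rewrite exprS.
Qed.

Lemma cusp_coef0 m i : (i < size m * q.-1)%N -> cusp_coef m i = 0.
Proof. by move=> hi; rewrite /cusp_coef sum_eT_pow0 // mulr0. Qed.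

Lemma cusp_coef_zero i : cusp_coef 0 i = 0.
Proof.
rewrite /cusp_coef rmorph0 expr0n; have := card_gt1 Fq.
by case: q => [|[|k]] //= _; rewrite mulr0 mul0r.
Qed.

(** The coefficient vanishes for i < (q - 1) size m, while |m|^(q-1) = q^((q - 1) (size m - 1)) and
    the power sums have absolute value at most 1. *)
Lemma cusp_coef_le m i : v (cusp_coef m i) <= q%:R ^+ i.
Proof.
have qi : 0 <= (q%:R : R) ^+ i by rewrite exprn_ge0.
have [hi|hi] := ltnP i (size m * q.-1); first by rewrite cusp_coef0 // uabs0.
have [->|m0] := eqVneq m 0; first by rewrite cusp_coef_zero uabs0.
rewrite /cusp_coef !uabsM !uabsX uabsN uabs1 expr1n mul1r iota_norm // -exprM.
have im0 : iota m != 0 by rewrite (iota_eq0 iota_norm).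
apply: le_trans (_ : q%:R ^+ ((size m).-1 * q.-1) * 1 <= _).
  rewrite ler_wpM2l ?exprn_ge0 //; apply: uabs_sum_le => // s hs _.
  rewrite uabsX exprn_ile1 ?uabs_ge0 //; apply: eT_le.
  rewrite uabsM uabsV ler_pdivrMr ?uabs_gt0 // mul1r.
  have [->|s0] := eqVneq s 0; first by rewrite rmorph0 uabs0 uabs_ge0.
  rewrite !iota_norm // ler_eXn2l ?q_gt1 //.
  by move: hs; rewrite mem_polys; case: (size s) (size m) => [|a] [|b].
rewrite mulr1 ler_weXn2l //; first by rewrite ltW ?q_gt1.
by apply: leq_trans hi; rewrite leq_mul2r leq_pred orbT.
Qed.

Lemma cusp_term_key (a t e : V) i :
  a * (t * (- (t * e)) ^+ i) = (-1) ^+ i * a * e ^+ i * t ^+ i.+1.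
Proof. by rewrite -[- (t * e)]mulN1r !exprMn exprS; ring. Qed.

Lemma cusp_term_sums c z m (t := tlatt (lattTA iota) z) : nondeg iota c z 1 ->
  v t * q%:R <= 1 / 2 ->
  sums (fun i => cusp_coef m i * t ^+ i.+1) (iota m ^+ (1 * q) * tsum iota 1 z 1 m).
Proof.
move=> h ht; have q1 := card_gt1 Fq.
have [->|m0] := eqVneq m 0.
  rewrite rmorph0 mul1n expr0n; have -> : (q == 0)%N = false by case: q q1.
  by rewrite mul0r; apply: eq_sums (sums0 _ _) => i; rewrite cusp_coef_zero mul0r.
have im0 : iota m != 0 by rewrite (iota_eq0 iota_norm).
rewrite (tsum_cusp h m0) -/t mul1n -(prednK (card_gt0 Fq)) exprSr mulrA mulfK //.
have hS s : s \in polys Fq (size m) ->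
    sums (fun i => (- (t * eT (iota s / iota m))) ^+ i) (1 + t * eT (iota s / iota m))^-1.
  move=> hs; rewrite -[X in 1 + X]opprK; apply: geometric_sum => //.
  rewrite uabsN uabsM; apply: le_trans ht; rewrite ler_wpM2l ?uabs_ge0 //.
  apply: le_trans (ltW (q_gt1 R Fq)); apply: eT_le.
  rewrite uabsM uabsV ler_pdivrMr ?uabs_gt0 // mul1r.
  have [->|s0] := eqVneq s 0; first by rewrite rmorph0 uabs0 uabs_ge0.
  rewrite !iota_norm // ler_eXn2l ?q_gt1 //.
  by move: hs; rewrite mem_polys; case: (size s) (size m) => [|a] [|b].
pose F s i := if s \in polys Fq (size m) then t * (- (t * eT (iota s / iota m))) ^+ i else 0.
have hF s : sums (F s) (if s \in polys Fq (size m) then t / (1 + t * eT (iota s / iota m)) else 0).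
  rewrite /F; case: ifP => hs; last exact: sums0.
  exact: sumsZ (hS s hs).
rewrite big_seq big_mkcond /=.
apply: eq_sums (sumsZ (iota m ^+ q.-1) (sums_sum (polys Fq (size m)) hF)) => i.
rewrite /cusp_coef big_seq [in RHS]big_seq /F !mulr_sumr mulr_suml; apply: eq_bigr => s ->.
exact: cusp_term_key.
Qed.

(** The coefficient of t^j in F_1. The sum over all m reduces to sizes at most j, as [cusp_coef m i]
    vanishes for i < size m. *)
Definition hcoef j : V := if j is i.+1 then \sum_(m <- polys Fq j) cusp_coef m i else 0.

Lemma hcoef_le j : v (hcoef j) <= q%:R ^+ j.
Proof.
case: j => [|i]; first by rewrite uabs0 expr0.
apply: uabs_sum_le => [|m _ _]; first exact: exprn_ge0.
apply: le_trans (cusp_coef_le m i) _; rewrite ler_weXn2l //.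
by rewrite ltW ?q_gt1.
Qed.

(** Nonzero m have size at least 1, so the exponents i start at q - 1 and j = i + 1 at q. *)
Lemma hcoef_low j : (j < q)%N -> hcoef j = 0.
Proof.
case: j => [|i] // hi; rewrite /hcoef big1 // => m _.
have [->|m0] := eqVneq m 0; first exact: cusp_coef_zero.
rewrite cusp_coef0 //; apply: leq_trans (_ : q.-1 <= _)%N.
  by rewrite -ltnS prednK // card_gt0.
by rewrite leq_pmull // size_poly_gt0.
Qed.

Lemma Fsum_cusp c z (t := tlatt (lattTA iota) z) : nondeg iota c z 1 ->
  v t * q%:R <= 1 / 2 -> sums (fun j => hcoef j * t ^+ j) (Fsum iota 1 z 1).
Proof.
move=> h ht; have q1 := card_gt1 Fq.
have hk : (0 < 1 <= q)%N by rewrite card_gt0.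
pose F (mi : {poly Fq} * nat) := cusp_coef mi.1 mi.2 * t ^+ mi.2.+1.
have big m i : (i < size m)%N -> cusp_coef m i = 0.
  move=> hi; apply: cusp_coef0; apply: leq_trans hi _.
  by rewrite leq_pmulr // -ltnS prednK // card_gt0.
have t1 : v t <= 1.
  apply: le_trans (_ : v t * q%:R <= _); last by lra.
  by rewrite ler_peMr ?uabs_ge0 // ltW // q_gt1.
have nF : nullfam F.
  (* On nonzero terms size m <= i, so the height size m + i is at most 2 i. *)
  apply: (nullfam_height (B := 2) (finite_height_pair (finite_height_poly Fq) finite_height_nat)).
  move=> [m i]; rewrite /F /=; have [hi|hi] := ltnP i (size m).
    by rewrite big // mul0r uabs0 mul0r.
  have a0 : 0 <= v t * q%:R by rewrite mulr_ge0 ?uabs_ge0.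
  have e1 := expr_half_le i a0 ht.
  apply: le_trans (_ : (v t * q%:R) ^+ i * (2 * i%:R) <= _); last first.
    by rewrite mulrCA -[leRHS]mulr1 ler_wpM2l.
  rewrite ler_pM ?uabs_ge0 //; last first.
    by rewrite -natrM ler_nat mul2n -addnn leq_add2r.
  rewrite uabsM uabsX exprMn [leRHS]mulrC ler_pM ?exprn_ge0 ?uabs_ge0 ?cusp_coef_le //.
  by rewrite exprS ler_piMl ?exprn_ge0 ?uabs_ge0.
have hH i : sums (fun m => F (m, i)) (hcoef i.+1 * t ^+ i.+1).
  rewrite /hcoef mulr_suml -big_polyset; apply: sums_fset => m.
  by rewrite in_fset mem_polys -ltnNge => hm; rewrite /F /= big ?mul0r // ltnW.
have := pair_sums_swap complete nF (fun m => cusp_term_sums m h ht) hH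
  (FsumP complete iota_norm h hk) => hs.
apply: (sums_inj (f := succn)) => [i i' [] //|[_|i /(_ i)//]|]; last exact: hs.
by rewrite mul0r.
Qed.

(** At y = 1, F_1 = - K zeta_1 f_1. Since f_k = f_1^k, the series wanted is the k-th power of that
    of F_1, which multiplies the order q by k; the constant goes into A. *)
Lemma fsum_cusp k : odd q -> (0 < k < q)%N -> exists (c : nat -> V) (A : V),
  [/\ forall j, (j < k * q)%N -> c j = 0,
      forall x, v x * q%:R <= 1 / 2 -> nullfam (fun j => c j * x ^+ j)
    & forall z, Omega iota z -> 2 * q%:R < imnorm iota z ->
        sums (fun j => c j * tlatt (lattTA iota) z ^+ j) (A * fsum iota k z 1) /\ A != 0].
Proof.
move=> oq hk; have [K K0 hK] := Fsum_Ssum complete iota_norm oq.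
have q1 := card_gt1 Fq; have q0 := q_gt0 R Fq.
have z1 := zeta_neq0 complete iota_norm (ltn0Sn 0).
exists (pconv hcoef k), ((- (K * zeta iota 1)) ^+ k); split.
- by move=> j; apply: pconv_low; exact: hcoef_low.
- move=> x hx; apply: (power_series_null q0 hx) => j; apply: pconv_bound; first exact: ltW.
  exact: hcoef_le.
move=> z hz hB; have [c h] := Omega_nondeg iota_norm hz.
split; last by rewrite expf_neq0 // oppr_eq0 mulf_neq0.
rewrite (fsum_pow complete iota_norm oq h hk) -exprMn.
have -> : - (K * zeta iota 1) * fsum iota 1 z 1 = Fsum iota 1 z 1.
  rewrite (hK c) // (fsum_Ssum complete iota_norm oq h) ?q1 // expr1n mulr1 expr1.
  by move: (zeta _ _) z1 (Ssum _ _ _ _) => Z Z0 S; field.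
have ht := tlattT_small h hB.
exact: (sums_pconv complete k q0 ht hcoef_le (Fsum_cusp h ht)).
Qed.

End CuspExpansion.

(** * Modularity of f_kappa^T *)

Section ModularForm.
Variables (R : realType) (Fq : finFieldType) (C : fieldType) (v : ultranorm R C).
Local Notation V := (valued v).
Variable iota : {rmorphism {poly Fq} -> V}.
Local Notation q := #|Fq|.
Implicit Types (x y z : V).
Hypothesis complete : forall F : set_system V, ProperFilter F -> cauchy F -> cvg F.
Hypothesis iota_norm : forall p, p != 0 -> v (iota p) = q%:R ^+ (size p).-1.

Lemma modform_fT k r (a b : 'I_r -> option Fq) : odd q -> (0 < k < q)%N ->
  pair_decomposition a b -> modform iota (k * q.+1) (k * q) (fT iota k a b).
Proof.
move=> oq hk hab; have k0 : (0 < k)%N by case/andP: hk.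
have fTE c z : nondeg iota c z 1 -> fT iota k a b z = _ :=
  fun h => fT_fsum complete iota_norm h k0 hab.
set K := embc iota _ ^+ k in fTE.
split.
- move=> n e e0; have [P [Q h]] := fsum_holo complete iota_norm K k0 n e0.
  exists P, Q => z hz; have := h z hz.
  by rewrite (fTE _ _ (Omega_n_nondeg iota_norm hz)).
- move=> g z hg /(Omega_nondeg iota_norm)[c h].
  have d1 : \det g != 0 by case/GammaTE: hg => ->; rewrite oner_eq0.
  have [c1 h1] := nondeg_moebius iota_norm h d1.
  rewrite (fTE _ _ h) (fTE _ _ h1) (fsum_moebius complete iota_norm h d1 k0).
  by rewrite (fsum_GammaT complete iota_norm h k0 hg) mulrCA.
move=> nu nuu; have [c [A [c0 cn cs]]] := fsum_cusp complete iota_norm oq hk.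
have q0 := q_gt0 R Fq.
(* K is the constant of f_kappa^T, the power of det nu comes from moving nu across Gamma(T), and 1 /
   A removes the normalization of [fsum_cusp]: one expansion serves all cusps. *)
pose B := K * embc iota (\det nu) ^- k / A.
exists (fun j => B * c j), (2 * q%:R)^-1, (2 * q%:R); split.
- by rewrite invr_gt0 mulr_gt0.
- by move=> m hm; rewrite c0 // mulr0.
- move=> x hx; have nx : nullfam (fun j => c j * x ^+ j).
    apply: cn; rewrite -ler_pdivlMr //; apply: le_trans (ltW hx) _.
    by rewrite invfM mul1r.
  apply/cvg_ex; exists (B * usum (fun j => c j * x ^+ j)).
  apply: sums_series; apply: eq_sums (sumsZ B (usumP complete nx)) => j.
  by rewrite mulrA.
move=> z hz hB; have [d h] := Omega_nondeg iota_norm hz.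
have [hs A0] := cs z hz hB.
have d1 : \det (cst nu) != 0.
  by rewrite det_cst polyC_eq0; move: nuu; rewrite unitmxE unitfE.
have [d2 h2] := nondeg_moebius iota_norm h d1.
have j0 := autj_neq0 iota_norm h d1.
rewrite -embA_cst (fTE _ _ h2) (fsum_moebius complete iota_norm h d1 k0).
rewrite (fsum_cst complete iota_norm h k0 nuu).
rewrite [X in _ --> X](_ : _ = B * (A * fsum iota k z 1)); last first.
  rewrite [LHS]mulrCA mulKf ?expf_neq0 // /B -!mulrA.
  by congr (_ * (_ * _)); rewrite mulKf.
by apply: sums_series; apply: eq_sums (sumsZ B hs) => j; rewrite mulrA.
Qed.

End ModularForm.

Theorem theorem6p4p3 (R : realType) (Fq : finFieldType)
    (C : fieldType) (v : ultranorm R C)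
    (iota : {rmorphism {poly Fq} -> valued v})
    (kappa r : nat) (a b : 'I_r -> option Fq)
    (hC : is_Cinfty iota)
    (hq : odd #|Fq|)
    (hkappa : (1 <= kappa <= #|Fq| - 1)%N)
    (hr : r = ((#|Fq| + 1) %/ 2)%N)
    (hab : pair_decomposition a b) :
  [/\ modform iota (kappa * (#|Fq| + 1)) (kappa * #|Fq|) (fT iota kappa a b),
      (* infinity is one of the a_i *)
      (exists i, a i = None) -> forall z : valued v, Omega iota z ->
        fT iota kappa a b z =
          embc iota (C0 a b) ^+ kappa * hform iota z ^+ kappa
    & (* infinity is one of the b_i *)
      (exists i, b i = None) -> forall z : valued v, Omega iota z ->
        fT iota kappa a b z =
          embc iota (- C0 a b) ^+ kappa * hform iota z ^+ kappa].
Proof.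
have [complete iota_norm _] := hC; have q0 := card_gt0 Fq.
have hk : (0 < kappa < #|Fq|)%N.
  by move: hkappa q0; case: #|Fq| => // n; rewrite subn1.
have k0 : (0 < kappa)%N by case/andP: hk.
(* The minus sign arises because the product of the q + 1 denominators is - D; the side on which
   infinity lies then decides between C0 and - C0. *)
have fTE z : Omega iota z -> fT iota kappa a b z =
    embc iota (- pair_const a b) ^+ kappa * hform iota z ^+ kappa.
  move=> /(Omega_nondeg iota_norm)[c h].
  rewrite (fT_fsum complete iota_norm h k0 hab) (hform_fsum complete iota_norm h).
  by rewrite (fsum_pow complete iota_norm hq h hk).
split=> [|ha z hz|hb z hz]; first by rewrite addn1; exact: modform_fT.
  by rewrite fTE // pair_const_a // opprK.
by rewrite fTE // pair_const_b.
Qed.
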